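(* Let $\mathcal C$ be a monotone graph class. Then $\mathcal C$ has bounded spanning twin-width (i.e., there is a constant $c$ such that every graph in $\mathcal C$ has spanning twin-width at most $c$) if and only if there exists an integer $t$ such that no graph in $\mathcal C$ has the complete graph $K_t$ as a minor.
   Context: A monotone graph class is a class of finite simple graphs closed under isomorphism and under taking (not necessarily induced) subgraphs. Tree orders: a partial order $\preceq$ on a set is a tree order if it has a minimum element and any two elements below a common element are comparable. Write $x\prec^c y$ if $x\prec y$ and there is no $z$ with $x\prec z\prec y$. For a connected graph $G$, a tree order $\preceq$ on $V(G)$ is compatible with $G$ if $uv\in E(G)$ whenever $u\prec^c v$. Twin-width of a binary structure: for a finite set $V$ with binary relations $E$ and $\preceq$, form the $V\times V$ matrix whose entry at $(x,y)$ encodes which of the atomic facts $x=y$, $E(x,y)$, $E(y,x)$, $x\preceq y$, $y\preceq x$ hold. For a matrix $M$, a contraction sequence is a sequence of pairs (row-partition, column-partition) starting from the partition into singletons on both sides, ending with both partitions having a single part, each pair obtained from the previous by merging two row parts or two column parts. A zone is the submatrix $R\cap C$ for a row part $R$ and column part $C$; it is constant if all its entries are equal. The error value of a row part $R$ is the number of column parts $C$ such that $R\cap C$ is non-constant (symmetrically for column parts), and the error value of a pair of partitions is the maximum over all parts. The twin-width of $M$ is the minimum over contraction sequences of the maximum error value along the sequence; the twin-width of the structure $(G,\preceq)$ is that of its matrix. The spanning twin-width of a connected graph $G$ is the minimum twin-width of $(G,\preceq)$ over all tree orders $\preceq$ on $V(G)$ compatible with $G$; for a disconnected graph it is the maximum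 spanning twin-width of its connected components. *)

(* Defs.v *)
From mathcomp Require Import all_boot.
From mathcomp Require Import boolp.

Set Implicit Arguments.
Unset Strict Implicit.
Unset Printing Implicit Defensive.

Record sgraph := SGraph {
  svertex :> finType;
  sedge : rel svertex;
  sedge_sym : symmetric sedge;
  sedge_irr : irreflexive sedge }.

Section Subgraphs.
Variable G : sgraph.

(* The subgraph with vertex set [W] whose edges are the edges of [G] inside
   [W] that belong to [F]; edges are unordered pairs [set x; y]. *)
Definition subgraph_edge (W : {set G}) (F : {set {set G}}) :
    rel {x : G | x \in W} :=
  fun x y => ([set val x; val y] \in F) && sedge (val x) (val y).

Lemma subgraph_edge_sym W F : symmetric (@subgraph_edge W F).
Proof. by move=> x y; rewrite /subgraph_edge setUC sedge_sym. Qed.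

Lemma subgraph_edge_irr W F : irreflexive (@subgraph_edge W F).
Proof. by move=> x; rewrite /subgraph_edge sedge_irr andbF. Qed.

Definition subgraph (W : {set G}) (F : {set {set G}}) : sgraph :=
  SGraph (@subgraph_edge_sym W F) (@subgraph_edge_irr W F).

Definition induced_edge (W : {set G}) : rel {x : G | x \in W} :=
  fun x y => sedge (val x) (val y).

Lemma induced_edge_sym W : symmetric (@induced_edge W).
Proof. by move=> x y; rewrite /induced_edge sedge_sym. Qed.

Lemma induced_edge_irr W : irreflexive (@induced_edge W).
Proof. by move=> x; rewrite /induced_edge sedge_irr. Qed.

Definition induced (W : {set G}) : sgraph :=
  SGraph (@induced_edge_sym W) (@induced_edge_irr W).

End Subgraphs.

Definition isomorphic (G H : sgraph) : Prop :=
  exists f : G -> H, bijective f /\ {mono f : x y / sedge x y}.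

Definition monotone_class (C : sgraph -> Prop) : Prop :=
  (forall G H : sgraph, isomorphic G H -> C G -> C H) /\
  (forall (G : sgraph) (W : {set G}) (F : {set {set G}}),
      C G -> C (subgraph W F)).

Definition connected (G : sgraph) : Prop :=
  forall x y : G, connect (@sedge G) x y.

Definition component (G : sgraph) (x : G) : sgraph :=
  induced [set y | connect (@sedge G) x y].

Lemma mem_component (G : sgraph) (x : G) :
  x \in [set y | connect (@sedge G) x y].
Proof. by rewrite inE connect0. Qed.

Definition component_root (G : sgraph) (x : G) : component x :=
  exist _ x (mem_component x).

(* [B] assigns to each vertex of [H] its branch set in [G]. *)
Definition minor (H G : sgraph) : Prop :=
  exists B : H -> {set G},
    [/\ forall u, B u != set0,
        forall u, connected (induced (B u)),
        forall u v, u != v -> [disjoint B u & B v]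
      & forall u v, sedge u v ->
          exists x y, [/\ x \in B u, y \in B v & sedge x y]].

Definition complete_edge (t : nat) : rel 'I_t := fun i j => i != j.

Lemma complete_edge_sym t : symmetric (@complete_edge t).
Proof. by move=> i j; rewrite /complete_edge eq_sym. Qed.

Lemma complete_edge_irr t : irreflexive (@complete_edge t).
Proof. by move=> i; rewrite /complete_edge eqxx. Qed.

Definition complete_graph (t : nat) : sgraph :=
  SGraph (@complete_edge_sym t) (@complete_edge_irr t).

Section Merge.
Variable T : finType.

Definition singletons : {set {set T}} := [set [set x] | x : T].

Definition merge_parts (P P' : {set {set T}}) : bool :=
  [exists A in P, exists B in P,
     (A != B) && (P' == (A :|: B) |: (P :\ A :\ B))].

Lemma merge_partsP_ex (P : {set {set T}}) :
  1 < #|P| -> exists2 P', merge_parts P P' & #|P'| < #|P|.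
Proof.
case/card_gt1P=> A [B [AP BP nAB]].
exists ((A :|: B) |: (P :\ A :\ B)).
  by apply/exists_inP; exists A => //; apply/exists_inP; exists B; rewrite // nAB /=.
rewrite (cardsD1 A P) AP (cardsD1 B (P :\ A)) !inE eq_sym nAB BP /=.
by rewrite cardsU1 !add1n ltnS; case: (_ \notin _); rewrite /= ?add0n ?add1n.
Qed.

End Merge.

Section MatrixTwinWidth.
Variables (I J : finType) (A : eqType) (M : I -> J -> A).

Definition partition_pair : Type := ({set {set I}} * {set {set J}})%type.

Definition constant_zone (R : {set I}) (C : {set J}) : bool :=
  [forall i in R, forall j in C, forall i' in R, forall j' in C,
     M i j == M i' j'].

Definition row_error (PQ : partition_pair) (R : {set I}) : nat :=
  #|[set C in PQ.2 | ~~ constant_zone R C]|.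

Definition col_error (PQ : partition_pair) (C : {set J}) : nat :=
  #|[set R in PQ.1 | ~~ constant_zone R C]|.

Definition error_value (PQ : partition_pair) : nat :=
  maxn (\max_(R in PQ.1) row_error PQ R) (\max_(C in PQ.2) col_error PQ C).

Definition contraction_step (PQ PQ' : partition_pair) : bool :=
  (merge_parts PQ.1 PQ'.1 && (PQ'.2 == PQ.2)) ||
  ((PQ'.1 == PQ.1) && merge_parts PQ.2 PQ'.2).

Definition initial_pair : partition_pair := (singletons I, singletons J).

(* The bounds are [<= 1] and not [== 1] so that a matrix with no rows or no
   columns, whose only partition is empty, also has a contraction sequence. *)
Definition final_pair (PQ : partition_pair) : bool :=
  (#|PQ.1| <= 1) && (#|PQ.2| <= 1).

(* [s] lists the pairs that follow [initial_pair]. *)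
Definition contraction_sequence (s : seq partition_pair) : bool :=
  path contraction_step initial_pair s && final_pair (last initial_pair s).

Definition sequence_error (s : seq partition_pair) : nat :=
  \max_(PQ <- initial_pair :: s) error_value PQ.

Lemma contraction_sequence_ex : exists s, contraction_sequence s.
Proof.
suff H n (PQ : partition_pair) : #|PQ.1| + #|PQ.2| <= n ->
    exists s, path contraction_step PQ s && final_pair (last PQ s).
  exact: H (leqnn _).
elim: n PQ => [|n IHn] [P Q] /= le_n.
  exists [::]; rewrite /final_pair /=; move: le_n.
  by rewrite leqn0 addn_eq0 => /andP[/eqP-> /eqP->].
have [P1|P1] := leqP #|P| 1; last first.
  have [P' mP cP] := merge_partsP_ex P1.
  have [|s hs] := IHn (P', Q).
    by rewrite /= -ltnS; apply: leq_trans le_n; rewrite ltn_add2r.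
  by exists ((P', Q) :: s); rewrite /= /contraction_step /= mP eqxx.
have [Q1|Q1] := leqP #|Q| 1; last first.
  have [Q' mQ cQ] := merge_partsP_ex Q1.
  have [|s hs] := IHn (P, Q').
    by rewrite /= -ltnS; apply: leq_trans le_n; rewrite ltn_add2l.
  by exists ((P, Q') :: s); rewrite /= /contraction_step /= mQ eqxx orbT.
by exists [::]; rewrite /final_pair /= P1.
Qed.

Lemma twin_width_ex :
  exists k, `[< exists s, contraction_sequence s /\ sequence_error s = k >].
Proof.
have [s hs] := contraction_sequence_ex.
by exists (sequence_error s); apply/asboolP; exists s.
Qed.

Definition twin_width : nat := ex_minn twin_width_ex.

End MatrixTwinWidth.

Section TreeOrder.
Variable T : finType.

Definition partial_order (le : rel T) : Prop :=
  [/\ reflexive le, antisymmetric le & transitive le].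

Definition tree_order (le : rel T) : Prop :=
  [/\ partial_order le,
      exists r, forall x, le r x
    & forall x y z, le x z -> le y z -> le x y || le y x].

Definition strict (le : rel T) : rel T := fun x y => (x != y) && le x y.

Definition cover (le : rel T) : rel T :=
  fun x y => strict le x y && ~~ [exists z, strict le x z && strict le z y].

End TreeOrder.

Definition compatible (G : sgraph) (le : rel G) : Prop :=
  forall u v : G, cover le u v -> sedge u v.

Definition structure_matrix (T : finType) (e le : rel T) (x y : T) :
    bool * bool * bool * bool * bool :=
  (x == y, e x y, e y x, le x y, le y x).

Section CompatibleOrder.
Variables (G : sgraph) (r : G).
Hypothesis conn : forall x, connect (@sedge G) r x.

Let ball n : {set G} :=
  iter n (fun S => S :|: [set y | [exists x in S, sedge x y]]) [set r].

Lemma ball_ex y : exists n, y \in ball n.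
Proof.
have /connectP[p pp ->] := conn y.
have r0 : r \in ball 0 by rewrite inE.
elim: p {1 2 3}r 0 pp r0 => [|z p IHp] x n /= pp xn; first by exists n.
move: pp => /andP[xz pp]; apply: (IHp z n.+1 pp).
by rewrite /= !inE; apply/orP; right; apply/exists_inP; exists x.
Qed.

Let depth y := ex_minn (ball_ex y).

Lemma parent_ex y : y != r -> exists x, sedge x y && (depth x < depth y).
Proof.
move=> yr; rewrite {2}/depth; case: ex_minnP => -[|n] /=.
  by rewrite inE (negPf yr).
rewrite !inE => /orP[yn /(_ _ yn)|]; first by rewrite ltnn.
case/exists_inP=> x xn xy _; exists x; rewrite xy /= ltnS.
by rewrite /depth; case: ex_minnP => m _; apply.
Qed.

Let parent y := odflt y [pick x | sedge x y && (depth x < depth y)].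

Lemma parentP y : y != r -> sedge (parent y) y && (depth (parent y) < depth y).
Proof.
move=> yr; rewrite /parent; case: pickP => //= none.
by have [x] := parent_ex yr; rewrite none.
Qed.

Lemma parent_r : parent r = r.
Proof.
rewrite /parent; case: pickP => //= x /andP[_].
suff -> : depth r = 0 by [].
by rewrite /depth; case: ex_minnP => m _ /(_ 0); rewrite inE eqxx leqn0 => /(_ isT)/eqP.
Qed.

Lemma depth_parent y : depth (parent y) <= depth y.
Proof.
by have [->|/parentP/andP[_ /ltnW//]] := eqVneq y r; rewrite parent_r.
Qed.

Lemma depth_iter n y : depth (iter n parent y) <= depth y.
Proof. by elim: n => //= n; apply/leq_trans/depth_parent. Qed.

Lemma compatible_tree_order_ex : exists le : rel G, tree_order le /\ compatible le.
Proof.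
pose le : rel G := fun x y => fconnect parent y x.
have leP x y : reflect (exists n, x = iter n parent y) (le x y).
  apply: (iffP idP) => [/iter_findex <-|[n ->]]; last exact: fconnect_iter.
  by exists (findex parent y x).
have le_r x : le r x.
  have [n] := ubnP (depth x); elim: n x => // n IHn x lxn.
  have [->|xr] := eqVneq x r; first exact: connect0.
  have /andP[_ dx] := parentP xr.
  apply: connect_trans (fconnect1 _ _) (IHn _ _).
  exact: leq_trans dx _.
have le_parent x y : x != y -> le x y -> y != r /\ le x (parent y).
  move=> xy /leP[[|n] xE]; first by rewrite xE eqxx in xy.
  split; last by apply/leP; exists n; rewrite xE -iterSr.
  apply/eqP=> yr; case/negP: xy; rewrite xE yr; apply/eqP.
  by elim: n.+1 => //= m ->; rewrite parent_r.
have le_depth x y : le x y -> depth x <= depth y.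
  by case/leP=> n ->; apply: depth_iter.
have lt_depth x y : x != y -> le x y -> depth x < depth y.
  move=> xy lxy; have [yr lp] := le_parent _ _ xy lxy.
  have /andP[_ dy] := parentP yr.
  exact: leq_ltn_trans (le_depth _ _ lp) dy.
exists le; split; first split; first split.
- by move=> x; apply: connect0.
- move=> x y /andP[xy yx]; apply/eqP; apply: contraT => nxy.
  by have := leq_trans (lt_depth _ _ nxy xy) (le_depth _ _ yx); rewrite ltnn.
- by move=> y x z xy yz; apply: connect_trans yz xy.
- by exists r.
- move=> x y z /leP[m ->] /leP[n ->].
  have [/subnK<-|/ltnW/subnK<-] := leqP m n; rewrite iterD.
    by apply/orP; right; apply: fconnect_iter.
  by apply/orP; left; apply: fconnect_iter.
move=> u v /andP[/andP[uv luv] nz].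
have [vr lup] := le_parent _ _ uv luv.
have /andP[epv dv] := parentP vr.
have [->//|nup] := eqVneq u (parent v).
case/negP: nz; apply/existsP; exists (parent v).
rewrite /strict nup lup /=; apply/andP; split; last exact: fconnect1.
by apply: contraTneq dv => ->; rewrite ltnn.
Qed.

End CompatibleOrder.

Lemma component_connected (G : sgraph) (x : G) : connected (component x).
Proof.
have to_x (u : component x) : connect (@sedge (component x)) (component_root x) u.
  have /connectP[p] : connect (@sedge G) x (val u) by have := valP u; rewrite inE.
  elim/last_ind: p u => [|p z IHp] u /=.
    by move=> _ ux; rewrite (_ : u = component_root x) ?connect0 //; apply: val_inj.
  rewrite rcons_path last_rcons => /andP[pp lz] uz.
  have xl : last x p \in [set y | connect (@sedge G) x y].
    by rewrite inE; apply/connectP; exists p.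
  pose w : component x := exist _ (last x p) xl.
  apply: (@connect_trans _ _ w); first exact: (IHp w pp erefl).
  by apply: connect1; rewrite /= /induced_edge /= uz.
move=> u v; apply: connect_trans (to_x v).
by rewrite (sym_connect_sym (@sedge_sym _)).
Qed.

Lemma spanning_twin_width_ex (G : sgraph) (r : G) (cG : connected G) :
  exists k, `[< exists le : rel G, [/\ tree_order le, compatible le
                  & twin_width (structure_matrix (@sedge G) le) = k] >].
Proof.
have [le [tle cle]] := compatible_tree_order_ex (cG r).
exists (twin_width (structure_matrix (@sedge G) le)).
by apply/asboolP; exists le.
Qed.

(* The vertex [r] only witnesses that [G] is nonempty. *)
Definition connected_spanning_twin_width (G : sgraph) (r : G)
    (cG : connected G) : nat :=
  ex_minn (spanning_twin_width_ex r cG).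

(* A nonempty connected graph is its own only component, so the maximum over
   components covers the connected case too; it is [0] for the empty graph. *)
Definition spanning_twin_width (G : sgraph) : nat :=
  \max_(x : G) connected_spanning_twin_width
                 (component_root x) (@component_connected G x).

(* Main.v *)
(* If no graph of the class has a [K_t] minor, order the vertices of a connected
   graph by a depth-first search that visits sibling subtrees in lexicographic
   order of their neighbourhoods on the root path. A large grid of the adjacency
   matrix in that order yields a [K_t] minor: its rows are disjoint pieces of a
   root path, and its columns either lie at distinct depths of the tree, or fall
   into many sibling subtrees, where the lexicographic order provides common
   neighbours or private intervals of the root path. By the Marcus-Tardos
   theorem every partition into intervals then has linearly many nonempty zones,
   so consecutive intervals can be merged greedily; splitting each interval
   according to where subtrees end and to the heavy neighbours makes all other
   zones of the adjacency matrix and of the tree order constant.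

   Conversely, large clique minors contain, for every permutation of [m] points,
   a sparse model of the graph made of two paths and the matching given by the
   permutation. Any tree order compatible with the model has a contracted tree
   on O(m) vertices from which the permutation can be read, and bounded
   twin-width orders the rows and columns so that the relation coding it has no
   large grid. There are only exponentially many such relations (Klazar), but
   [m!] permutations. *)

Require Import Defs.
From mathcomp Require Import all_boot all_fingroup boolp zify.

Set Implicit Arguments.
Unset Strict Implicit.
Unset Printing Implicit Defensive.


(** * Grids in 0/1 matrices *)

(** From bounded spanning twin-width, the tree order is chosen by an adversary, so the model has to
    leave it little freedom. The model has at most $|V|-2m$ edges inside branch sets and at most
    $4m$ others, while a compatible tree order uses $|V|-1$ edges; so all but at most $2m+1$ of the
    inner edges are cover pairs, and contracting along them leaves at most $28m$ vertices. Storing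
    the label of each would cost about $\log m$ bits and ruin the count against $m!$; each stores
    one of 12 colours, and the labels are recovered by propagation. Rows and columns receive
    unrelated orders, so a second matrix, that of the identity, translates between them.

    In the other direction, a linear number of nonempty zones controls only the average block. Two
    consecutive blocks with few neighbours can be merged, but other blocks may keep arbitrarily
    many. Those are still single vertices, and splitting every block by its adjacency to them
    confines their errors to one block, the one where their subtree ends. *)

(** Only cut points are stored: as every zone contains an entry, [a] and [b] are forced to increase
    up to index [k]. *)
Definition grid (k : nat) (M : nat -> nat -> bool) : Prop :=
  exists a b : nat -> nat, forall i j, i < k -> j < k ->
    exists x y, [/\ a i <= x < a i.+1, b j <= y < b j.+1 & M x y].

(** Gaps between the given intervals are harmless: each gap is attached to the interval that follows
    it. *)
Lemma grid_of_intervals k (M : nat -> nat -> bool) (a a' b b' : nat -> nat) :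
  (forall i, i.+1 < k -> a' i <= a i.+1) ->
  (forall j, j.+1 < k -> b' j <= b j.+1) ->
  (forall i j, i < k -> j < k ->
     exists x y, [/\ a i <= x < a' i, b j <= y < b' j & M x y]) ->
  grid k M.
Proof.
move=> ha hb H.
pose c i := if i is i'.+1 then a' i' else a 0.
pose d i := if i is i'.+1 then b' i' else b 0.
exists c, d => i j ik jk; have [x [y [/andP[x1 x2] /andP[y1 y2] Mxy]]] := H i j ik jk.
exists x, y; split=> //=; rewrite ?x2 ?y2 andbT.
  by case: i ik x1 {x2 H} => // i ik; apply/leq_trans/ha.
by case: j jk y1 {y2 H} => // j jk; apply/leq_trans/hb.
Qed.

Lemma incr_enum (P : pred nat) n k :
  k <= #|[set i : 'I_n | P i]| ->
  exists f : nat -> nat, (forall i, i < k -> P (f i) && (f i < n)) /\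
    (forall i j, i < j -> j < k -> f i < f j).
Proof.
pose s := [seq i <- iota 0 n | P i] => kle.
have sz : size s = #|[set i : 'I_n | P i]|.
  have -> : s = [seq i <- index_iota 0 n | P i] by rewrite /s /index_iota subn0.
  rewrite size_filter -sum1_count big_mkord -sum1_card.
  by apply: eq_bigl => i; rewrite inE.
have st : sorted ltn s by apply/sorted_filter/iota_ltn_sorted/ltn_trans.
rewrite -sz in kle.
exists (nth 0 s); split=> [i ik|i j ij jk].
  have := mem_nth 0 (leq_trans ik kle).
  by rewrite mem_filter mem_iota.
apply: (sorted_ltn_nth ltn_trans) => //; rewrite inE; [exact: leq_trans (ltn_trans ij jk) kle | exact: leq_trans jk kle].
Qed.

(** * The Marcus-Tardos theorem *)

Definition ones (M : nat -> nat -> bool) n : nat :=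
  \sum_(i < n) \sum_(j < n) M i j.

Lemma ones_mono M n m : n <= m -> ones M n <= ones M m.
Proof.
move=> nm; rewrite /ones.
rewrite (big_ord_widen m (fun i => \sum_(j < n) (M i j : nat))) // big_mkcond /=.
apply: leq_sum => i _; case: ifP => // _.
rewrite (big_ord_widen m (fun j => (M i j : nat))) // big_mkcond /=.
by apply: leq_sum => j _; case: ifP.
Qed.

Lemma sum_blocks n s (F : nat -> nat) :
  \sum_(i < n * s) F i = \sum_(i < n) \sum_(x < s) F (i * s + x).
Proof.
elim: n => [|n IH]; first by rewrite mul0n !big_ord0.
rewrite mulSnr big_ord_recr /= -IH -!(big_mkord xpredT F).
rewrite (big_cat_nat (n := n * s)) ?leq_addr //=; congr (_ + _).
rewrite -{1}[n * s]add0n big_addn addKn big_mkord.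
by apply: eq_bigr => i _; rewrite addnC.
Qed.

Section Blocks.
Variables (s : nat) (M : nat -> nat -> bool).

Definition block_cell i j x y : bool := M (i * s + x) (j * s + y).

Definition block_quot i j : bool := [exists x : 'I_s, exists y : 'I_s, block_cell i j x y].

Lemma block_quot_grid k : grid k block_quot -> grid k M.
Proof.
move=> [a [b H]]; exists (fun i => a i * s), (fun j => b j * s) => i j ik jk.
have [x [y [/andP[x1 x2] /andP[y1 y2] /existsP[u /existsP[v Muv]]]]] := H i j ik jk.
exists (x * s + u), (y * s + v); split=> //; apply/andP; split.
- by apply: leq_trans (leq_addr _ _); rewrite leq_mul2r x1 orbT.
- apply: (@leq_trans (x.+1 * s)); first by rewrite mulSn addnC ltn_add2r.
  by rewrite leq_mul2r x2 orbT.
- by apply: leq_trans (leq_addr _ _); rewrite leq_mul2r y1 orbT.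
- apply: (@leq_trans (y.+1 * s)); first by rewrite mulSn addnC ltn_add2r.
  by rewrite leq_mul2r y2 orbT.
Qed.

Definition block_weight i j := \sum_(x < s) \sum_(y < s) (block_cell i j x y : nat).
Definition block_cols i j := [set y : 'I_s | [exists x : 'I_s, block_cell i j x y]].
Definition block_rows i j := [set x : 'I_s | [exists y : 'I_s, block_cell i j x y]].

Lemma ones_blocks n : ones M (n * s) = \sum_(i < n) \sum_(j < n) block_weight i j.
Proof.
rewrite /ones (sum_blocks n s (fun i => \sum_(j < n * s) (M i j : nat))).
apply: eq_bigr => i _; rewrite /block_weight [RHS]exchange_big /=.
apply: eq_bigr => x _; exact: (sum_blocks n s (fun j => M (i * s + x) j : nat)).
Qed.

Lemma weight_le_rc i j : block_weight i j <= #|block_rows i j| * #|block_cols i j|.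
Proof.
rewrite /block_weight -sum1_card big_distrl /= [X in _ <= X]big_mkcond /=.
apply: leq_sum => x _; case: ifP => [_|].
  rewrite mul1n -sum1_card [X in _ <= X]big_mkcond /=; apply: leq_sum => y _.
  case: ifPn => [_|]; first exact: leq_b1.
  by rewrite /block_cols inE negb_exists => /forallP/(_ x)/negPf->.
move/negbT; rewrite /block_rows inE negb_exists => /forallP h.
by rewrite big1 // => y _; rewrite (negPf (h y)).
Qed.

Lemma weight_le_sq i j : block_weight i j <= s ^ 2.
Proof.
apply: leq_trans (weight_le_rc i j) _; rewrite -mulnn.
by apply: leq_mul; rewrite -[X in _ <= X]card_ord max_card.
Qed.

(** A block with fewer than [k] nonzero rows and fewer than [k] nonzero columns has at most
    $(k-1)^2$ ones. Wide and tall blocks will be few, so they can be charged the trivial $s^2$. *)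
Lemma weight_split k i j : 0 < k ->
  block_weight i j <= k.-1 ^ 2 * block_quot i j
    + s ^ 2 * (k <= #|block_cols i j|) + s ^ 2 * (k <= #|block_rows i j|).
Proof.
move=> k0; have [hc|hc] := leqP k #|block_cols i j|.
  by apply: leq_trans (weight_le_sq i j) _; lia.
have [hr|hr] := leqP k #|block_rows i j|.
  by apply: leq_trans (weight_le_sq i j) _; lia.
rewrite !muln0 !addn0; case hq: (block_quot i j).
  apply: leq_trans (weight_le_rc i j) _; rewrite muln1 -mulnn.
  by apply: leq_mul; lia.
rewrite muln0 /block_weight big1 // => x _; rewrite big1 // => y _.
have := negbT hq; rewrite /block_quot negb_exists => /forallP/(_ x).
by rewrite negb_exists => /forallP/(_ y)/negPf->.
Qed.

End Blocks.

Lemma pigeonhole_fiber (I T : finType) (A : {set I}) (f : I -> T) k :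
  #|T| * k < #|A| -> exists t, k < #|[set i in A | f i == t]|.
Proof.
move=> h; apply: contrapT => hn; move: h; rewrite ltnNge => /negP; apply.
rewrite -sum1_card (partition_big f xpredT) //= -sum_nat_const.
apply: leq_sum => t _; rewrite leqNgt; apply/negP => ht; apply: hn; exists t.
by rewrite -sum1_card; under eq_bigl => i do rewrite inE.
Qed.

(** More than $k 2^s$ wide blocks in one column of blocks would include [k] with the same set [W] of
    nonzero columns; these rows of blocks against [k] columns of [W] form a grid. *)
Lemma wide_blocks k s M n j : 0 < k -> ~ grid k M ->
  \sum_(i < n) (k <= #|block_cols s M i j|) <= k * 2 ^ s.
Proof.
move=> k0 nog; rewrite leqNgt; apply/negP => h; apply: nog.
have {}h : #|{set 'I_s}| * k < #|[set i : 'I_n | k <= #|block_cols s M i j|]|.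
  rewrite -cardsT -powersetT card_powerset cardsT card_ord -sum1_card.
  rewrite mulnC; apply: leq_trans h _.
  by rewrite [\sum_(i in _) 1]big_mkcond; apply: leq_sum => i _; rewrite inE; case: (k <= #|_|).
have [W hW] := pigeonhole_fiber (fun i : 'I_n => block_cols s M i j) h.
have [|f [fP fi]] := @incr_enum (fun i => (k <= #|block_cols s M i j|) && (block_cols s M i j == W)) n k.
  apply: leq_trans (ltnW hW) _; apply/subset_leq_card/subsetP => i; rewrite !inE //.
have kW : k <= #|[set y : 'I_s | y \in W]|.
  have /andP[/andP[h1 /eqP h2] _] := fP 0 k0; rewrite h2 in h1.
  by rewrite cardsE.
have [|g [gP gi]] := @incr_enum (fun y => [exists z : 'I_s, (z == y :> nat) && (z \in W)]) s k.
  apply: leq_trans kW _; apply/subset_leq_card/subsetP => y; rewrite !inE => yW.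
  by apply/existsP; exists y; rewrite eqxx.
apply: (@grid_of_intervals _ _ (fun i => f i * s) (fun i => (f i).+1 * s)
   (fun y => j * s + g y) (fun y => j * s + (g y).+1)).
- by move=> i ik; rewrite leq_mul2r fi ?orbT.
- by move=> i ik; rewrite leq_add2l gi.
move=> i y ik yk; have /andP[/existsP[z /andP[/eqP zy zW]] _] := gP y yk.
have /andP[/andP[_ /eqP h2] _] := fP i ik.
move: zW; rewrite -h2 /block_cols inE => /existsP[x hx].
exists (f i * s + x), (j * s + z); split=> //; last by rewrite -zy; lia.
by rewrite leq_addr mulSn addnC ltn_add2r ltn_ord.
Qed.

Lemma grid_transpose k (M : nat -> nat -> bool) :
  grid k (fun x y => M y x) -> grid k M.
Proof.
move=> [a [b H]]; exists b, a => i j ik jk.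
by have [x [y [h1 h2 h3]]] := H j i jk ik; exists y, x.
Qed.

Lemma tall_blocks k s M n i : 0 < k -> ~ grid k M ->
  \sum_(j < n) (k <= #|block_rows s M i j|) <= k * 2 ^ s.
Proof.
move=> k0 nog.
exact: (@wide_blocks k s (fun x y => M y x) n i k0 (fun h => nog (grid_transpose h))).
Qed.

(** The recurrence is $f(ns) \le (k-1)^2 f(n) + 2 s^2 n k 2^s$ with $s = k^2$. The constant [c]
    makes the last term equal to $cn$, and $(k-1)^2 + 1 \le k^2 = s$ closes the induction. *)
Lemma marcus_tardos_pow k : 0 < k -> forall q M, ~ grid k M ->
  ones M ((k ^ 2) ^ q) <= (2 * k * 2 ^ (k ^ 2) * (k ^ 2) ^ 2) * (k ^ 2) ^ q.
Proof.
move=> k0; set s := k ^ 2; set c := _ * s ^ 2.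
have s0 : 0 < s by rewrite expn_gt0 k0.
elim=> [|q IH] M nog.
  rewrite expn0 muln1 /ones big_ord1 big_ord1; apply: leq_trans (leq_b1 _) _; rewrite /c.
  by rewrite !muln_gt0 k0 !expn_gt0 ?k0.
have {IH} := IH (block_quot s M) (fun h => nog (block_quot_grid h)).
rewrite expnSr; set n := s ^ q => IH.
rewrite ones_blocks.
apply: leq_trans (_ : k.-1 ^ 2 * ones (block_quot s M) n + s ^ 2 * (n * (k * 2 ^ s)) + s ^ 2 * (n * (k * 2 ^ s)) <= _).
  apply: (@leq_trans (\sum_(i < n) \sum_(j < n) (k.-1 ^ 2 * block_quot s M i j
    + s ^ 2 * (k <= #|block_cols s M i j|) + s ^ 2 * (k <= #|block_rows s M i j|)))).
    by apply: leq_sum => i _; apply: leq_sum => j _; apply: weight_split.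
  under eq_bigr => i _ do rewrite !big_split /=.
  rewrite !big_split /=; apply: leq_add; first apply: leq_add.
  - by rewrite /ones big_distrr /=; apply: leq_sum => i _; rewrite big_distrr.
  - rewrite exchange_big /=; under eq_bigr => i _ do rewrite -big_distrr /=.
    rewrite -big_distrr leq_mul2l; apply/orP; right.
    rewrite -[X in X * _]card_ord -sum_nat_const; apply: leq_sum => i _.
    exact: wide_blocks.
  - under eq_bigr => i _ do rewrite -big_distrr /=.
    rewrite -big_distrr leq_mul2l; apply/orP; right.
    rewrite -[X in X * _]card_ord -sum_nat_const; apply: leq_sum => i _.
    exact: tall_blocks.
rewrite -addnA.
have -> : s ^ 2 * (n * (k * 2 ^ s)) + s ^ 2 * (n * (k * 2 ^ s)) = c * n by rewrite /c; lia.
apply: leq_trans (_ : (k.-1 ^ 2).+1 * (c * n) <= _).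
  by rewrite mulSn addnC leq_add2l leq_mul2l IH orbT.
rewrite [n * s]mulnC [c * (s * n)]mulnCA leq_mul2r; apply/orP; right.
by rewrite /s; case: k k0 {s c s0 n nog IH} => // k _ /=; rewrite -!mulnn; lia.
Qed.

Lemma marcus_tardos k : 1 < k -> exists c, forall n M, ~ grid k M -> ones M n <= c * n.
Proof.
move=> k1; have k0 := ltnW k1; set s := k ^ 2.
have s1 : 1 < s by rewrite /s -mulnn; nia.
(* The last factor [s] pays for rounding [n] up to a power of [s]. *)
exists (2 * k * 2 ^ s * s ^ 2 * s) => n M nog.
have [n1|n1] := leqP n 1.
  case: n n1 => [|[|//]] _; first by rewrite /ones big_ord0.
  rewrite muln1 /ones big_ord1 big_ord1; apply: leq_trans (leq_b1 _) _.
  by rewrite !muln_gt0 k0 !expn_gt0 ?k0.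
have /andP[h1 h2] := up_log_bounds s1 n1.
apply: leq_trans (ones_mono M h2) _.
apply: leq_trans (@marcus_tardos_pow k k0 (up_log s n) M nog) _.
rewrite -/s -[X in _ <= X]mulnA leq_mul2l; apply/orP; right.
have u0 : 0 < up_log s n by rewrite up_log_gt0 s1 n1.
rewrite -(prednK u0) expnS; apply: leq_mul => //; exact: ltnW.
Qed.

(** * Klazar's bound on the number of grid-free matrices *)

Section Counting.

(** [grid] and [ones] live on [nat], so finite matrices are padded with [false]. *)
Definition ext n (f : {ffun 'I_n * 'I_n -> bool}) (i j : nat) : bool :=
  [exists p : 'I_n * 'I_n, [&& p.1 == i :> nat, p.2 == j :> nat & f p]].

Lemma extE n (f : {ffun 'I_n * 'I_n -> bool}) (i j : 'I_n) : ext f i j = f (i, j).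
Proof.
apply/existsP/idP => [[[a b] /and3P[/= /eqP/val_inj-> /eqP/val_inj->]]//|h].
by exists (i, j); rewrite /= !eqxx.
Qed.

Definition grid_free k n : {set {ffun 'I_n * 'I_n -> bool}} :=
  [set f | ~~ `[< grid k (ext f) >]].

Lemma grid_sub k (M M' : nat -> nat -> bool) :
  (forall i j, M i j -> M' i j) -> grid k M -> grid k M'.
Proof.
move=> h [a [b H]]; exists a, b => i j ik jk.
by have [x [y [h1 h2 /h h3]]] := H i j ik jk; exists x, y.
Qed.

Lemma ones_ext n (f : {ffun 'I_n * 'I_n -> bool}) : ones (ext f) n = #|[set p | f p]|.
Proof.
rewrite /ones pair_big /= -sum1_card [RHS]big_mkcond /=.
by apply: eq_bigr => -[i j] _; rewrite extE inE /=; case: (f _).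
Qed.

Variables (s n : nat).

Lemma mul_ord (i : 'I_n) (x : 'I_s) : i * s + x < n * s.
Proof.
apply: (@leq_trans (i.+1 * s)); first by rewrite mulSn addnC ltn_add2r.
by rewrite leq_mul2r ltn_ord orbT.
Qed.

Definition in_blocks (f : {ffun 'I_(n * s) * 'I_(n * s) -> bool}) :
    {ffun 'I_n * 'I_n -> {ffun 'I_s * 'I_s -> bool}} :=
  [ffun p => [ffun q => f (Ordinal (mul_ord p.1 q.1), Ordinal (mul_ord p.2 q.2))]].

Lemma mul_ord_onto (i : 'I_(n * s)) : exists (I : 'I_n) (x : 'I_s), i = Ordinal (mul_ord I x).
Proof.
have s0 : 0 < s by case: s i => // -[i]; rewrite muln0.
have h1 : i %/ s < n by rewrite ltn_divLR.
exists (Ordinal h1), (Ordinal (ltn_pmod i s0)); apply: val_inj => /=.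
exact: divn_eq.
Qed.

Lemma in_blocks_inj : injective in_blocks.
Proof.
move=> f g h; apply/ffunP => -[i j].
have [I [x ->]] := mul_ord_onto i; have [J [y ->]] := mul_ord_onto j.
by have /ffunP/(_ (I, J)) := h; rewrite !ffunE => /ffunP/(_ (x, y)); rewrite !ffunE.
Qed.

Definition block_support (f : {ffun 'I_(n * s) * 'I_(n * s) -> bool}) :
    {ffun 'I_n * 'I_n -> bool} :=
  [ffun p => in_blocks f p != [ffun => false]].

Lemma block_support_free k f : f \in grid_free k (n * s) -> block_support f \in grid_free k n.
Proof.
rewrite !inE; apply: contra => /asboolP h; apply/asboolP.
apply: (@block_quot_grid s); apply: grid_sub h => i j.
case/existsP=> -[I J] /and3P[/= /eqP<- /eqP<-]; rewrite ffunE => h.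
have [[x y]] : exists q, in_blocks f (I, J) q.
  apply: contrapT => hn; case/negP: h; apply/eqP/ffunP => q; rewrite [RHS]ffunE.
  by apply/negbTE/negP => hq; apply: hn; exists q.
rewrite !ffunE /= => hf; apply/existsP; exists x; apply/existsP; exists y.
by apply/existsP; exists (Ordinal (mul_ord I x), Ordinal (mul_ord J y)); rewrite /= !eqxx.
Qed.

(** Once the support is fixed, only its nonzero blocks can vary, each among at most $2^{s^2}$
    fillings. *)
Lemma card_block_support (g : {ffun 'I_n * 'I_n -> bool}) :
  #|[set f | block_support f == g]| <= (2 ^ (s ^ 2)) ^ ones (ext g) n.
Proof.
rewrite ones_ext -(card_imset _ in_blocks_inj).
have <- : #|{ffun 'I_s * 'I_s -> bool}| = 2 ^ s ^ 2.
  by rewrite card_ffun card_bool card_prod !card_ord mulnn.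
rewrite -(card_pffun_on ([ffun => false] : {ffun 'I_s * 'I_s -> bool})).
apply/subset_leq_card/subsetP => F /imsetP[f]; rewrite inE => /eqP<- ->.
apply/pffun_onP; split=> //; apply/subsetP => p hp.
by rewrite in_set [block_support _ _]ffunE; exact: hp.
Qed.

Lemma card_grid_free_step k c : (forall M, ~ grid k M -> ones M n <= c * n) ->
  #|grid_free k (n * s)| <= #|grid_free k n| * (2 ^ (s ^ 2)) ^ (c * n).
Proof.
move=> hc; rewrite -sum1_card.
rewrite (partition_big (@block_support) (mem (grid_free k n))) /=; last exact: block_support_free.
rewrite -sum_nat_const; apply: leq_sum => g; rewrite inE => hg.
apply: (@leq_trans #|[set f | block_support f == g]|).
  rewrite -sum1_card big_mkcond [X in _ <= X]big_mkcond.
  by apply: leq_sum => f _; rewrite inE; case: ifP => // /andP[_ ->].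
apply: leq_trans (card_block_support g) _; rewrite leq_pexp2l ?expn_gt0 //.
by apply: hc => h; case/negP: hg; apply/asboolP.
Qed.

End Counting.

(** Doubling the size from $n = 2^q$ multiplies the count by at most $16^{cn}$; these exponents form
    a geometric series, so the total stays exponential in the size. *)
Lemma klazar k : 1 < k -> exists C, forall q, #|grid_free k (2 ^ q)| <= C ^ (2 ^ q).
Proof.
move=> k1; have [c hc] := marcus_tardos k1.
exists (2 ^ (2 ^ 2 * c).+1).
elim=> [|q IH].
  rewrite expn0 expn1; apply: leq_trans (max_card _) _.
  by rewrite card_ffun card_bool card_prod !card_ord leq_exp2l.
rewrite expnSr; apply: leq_trans (card_grid_free_step _ (fun M => hc (2 ^ q) M)) _.
apply: leq_trans (leq_mul IH (leqnn _)) _.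
rewrite -!expnM -expnD leq_exp2l //; nia.
Qed.

(** * Orders given by a contraction sequence *)

Lemma path_first (T : Type) (e : rel T) (P : T -> Prop) (x : T) (s : seq T) :
  path e x s -> ~ P x -> P (last x s) ->
  exists y z s1 s2, [/\ x :: s = s1 ++ y :: z :: s2, e y z, ~ P y & P z].
Proof.
elim: s x => [|z s IH] x //= /andP[xz ps] nP Pl.
have [Pz|nPz] := pselect (P z); first by exists x, z, [::], s.
have [y [w [s1 [s2 [E1 E2 E3 E4]]]]] := IH z ps nPz Pl.
by exists y, w, (x :: s1), s2; rewrite E1.
Qed.

Section Orders.
Variable T : finType.
Implicit Types (P PP : {set {set T}}) (A B Q : {set T}).

(** What a contraction step does to one of the two partitions: it may act on the other one only. *)
Definition merge_or_stay P P' := merge_parts P P' || (P' == P).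

Lemma merge_parts_partition P P' : partition P [set: T] -> merge_parts P P' ->
  partition P' [set: T].
Proof.
move=> /and3P[/eqP cov triv n0] /exists_inP[A AP /exists_inP[B BP /andP[AB /eqP->]]].
apply/and3P; split.
- apply/eqP/setP => x; rewrite !inE; apply/bigcupP.
  have /bigcupP[C CP xC] : x \in cover P by rewrite cov.
  have [E|nA] := eqVneq C A.
    by exists (A :|: B); rewrite !inE ?eqxx // -E xC.
  have [E|nB] := eqVneq C B.
    by exists (A :|: B); rewrite !inE ?eqxx // -E xC orbT.
  by exists C => //; rewrite !inE nA nB CP orbT.
- have dj C D : C \in P -> D \in P -> C != D -> [disjoint C & D].
    by move: triv => /trivIsetP; apply.
  have djU C : C \in P -> C != A -> C != B -> [disjoint C & A :|: B].
    by move=> h1 h2 h3; rewrite -setI_eq0 setIUr setU_eq0 !setI_eq0 !dj.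
  apply/trivIsetP => C D; rewrite !inE => /orP[/eqP->|/and3P[C1 C2 C3]] /orP[/eqP->|/and3P[D1 D2 D3]] ne.
  + by rewrite eqxx in ne.
  + by rewrite disjoint_sym djU.
  + exact: djU.
  + exact: dj.
- rewrite !inE negb_or !negb_and n0 !orbT andbT.
  apply/eqP => /esym/eqP; rewrite setU_eq0 => /andP[/eqP A0 _].
  by rewrite -A0 AP in n0.
Qed.

(* Read from the coarsest partition back to the finest, each merge of [A] and
   [B] contributes one binary digit, telling [A] from [B]. *)
Lemma convex_order P (s : seq {set {set T}}) :
  partition P [set: T] -> path merge_or_stay P s -> #|last P s| <= 1 ->
  exists kappa : T -> nat,
    [/\ forall Q x y, Q \in P -> x \in Q -> y \in Q -> kappa x = kappa y,
        forall Q x y, Q \in P -> x \in Q -> kappa x = kappa y -> y \in Q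
      & forall PP Q x y z, PP \in P :: s -> Q \in PP -> x \in Q -> y \in Q ->
          kappa x <= kappa z <= kappa y -> z \in Q].
Proof.
elim: s P => [|P' s IH] P pP /=.
  move=> _ P1; exists (fun=> 0).
  have sub Q y : Q \in P -> y \in Q.
    move=> QP; have : y \in cover P by rewrite (cover_partition pP).
    case/bigcupP=> Q' Q'P yQ'; have -> // : Q = Q'.
    apply/eqP; apply: contraT => ne; move: P1; rewrite leqNgt => /negP[].
    by apply/card_gt1P; exists Q, Q'.
  split; [by [] | by move=> Q x y QP _ _; apply: sub |].
  by move=> PP Q x y z; rewrite inE => /eqP-> QP _ _ _; apply: sub.
case/andP=> /orP[mP|/eqP->] ps l1; last first.
  have [kappa [k1 k2 k3]] := IH P pP ps l1; exists kappa; split=> // PP Q x y z.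
  by rewrite inE => /orP[/eqP->|]; [apply: k3; rewrite inE eqxx | apply: k3].
have [kappa [k1 k2 k3]] := IH P' (merge_parts_partition pP mP) ps l1.
case/exists_inP: mP => A AP /exists_inP[B BP /andP[AB /eqP EP']].
have ABP' : A :|: B \in P' by rewrite EP' !inE eqxx.
have P'I Q : Q \in P -> Q != A -> Q != B -> Q \in P'.
  by move=> h1 h2 h3; rewrite EP' !inE h1 h2 h3 orbT.
have dj C D x : C \in P -> D \in P -> x \in C -> x \in D -> C = D.
  move=> CP DP xC xD; apply/eqP; apply: contraT => ne.
  case/and3P: pP => _ /trivIsetP/(_ _ _ CP DP ne) dCD _.
  by rewrite (disjointFr dCD xC) in xD.
pose k x := (kappa x).*2 + (x \in B).
have k1' Q x y : Q \in P -> x \in Q -> y \in Q -> k x = k y.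
  move=> QP xQ yQ; rewrite /k; congr (_.*2 + nat_of_bool _).
    have [E|nA] := eqVneq Q A.
      by apply: (k1 (A :|: B)); rewrite // inE -E ?xQ ?yQ.
    have [E|nB] := eqVneq Q B.
      by apply: (k1 (A :|: B)); rewrite // inE -E ?xQ ?yQ orbT.
    by apply: (k1 Q) => //; apply: P'I.
  have [xB|xB] := boolP (x \in B).
    by rewrite -(dj Q B x) // yQ.
  by apply/esym/negbTE/negP => yB; case/negP: xB; rewrite -(dj Q B y).
have kk x y : k x <= k y -> kappa x <= kappa y.
  by rewrite /k; case: (x \in B) (y \in B) => [] []; lia.
have kke x y : k x = k y -> kappa x = kappa y /\ (x \in B) = (y \in B).
  by rewrite /k; case: (x \in B) (y \in B) => [] [] h; split=> //; lia.
have k2' Q x y : Q \in P -> x \in Q -> k x = k y -> y \in Q.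
  move=> QP xQ /kke[e1 e2].
  have [E|nA] := eqVneq Q A.
    have : y \in A :|: B by apply: (k2 (A :|: B) x) => //; rewrite inE -E xQ.
    rewrite inE E => /orP[] // yB; rewrite -e2 in yB.
    by case/eqP: AB; rewrite -E; apply: dj xQ yB.
  have [E|nB] := eqVneq Q B; first by rewrite E -e2 -E.
  by apply: (k2 Q x) => //; apply: P'I.
exists k; split=> // PP Q x y z; rewrite inE => /orP[/eqP-> QP xQ yQ|PPs QP xQ yQ].
  move=> /andP[h1 h2]; apply: (k2' Q x) => //; apply/eqP; rewrite eqn_leq h1 /=.
  by rewrite (k1' Q x y).
move=> /andP[h1 h2]; apply: (k3 PP Q x y) => //.
by rewrite (kk _ _ h1) (kk _ _ h2).
Qed.

End Orders.

(** With injective [f] and [g] this is the matrix of [R] with rows and columns reordered; with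
    blocks as fibres it is the pattern of nonempty zones of a division into blocks. *)
Definition quot (I J : finType) (f : I -> nat) (g : J -> nat) (R : I -> J -> bool) (i j : nat) : bool :=
  [exists x, exists y, [&& f x == i, g y == j & R x y]].

Lemma quotP (I J : finType) (f : I -> nat) (g : J -> nat) (R : I -> J -> bool) i j :
  reflect (exists x y, [/\ f x = i, g y = j & R x y]) (quot f g R i j).
Proof.
apply: (iffP existsP) => [[x /existsP[y /and3P[/eqP<- /eqP<- Rxy]]]|[x [y [<- <- Rxy]]]].
  by exists x, y.
by exists x; apply/existsP; exists y; rewrite !eqxx.
Qed.

Lemma nondecr_upto (a : nat -> nat) k : (forall i, i < k -> a i <= a i.+1) ->
  forall i j, i <= j -> j <= k -> a i <= a j.
Proof.
move=> h i j /subnKC<-; elim: (j - i) => [|n IH]; rewrite ?addn0 // addnS => le.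
by apply: leq_trans (IH (ltnW le)) (h _ le).
Qed.

(* Whenever a part [Q] has only constant zones with a family of columns, few
   pairs of [R] with distinct ends join [Q] to these columns; so a grid of [R]
   forces non-constant zones. *)
Definition spread (T : finType) (X : Type) g (A : T -> T -> X) (R : rel T) : Prop :=
  forall (Q : {set T}) (u v : 'I_g -> T), (forall p, u p \in Q) -> injective u ->
    injective v -> (forall p, R (u p) (v p)) ->
    (forall p x, x \in Q -> A x (v p) = A (u p) (v p)) -> False.

Section NoGrid.
Variable T : finType.
Implicit Types (R : rel T) (S Q : {set T}) (CC : {set {set T}}).

Definition convex_on S CC (r : T -> nat) : Prop :=
  forall C x y z, C \in CC -> x \in C -> y \in C -> x \in S -> y \in S -> z \in S ->
    r x <= r z <= r y -> z \in C.

(** The grid is cut into $2(d+1)$ super-blocks of [g] intervals on each side. [Q] contains a whole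
    row super-block, so [spread] forces a non-constant zone at every column super-block. By
    convexity, a part found at two even super-blocks would contain the odd one between them, which
    no part does; hence the $d+1$ even ones give distinct parts. *)
Lemma many_errors (X : eqType) (A : T -> T -> X) S g d R (rr rc : T -> nat) Q CC
    (a b : nat -> nat) i0 :
  0 < g -> i0 < d.+1.*2 ->
  partition CC [set: T] -> convex_on S CC rc ->
  (forall u v, R u v -> (u \in S) && (v \in S)) -> spread g A R ->
  (forall x, x \in S -> a (g * i0) <= rr x < a (g * i0.+1) -> x \in Q) ->
  (forall j C, j < d.+1.*2 -> C \in CC ->
     ~ (forall y, y \in S -> b (g * j) <= rc y < b (g * j.+1) -> y \in C)) ->
  (forall i j, i < g * d.+1.*2 -> j < g * d.+1.*2 -> exists x y,
     [/\ a i <= rr x < a i.+1, b j <= rc y < b j.+1 & R x y]) ->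
  d < #|[set C in CC | ~~ constant_zone A Q C]|.
Proof.
move=> g0 i0L pCC cvx RS spr Qfull nofull zone.
have K0 : 0 < g * d.+1.*2 by rewrite muln_gt0 g0.
have ia : forall i, i < g * d.+1.*2 -> a i <= a i.+1.
  by move=> i iK; have [x [y [h _ _]]] := zone i 0 iK K0; lia.
have ib : forall i, i < g * d.+1.*2 -> b i <= b i.+1.
  by move=> i iK; have [x [y [_ h _]]] := zone 0 i K0 iK; lia.
have bad j : j < d.+1.*2 -> exists C, [/\ C \in CC, ~~ constant_zone A Q C &
    exists y, [/\ y \in S, y \in C & b (g * j) <= rc y < b (g * j.+1)]].
  move=> jL; apply: contrapT => nbad.
  (* One pair of [R] in each diagonal cell of the super-block, so that the rows are distinct and so
     are the columns. *)
  have zn (p : 'I_g) : exists uv : T * T, [/\ a (g * i0 + p) <= rr uv.1 < a (g * i0 + p).+1,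
      b (g * j + p) <= rc uv.2 < b (g * j + p).+1 & R uv.1 uv.2].
    have [||x [y h]] := zone (g * i0 + p) (g * j + p).
    - by have := ltn_ord p; nia.
    - by have := ltn_ord p; nia.
    by exists (x, y).
  have [uv huv] := choice zn.
  have sep (c : nat -> nat) (f : 'I_g -> nat) i : i < d.+1.*2 ->
      (forall i, i < g * d.+1.*2 -> c i <= c i.+1) ->
      (forall p : 'I_g, c (g * i + p) <= f p < c (g * i + p).+1) -> injective f.
    move=> iL ic hf.
    have mg : g * i + g <= g * d.+1.*2 by rewrite -mulnSr leq_mul2l iL orbT.
    have lt (p q : 'I_g) : p < q -> f p < f q.
      move=> pq; have /andP[_ h1] := hf p; have /andP[h2 _] := hf q.
      apply: leq_trans h1 (leq_trans _ h2); apply: (nondecr_upto ic); first by rewrite ltn_add2l.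
      by apply: leq_trans mg; rewrite leq_add2l ltnW.
    move=> p q e; apply/val_inj; apply: contrapT => /eqP; rewrite neq_ltn.
    by case/orP=> /lt; rewrite e ltnn.
  have inQ p : (uv p).1 \in Q.
    have [h1 h2 h3] := huv p; have /andP[s1 s2] := RS _ _ h3.
    apply: Qfull => //; have pg := ltn_ord p.
    have := @nondecr_upto a _ ia (g * i0) (g * i0 + p) _ _.
    have := @nondecr_upto a _ ia (g * i0 + p).+1 (g * i0.+1) _ _.
    by move=> H1 H2; have := H1 ltac:(nia) ltac:(nia); have := H2 ltac:(nia) ltac:(nia); lia.
  apply: (spr Q (fun p => (uv p).1) (fun p => (uv p).2)) => //.
  - move=> p q e; apply: (sep a (fun p => rr (uv p).1) i0) => //=; last by rewrite e.
    by move=> r; have [] := huv r.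
  - move=> p q e; apply: (sep b (fun p => rc (uv p).2) j) => //=; last by rewrite e.
    by move=> r; have [] := huv r.
  - by move=> p; have [] := huv p.
  move=> p x xQ; have [h1 h2 h3] := huv p; have /andP[s1 s2] := RS _ _ h3.
  have : (uv p).2 \in cover CC by rewrite (cover_partition pCC).
  case/bigcupP=> C CCC vC; apply: contrapT => ne; apply: nbad; exists C; split=> //.
    apply/negP => /forallP/(_ x); rewrite xQ /= => /forall_inP/(_ _ vC)/forall_inP/(_ _ (inQ p))/forall_inP/(_ _ vC)/eqP //.
  exists (uv p).2; split=> //; have pg := ltn_ord p.
  have := @nondecr_upto b _ ib (g * j) (g * j + p) _ _.
  have := @nondecr_upto b _ ib (g * j + p).+1 (g * j.+1) _ _.
  by move=> H1 H2; have := H1 ltac:(nia) ltac:(nia); have := H2 ltac:(nia) ltac:(nia); lia.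
have bad2 (j : 'I_d.+1) : exists C, [/\ C \in CC, ~~ constant_zone A Q C &
    exists y, [/\ y \in S, y \in C & b (g * j.*2) <= rc y < b (g * j.*2.+1)]].
  by apply: bad; rewrite ltn_double.
have [F hF] := choice bad2.
have Flt (i j : 'I_d.+1) : i < j -> F i != F j.
  move=> ij; apply/eqP => e.
  have [F1 F2 [y [yS yF hy]]] := hF i; have [_ _ [y' [yS' yF' hy']]] := hF j.
  apply: (nofull i.*2.+1 (F i)) => //; first by have := ltn_ord j; lia.
  move=> z zS hz; apply: (cvx (F i) y y' z) => //; first by rewrite e.
  have := @nondecr_upto b _ ib (g * i.*2.+2) (g * j.*2) _ _.
  have := ltn_ord j.
  by move=> jd H1; have := H1 ltac:(nia) ltac:(nia); lia.
have Finj : injective F.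
  move=> i j e; apply/val_inj; apply: contrapT => /eqP; rewrite neq_ltn.
  by case/orP=> /Flt; rewrite e eqxx.
rewrite -[X in X <= _](card_ord d.+1) -(card_imset _ Finj).
apply/subset_leq_card/subsetP => C /imsetP[j _ ->]; rewrite inE.
by have [-> -> _] := hF j.
Qed.

Lemma singletons_partition : partition (singletons T) [set: T].
Proof.
have -> : singletons T = preim_partition id [set: T].
  apply/setP => A; apply/imsetP/imsetP => -[x _ ->]; exists x => //;
    by apply/setP => y; rewrite !inE // eq_sym.
exact: preim_partitionP.
Qed.

End NoGrid.

Lemma final_cover (T : finType) (PP : {set {set T}}) (x : T) : partition PP [set: T] -> #|PP| <= 1 ->
  exists2 Q, Q \in PP & forall y, y \in Q.
Proof.
move=> pP P1; have : x \in cover PP by rewrite (cover_partition pP).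
case/bigcupP=> Q QP xQ; exists Q => // y.
have : y \in cover PP by rewrite (cover_partition pP).
case/bigcupP=> Q' Q'P yQ'; have -> // : Q = Q'.
apply/eqP; apply: contraT => ne; move: P1; rewrite leqNgt => /negP[].
by apply/card_gt1P; exists Q, Q'.
Qed.

Lemma path_partition (T : finType) (PP : {set {set T}}) s :
  partition PP [set: T] -> path (@merge_or_stay T) PP s ->
  forall PP', PP' \in PP :: s -> partition PP' [set: T].
Proof.
elim: s PP => [|P s IH] PP pP /=; first by move=> _ P'; rewrite inE => /eqP->.
case/andP=> /orP[/(merge_parts_partition pP) pP1|/eqP->] ps P'; rewrite inE => /orP[/eqP->//|]; exact: IH.
Qed.

Section TwinWidthNoGrid.
Variables (T : finType) (X : eqType) (A : T -> T -> X) (S : {set T}) (d : nat).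
Variable s : seq (partition_pair T T).
Hypothesis cs : contraction_sequence s.
Hypothesis err : sequence_error A s <= d.

Let rows := [seq PQ.1 | PQ <- s].
Let cols := [seq PQ.2 | PQ <- s].

Lemma path_rows : path (@merge_or_stay T) (singletons T) rows.
Proof.
case/andP: cs => + _; rewrite /rows -[singletons T]/((initial_pair T T).1).
elim: s (initial_pair T T) => [|PQ s' IH] x //= /andP[h /IH->]; rewrite andbT.
by case/orP: h => /andP[h1 h2]; rewrite /merge_or_stay ?h1 ?h2 // orbT.
Qed.

Lemma path_cols : path (@merge_or_stay T) (singletons T) cols.
Proof.
case/andP: cs => + _; rewrite /cols -[singletons T]/((initial_pair T T).2).
elim: s (initial_pair T T) => [|PQ s' IH] x //= /andP[h /IH->]; rewrite andbT.
by case/orP: h => /andP[h1 h2]; rewrite /merge_or_stay ?h1 ?h2 // orbT.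
Qed.

Lemma last_rows : #|last (singletons T) rows| <= 1.
Proof.
case/andP: cs => _ /andP[h _]; rewrite /rows.
by rewrite -[singletons T]/((initial_pair T T).1) last_map.
Qed.

Lemma last_cols : #|last (singletons T) cols| <= 1.
Proof.
case/andP: cs => _ /andP[_ h]; rewrite /cols.
by rewrite -[singletons T]/((initial_pair T T).2) last_map.
Qed.

(** Ranks are counted inside [S] and not in the whole type: the size of the codes will depend on
    #|S| alone. *)
Lemma rank_order (PPs : seq {set {set T}}) : path (@merge_or_stay T) (singletons T) PPs ->
  #|last (singletons T) PPs| <= 1 ->
  exists r : T -> nat, [/\ {in S &, injective r}, forall x, x \in S -> r x < #|S| &
    forall PP, PP \in singletons T :: PPs -> convex_on S PP r].
Proof.
move=> pth lst; have [k [k1 k2 k3]] := convex_order (singletons_partition T) pth lst.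
have kinj : injective k.
  move=> x y e; have xs : [set x] \in singletons T by apply: imset_f.
  by have := k2 _ x y xs (set11 x) e; rewrite inE => /eqP.
pose r x := #|[set y in S | k y < k x]|.
have rlt x y : x \in S -> k x < k y -> r x < r y.
  move=> xS kxy; apply: proper_card; apply/properP; split.
    by apply/subsetP => z; rewrite !inE => /andP[-> /ltn_trans->].
  by exists x; rewrite !inE xS //= ltnn.
have rle x y : x \in S -> r y <= r x -> k y <= k x.
  by move=> xS; apply: contraTT; rewrite -!ltnNge => /(rlt _ _ xS).
exists r; split.
- move=> x y xS yS e; apply: kinj; apply/eqP; rewrite eqn_leq.
  by rewrite !rle // e.
- move=> x xS; apply: proper_card; apply/properP; split; last by exists x; rewrite // inE ltnn andbF.
  by apply/subsetP => y; rewrite inE => /andP[].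
move=> PP PPin C x y z CP xC yC xS yS zS /andP[h1 h2].
by apply: (k3 PP C x y) => //; rewrite !rle.
Qed.

Lemma constant_zone_tr (Q C : {set T}) :
  constant_zone A Q C = constant_zone (fun x y => A y x) C Q.
Proof.
apply/idP/idP => h; apply/forall_inP => i iC; apply/forall_inP => j jQ;
  apply/forall_inP => i' iC'; apply/forall_inP => j' jQ';
  exact: (implyP (forallP (implyP (forallP (implyP (forallP (implyP (forallP h j) jQ) i) iC) j') jQ') i') iC').
Qed.

(** Consider the first pair of partitions in which some part contains a whole super-block of [g]
    consecutive intervals. The step leading to it changed one side only, so the other side has no
    such part yet, and [many_errors] yields more than [d] errors. *)
Lemma twin_width_orders : exists rr rc : T -> nat,
  [/\ {in S &, injective rr}, {in S &, injective rc},
      forall x, x \in S -> rr x < #|S|, forall x, x \in S -> rc x < #|S| &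
      forall g (R : rel T), 1 < g -> (forall u v, R u v -> (u \in S) && (v \in S)) ->
        spread g A R -> spread g (fun x y => A y x) (fun x y => R y x) ->
        ~ grid (g * d.+1.*2) (quot rr rc R)].
Proof.
have [rr [rr1 rr2 rr3]] := rank_order path_rows last_rows.
have [rc [rc1 rc2 rc3]] := rank_order path_cols last_cols.
exists rr, rc; split=> // g R g1 RS spr sprt [a [b ab]].
have g0 := ltnW g1.
have zone i j : i < g * d.+1.*2 -> j < g * d.+1.*2 -> exists x y,
     [/\ a i <= rr x < a i.+1, b j <= rc y < b j.+1 & R x y].
  move=> iK jK; have [u [v [h1 h2 /quotP[x [y [e1 e2 Rxy]]]]]] := ab i j iK jK.
  by exists x, y; rewrite e1 e2.
pose fullr (PP : {set {set T}}) := exists i Q, [/\ i < d.+1.*2, Q \in PP &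
  forall x, x \in S -> a (g * i) <= rr x < a (g * i.+1) -> x \in Q].
pose fullc (PP : {set {set T}}) := exists j C, [/\ j < d.+1.*2, C \in PP &
  forall y, y \in S -> b (g * j) <= rc y < b (g * j.+1) -> y \in C].
have ia : forall i, i < g * d.+1.*2 -> a i <= a i.+1.
  by move=> i iK; have [x [y [h _ _]]] := zone i i iK iK; lia.
have ib : forall i, i < g * d.+1.*2 -> b i <= b i.+1.
  by move=> i iK; have [x [y [_ h _]]] := zone i i iK iK; lia.
(* As [g > 1], a super-block contains two distinct rows and two distinct columns, so no singleton
   contains it and the initial pair is not yet of the kind sought. *)
have two i : i < d.+1.*2 ->
    exists x1 y1 x2 y2, [/\ x1 != x2, y1 != y2, R x1 y1 & R x2 y2] /\
     [/\ a (g * i) <= rr x1 < a (g * i.+1), a (g * i) <= rr x2 < a (g * i.+1),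
         b (g * i) <= rc y1 < b (g * i.+1) & b (g * i) <= rc y2 < b (g * i.+1)].
  move=> iL.
  have i1 : g * i < g * d.+1.*2 by nia.
  have i2 : (g * i).+1 < g * d.+1.*2 by nia.
  have i3 : (g * i).+2 <= g * i.+1 by nia.
  have i4 : g * i.+1 <= g * d.+1.*2 by nia.
  have [x1 [y1 [hx1 hy1 R1]]] := zone _ _ i1 i1.
  have [x2 [y2 [hx2 hy2 R2]]] := zone _ _ i2 i2.
  have := nondecr_upto ia i3 i4; have := nondecr_upto ib i3 i4.
  have := ia _ i1; have := ib _ i1.
  move=> l1 l2 l3 l4; exists x1, y1, x2, y2; split; split; try lia; rewrite ?R1 ?R2 //.
    by apply/eqP => e; rewrite e in hx1; lia.
  by apply/eqP => e; rewrite e in hy1; lia.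
case/andP: (cs) => pth /andP[lr lc].
pose P (PQ : partition_pair T T) := fullr PQ.1 \/ fullc PQ.2.
have nP0 : ~ P (initial_pair T T).
  case=> -[i [Q [iL /imsetP[z _ ->] hQ]]];
    have [x1 [y1 [x2 [y2 [[ne1 ne2 R1 R2] [h1 h2 h3 h4]]]]]] := two i iL;
    have /andP[s1 s2] := RS _ _ R1; have /andP[s3 s4] := RS _ _ R2.
    have /set1P e1 := hQ x1 s1 h1; have /set1P e2 := hQ x2 s3 h2.
    by rewrite e1 e2 eqxx in ne1.
  have /set1P e1 := hQ y1 s2 h3; have /set1P e2 := hQ y2 s4 h4.
  by rewrite e1 e2 eqxx in ne2.
have L0 : 0 < d.+1.*2 by [].
have [x0 _] := two 0 L0.
have pr := path_partition (singletons_partition T) path_rows.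
have pc := path_partition (singletons_partition T) path_cols.
have mr PQ : PQ \in initial_pair T T :: s -> PQ.1 \in singletons T :: rows.
  by rewrite !inE => /orP[/eqP->|h]; rewrite ?eqxx // [_ \in rows]map_f ?orbT.
have mc PQ : PQ \in initial_pair T T :: s -> PQ.2 \in singletons T :: cols.
  by rewrite !inE => /orP[/eqP->|h]; rewrite ?eqxx // [_ \in cols]map_f ?orbT.
have Pl : P (last (initial_pair T T) s).
  left; have [|Q QP hQ] := final_cover x0 _ lr; first exact/pr/mr/mem_last.
  by exists 0, Q; split.
have [PQ [PQ' [s1 [s2 [Es st nPQ PPQ']]]]] := path_first pth nP0 Pl.
have in' : PQ' \in initial_pair T T :: s by rewrite Es mem_cat !inE eqxx !orbT.
have e' : error_value A PQ' <= d.
  by apply: leq_trans err; rewrite /sequence_error; apply: (@leq_bigmax_seq _ (initial_pair T T :: s) xpredT (error_value A)).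
case: PPQ' => [fr|fc].
  have {}st : PQ'.2 = PQ.2.
    case/orP: st => /andP[h1 h2]; first exact/eqP.
    by case: nPQ; left; rewrite -(eqP h1).
  case: (fr) => i [Q [iL QP hQ]].
  have := @many_errors T X A S g d R rr rc Q PQ'.2 a b i g0 iL (pc _ (mc _ in')) (rc3 _ (mc _ in')) RS spr hQ _ zone.
  move=> me; suff : d < d by rewrite ltnn.
  apply: leq_trans (me _) _.
    by move=> j C jL CP hC; apply: nPQ; right; rewrite -st; exists j, C.
  apply: leq_trans e'; apply: leq_trans (leq_maxl _ _).
  exact: (@leq_bigmax_cond _ (mem PQ'.1) (row_error A PQ') Q QP).
have {}st : PQ'.1 = PQ.1.
  case/orP: st => /andP[h1 h2]; last exact/eqP.
  by case: nPQ; right; rewrite -(eqP h2).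
case: (fc) => i [Q [iL QP hQ]].
have := @many_errors T X (fun x y => A y x) S g d (fun x y => R y x) rc rr Q PQ'.1 b a i g0 iL (pr _ (mr _ in')) (rr3 _ (mr _ in')) _ sprt hQ _ _.
move=> me; suff : d < d by rewrite ltnn.
apply: leq_trans (me _ _ _) _.
- by move=> u v /RS/andP[-> ->].
- by move=> j C jL CP hC; apply: nPQ; left; rewrite -st; exists j, C.
- by move=> j k jK kK; have [x [y [h1 h2 h3]]] := zone k j kK jK; exists y, x.
apply: leq_trans e'; apply: leq_trans (leq_maxr _ _).
apply: leq_trans (@leq_bigmax_cond _ (mem PQ'.2) (col_error A PQ') Q QP).
apply: eq_leq; apply: eq_card => C; rewrite !inE; congr (_ && ~~ _).
by rewrite [RHS]constant_zone_tr.
Qed.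

End TwinWidthNoGrid.

(** * Tree orders *)

Section TreeOrders.
Variables (T : finType) (le : rel T).
Hypothesis tle : tree_order le.

Lemma tle_refl x : le x x. Proof. by case: tle => -[]. Qed.
Lemma tle_anti x y : le x y -> le y x -> x = y.
Proof. by case: tle => -[_ h _] _ _ xy yx; apply: h; rewrite xy yx. Qed.
Lemma tle_trans y x z : le x y -> le y z -> le x z.
Proof. by case: tle => -[_ _ h] _ _; apply: h. Qed.
Lemma tle_total z x y : le x z -> le y z -> le x y || le y x.
Proof. by case: tle => _ _; apply. Qed.

(** Elements below [x] form a chain, whose maximum is the one with the largest down-set. *)
Lemma chain_max (P : pred T) x : (exists t, P t) -> (forall t, P t -> le t x) ->
  exists2 z, P z & forall t, P t -> le t z.
Proof.
case=> t0 Pt0 Px; pose f t := #|[set s | le s t]|.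
case: (arg_maxnP f Pt0) => z Pz zmax; exists z => // t Pt.
case/orP: (tle_total (Px _ Pt) (Px _ Pz)) => // zt.
have sub : [set s | le s z] \subset [set s | le s t].
  by apply/subsetP => s; rewrite !inE => /tle_trans; apply.
have /eqP e : [set s | le s z] == [set s | le s t].
  by rewrite eqEcard sub; apply: zmax.
have : t \in [set s | le s t] by rewrite inE tle_refl.
by rewrite -e inE.
Qed.

Lemma parent_of v u0 : strict le u0 v ->
  exists2 u, Defs.cover le u v & forall t, strict le t v -> le t u.
Proof.
move=> h0; have [||u /= hu /= umax] := @chain_max (fun t => strict le t v) v; first by exists u0.
  by move=> t /andP[].
exists u => //; rewrite /Defs.cover hu /=; apply/negP => /existsP[z /andP[/andP[uz luz] h2]].
by case/eqP: uz; apply: tle_anti luz (umax _ h2).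
Qed.

Lemma cover_below u v t : Defs.cover le u v -> strict le t v -> le t u.
Proof.
move=> /andP[/andP[uv luv] h] tv; have [w /andP[wv _] wmax] := parent_of tv.
have uw : le u w by apply: wmax; apply/andP.
have [->|ne] := eqVneq u w; first exact: wmax.
case/negP: h; apply/existsP; exists w; rewrite wv andbT; exact/andP.
Qed.

Definition is_meet (x y z : T) : Prop :=
  [/\ le z x, le z y & forall t, le t x -> le t y -> le t z].

Definition meet_closed (S : {set T}) : Prop :=
  forall x y, x \in S -> y \in S -> exists2 z, z \in S & is_meet x y z.

Lemma is_meet_sym x y z : is_meet x y z -> is_meet y x z.
Proof. by move=> [h1 h2 h3]; split=> // t a b; apply: h3. Qed.

Lemma is_meet_le x y : le x y -> is_meet x y x.
Proof. by move=> h; split=> //; apply: tle_refl. Qed.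

(** Adding [v] costs only one further vertex, the highest [w] that is below both [v] and some
    element of [S]: the meet of [v] or [w] with an element of [S] is [w] or already belongs to
    [S]. *)
Lemma meet_closure (S0 : {set T}) : exists S : {set T},
  [/\ S0 \subset S, meet_closed S & #|S| <= 2 * #|S0|].
Proof.
suff H (s : seq T) : exists S : {set T},
    [/\ {subset s <= S}, meet_closed S & #|S| <= 2 * size s].
  have [S [h1 h2 h3]] := H (enum S0); exists S; split=> //; last by rewrite -cardE in h3.
  by apply/subsetP => x xS; apply: h1; rewrite mem_enum.
elim: s => [|v s [S [sS cS leS]]].
  by exists set0; rewrite cards0; split=> [x|x y|]; rewrite ?inE.
have [S0e|[b0 b0S]] := set_0Vmem S.
  exists [set v]; split; last by rewrite cards1 /=; lia.
    move=> x; rewrite inE => /orP[/eqP->|/sS]; first by rewrite inE.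
    by rewrite S0e inE.
  move=> x y /set1P-> /set1P->; exists v; rewrite ?inE //; exact/is_meet_le/tle_refl.
case: (tle) => _ [r hr] _.
have [||w /exists_inP[x0 x0S /andP[wx0 wv]] wmax] :=
    @chain_max (fun t => [exists x in S, le t x && le t v]) v.
- by exists r; apply/exists_inP; exists b0; rewrite ?hr.
- by move=> t /exists_inP[x _ /andP[]].
have {}wmax t x : x \in S -> le t x -> le t v -> le t w.
  by move=> xS tx tv; apply: wmax; apply/exists_inP; exists x; rewrite ?tx.
have meetS b : b \in S -> le w b \/
    exists2 y, y \in S & [/\ le y w, le y v, le y b & forall t, le t b -> (le t v \/ le t w) -> le t y].
  move=> bS; have [wb|nwb] := boolP (le w b); first by left.
  right; have [y yS [yx yb ymax]] := cS x0 b x0S bS.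
  have yw : le y w.
    case/orP: (tle_total yx wx0) => // wy.
    by rewrite (tle_trans wy yb) in nwb.
  exists y => //; split=> //; first exact: tle_trans wv.
  move=> t tb tvw; apply: ymax => //; apply: tle_trans wx0.
  case: tvw => // tv; apply: (wmax t b) => //.
have meetv b : b \in S -> exists2 z, z \in v |: (w |: S) & is_meet v b z.
  move=> bS; case: (meetS b bS) => [wb|[y yS [yw yv yb ymax]]].
    by exists w; rewrite ?inE ?eqxx ?orbT //; split=> // t tv tb; apply: wmax tb tv.
  by exists y; rewrite ?inE ?yS ?orbT //; split=> // t tv tb; apply: ymax => //; left.
have meetw b : b \in S -> exists2 z, z \in v |: (w |: S) & is_meet w b z.
  move=> bS; case: (meetS b bS) => [wb|[y yS [yw yv yb ymax]]].
    by exists w; rewrite ?inE ?eqxx ?orbT //; apply: is_meet_le.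
  by exists y; rewrite ?inE ?yS ?orbT //; split=> // t tv tb; apply: ymax => //; right.
exists (v |: (w |: S)); split.
- move=> x; rewrite inE => /orP[/eqP->|/sS]; rewrite !inE ?eqxx // => ->.
  by rewrite !orbT.
- have sym x y : (exists2 z, z \in v |: (w |: S) & is_meet x y z) ->
      exists2 z, z \in v |: (w |: S) & is_meet y x z.
    by case=> z zS /is_meet_sym h; exists z.
  have win : w \in v |: (w |: S) by rewrite !inE eqxx orbT.
  have vin : v \in v |: (w |: S) by rewrite !inE eqxx.
  move=> x y; rewrite !inE => /or3P[/eqP->|/eqP->|xS] /or3P[/eqP->|/eqP->|yS].
  + by exists v => //; apply/is_meet_le/tle_refl.
  + by apply: sym; exists w => //; apply: is_meet_le.
  + exact: meetv.
  + by exists w => //; apply: is_meet_le.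
  + by exists w => //; apply/is_meet_le/tle_refl.
  + exact: meetw.
  + exact/sym/meetv.
  + exact/sym/meetw.
  + by have [z zS h] := cS x y xS yS; exists z => //; rewrite !inE zS !orbT.
- rewrite cardsU1 cardsU1 /= mulnS addnA; apply: leq_add => //.
  by case: (_ \notin _); case: (_ \notin _).
Qed.

(** * Contraction of a tree order to a meet-closed set *)

Section ContractedTree.
Variables (S : {set T}) (U : eqType) (lam : T -> U) (E : rel T).
Hypothesis symE : symmetric E.

Definition cov_in x y :=
  [&& x \in S, y \in S, strict le x y & [forall z in S, ~~ (strict le x z && strict le z y)]].

Lemma cov_inP x y : reflect [/\ x \in S, y \in S, strict le x y &
    forall z, z \in S -> strict le x z -> strict le z y -> False] (cov_in x y).
Proof.
apply: (iffP and4P) => -[h1 h2 h3 h4]; split=> //.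
  by move=> z zS xz zy; have /forall_inP/(_ z zS) := h4; rewrite xz zy.
by apply/forall_inP => z zS; apply/negP => /andP[]; apply: h4.
Qed.

(** A cover pair of the order induced on [S] stands for a contracted tree path. Those joining
    distinct labels are dropped unless they are edges, so that no adjacency foreign to the
    permutation graph appears. *)
Definition contracted x y :=
  [&& x \in S, y \in S & E x y || (lam x == lam y) && (cov_in x y || cov_in y x)].

Lemma contracted_sym : symmetric contracted.
Proof.
by move=> x y; rewrite /contracted symE [lam x == _]eq_sym [cov_in x y || _]orbC andbCA.
Qed.

Hypothesis meetS : meet_closed S.
Hypothesis covE : forall x y, E x y -> lam x = lam y -> x \notin S \/ y \notin S ->
  Defs.cover le x y \/ Defs.cover le y x.

Let eqc (Q : rel T) := [rel a b | Q a b && (lam a == lam b)].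

(* [a] is the last vertex of [S] met by the walk from [x0] to [x] and [w] the
   top of the tree path from [a] to [x], which meets [S] only in [a]. *)
Let inv x0 x := exists a w, [/\ a \in S, lam a = lam x0, connect (eqc contracted) x0 a,
  le w a /\ le w x & forall s, s \in S -> le w s -> le s a \/ le s x -> s = a].

Let inv_end x0 x : inv x0 x -> x \in S -> connect (eqc contracted) x0 x.
Proof.
move=> [a [w [aS la c [wa wx] h]]] xS.
by rewrite (h x xS wx) //; right; apply: tle_refl.
Qed.

Let inv_start x : x \in S -> inv x x.
Proof.
move=> xS; exists x, x; split=> //; first by split; apply: tle_refl.
by move=> s _ xs [] sx; apply: tle_anti.
Qed.

Let inv_new x0 y : y \in S -> lam y = lam x0 -> connect (eqc contracted) x0 y -> inv x0 y.
Proof.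
move=> yS ly c; exists y, y; split=> //; first by split; apply: tle_refl.
by move=> s _ xs [] sx; apply: tle_anti.
Qed.

(** If the walk goes away from the root and reaches [S] at [y], the meet of [a] and [y] lies in [S]
    above [w], hence is [a], so [a] and [y] are equal or a cover pair of [S]. If it goes towards the
    root past [w], then [w] was [x] and [y] becomes the new top; when [y] is in [S], it is covered
    by [a]. *)
Let inv_step x0 x y : inv x0 x -> eqc E x y -> lam x = lam x0 -> inv x0 y.
Proof.
move=> I /andP[/= Exy /eqP lxy] lx.
have ly : lam y = lam x0 by rewrite -lxy.
have new a : a \in S -> y \in S -> lam a = lam x0 -> connect (eqc contracted) x0 a ->
    E a y || (cov_in a y || cov_in y a) -> inv x0 y.
  move=> aS yS la c h; apply: inv_new => //; apply: connect_trans c (connect1 _).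
  by rewrite /= /contracted aS yS la ly eqxx /= h.
have [/andP[xS yS]|nS] := boolP ((x \in S) && (y \in S)).
  by apply: (new x) => //; [apply: inv_end | rewrite Exy].
have {}nS : x \notin S \/ y \notin S by apply/orP; rewrite -negb_and.
have [a [w [aS la c [wa wx] h]]] := I.
have strictI u v : u != v -> le u v -> strict le u v by move=> h1 h2; apply/andP.
case: (covE Exy lxy nS) => cv.
  have /andP[/andP[nxy lexy] nbetw] := cv.
  have wy : le w y := tle_trans wx lexy.
  have [yS|yS] := boolP (y \in S); last first.
    exists a, w; split=> // s sS ws [sa|sy]; first by apply: h => //; left.
    apply: h => //; right; apply: (cover_below cv).
    by apply: strictI => //; apply: contraNneq yS => <-.
  have [z zS [za zy zmax]] := meetS aS yS.
  have e : z = a by apply: h => //; [apply: zmax | left].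
  rewrite {}e in zy.
  have [e|nay] := eqVneq a y; first by apply: inv_new => //; rewrite -e.
  apply: (new a) => //; apply/orP; right; apply/orP; left; apply/cov_inP; split=> //.
    exact: strictI.
  move=> s sS /andP[nas las] say; case/eqP: nas; apply/esym/h => //.
    exact: tle_trans las.
  by right; apply: (cover_below cv).
have /andP[/andP[nyx leyx] nbetw] := cv.
have [wy|nwy] := boolP (le w y).
  have [yS|yS] := boolP (y \in S).
    have -> // : y = a by apply: h => //; right.
    exact: inv_new.
  exists a, w; split=> // s sS ws sas; apply: h => //; case: sas => [sa|sy]; [by left|right].
  exact: tle_trans leyx.
have yw : le y w.
  by case/orP: (tle_total leyx wx) => // yw; rewrite yw in nwy.
have ew : w = x.
  apply/eqP; apply: contraT => nwx; case/negP: nwy.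
  by apply: (cover_below cv); apply: strictI.
rewrite {}ew in wa wx h yw nwy.
have below s : s \in S -> strict le y s -> le s a -> s = a.
  move=> sS ys sa; case/orP: (tle_total sa wa) => sx; last by apply: h => //; left.
  have [e|nsx] := eqVneq s x; first by apply: h => //; [rewrite e; apply: tle_refl | left].
  by case/negP: nbetw; apply/existsP; exists s; rewrite ys; apply: strictI.
have [yS|yS] := boolP (y \in S); last first.
  exists a, y; split=> //; first by split; [apply: tle_trans wa | apply: tle_refl].
  move=> s sS ys [sa|sy].
    by apply: below => //; apply: strictI => //; apply: contraNneq yS => ->.
  by rewrite (tle_anti ys sy) sS in yS.
have lya : le y a by apply: tle_trans wa.
have [e|nya] := eqVneq y a; first by apply: inv_new => //; rewrite e.
apply: (new a) => //; apply/orP; right; apply/orP; right; apply/cov_inP; split=> //.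
  exact: strictI.
by move=> s sS ys /andP[nsa lsa]; case/eqP: nsa; apply: below.
Qed.

Lemma contracted_connect x y : x \in S -> y \in S ->
  connect (eqc E) x y -> connect (eqc contracted) x y.
Proof.
move=> xS yS /connectP[p pth ly].
suff H q u : path (eqc E) u q -> inv x u -> lam u = lam x -> inv x (last u q).
  by apply: inv_end => //; rewrite ly; apply: H => //; apply: inv_start.
elim: q u => [|z q IH] u //= /andP[uz pz] I lu.
apply: IH => //; first exact: inv_step I uz lu.
by case/andP: uz => _ /eqP<-.
Qed.

Lemma contracted_lam x y : contracted x y -> lam x = lam y \/ E x y.
Proof. by case/and3P=> _ _ /orP[|/andP[/eqP]]; [right|left]. Qed.

End ContractedTree.

Section Spread.
Variables (S : {set T}) (U : eqType) (lam : T -> U) (E : rel T) (par : T -> T) (L : rel T).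
Hypothesis sparseE : forall x y, E x y -> [|| par x == y, par y == x | L x y].
Hypothesis degL : forall x, #|[set y | L x y]| <= 4.

(** Charge each pair to the reason for its edge: [par x = y] accounts for at most $|X|$ pairs,
    [par y = x] for at most $|Y|$, and [L] for at most $4|X|$. *)
Lemma biclique_bound (X Y : {set T}) : (forall x y, x \in X -> y \in Y -> E x y) ->
  #|X| * #|Y| <= 5 * #|X| + #|Y|.
Proof.
move=> XY.
apply: (@leq_trans (\sum_(x in X) \sum_(y in Y) ((par x == y) + (par y == x) + L x y))).
  rewrite -sum_nat_const; apply: leq_sum => x xX; rewrite -sum1_card.
  apply: leq_sum => y yY; have := sparseE (XY x y xX yY).
  by case: (par x == y) (par y == x) (L x y) => [] [] [].
have le1 (z : T) (Z : {set T}) : \sum_(y in Z) (z == y) <= 1.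
  apply: leq_trans (_ : #|[set z]| <= _); last by rewrite cards1.
  rewrite -sum1_card big_mkcond [X in _ <= X]big_mkcond; apply: leq_sum => y _.
  by rewrite inE eq_sym; case: (_ \in _); case: (_ == _).
under eq_bigr => x _ do rewrite !big_split /=.
rewrite !big_split /= -addnA addnCA.
have h1 : \sum_(x in X) \sum_(y in Y) (par x == y) <= #|X|.
  by rewrite -sum1_card; apply: leq_sum => x _; apply: le1.
have h2 : \sum_(x in X) \sum_(y in Y) (par y == x) <= #|Y|.
  by rewrite exchange_big /= -sum1_card; apply: leq_sum => y _; apply: le1.
have h3 : \sum_(x in X) \sum_(y in Y) L x y <= 4 * #|X|.
  rewrite mulnC -sum_nat_const; apply: leq_sum => x _; apply: leq_trans (degL x).
  rewrite -sum1_card big_mkcond [X in _ <= X]big_mkcond; apply: leq_sum => y _.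
  by rewrite inE; case: (_ \in _); case: (L x y).
by lia.
Qed.

(** Of the eight pairs at most $5+1+1$ can exist. Constancy turns the [E]-pairs, say $e$ of them,
    into a biclique with all eight [u p], whence $8e \le 40 + e$. Two cover pairs of the same
    direction are impossible: constancy puts one lower end below both upper ends, so the lower ends
    are comparable and one of them breaks a cover. *)
Lemma contracted_spread (Q : {set T}) (u v : 'I_8 -> T) :
  (forall p, u p \in Q) -> injective u -> injective v ->
  (forall p, contracted S lam E (u p) (v p)) ->
  (forall p x, x \in Q -> [/\ E x (v p) = E (u p) (v p), le x (v p) = le (u p) (v p) &
     le (v p) x = le (v p) (u p)]) -> False.
Proof.
move=> uQ uinj vinj uv cst.
pose IE := [set p | E (u p) (v p)].
pose IC := [set p | cov_in S (u p) (v p)].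
pose ID := [set p | cov_in S (v p) (u p)].
have neq_le x y : le x y -> x != y -> le y x = false.
  by move=> xy ne; apply: contraNF ne => yx; apply/eqP/tle_anti.
have cardC : #|IC| <= 1.
  rewrite leqNgt; apply/negP => /card_gt1P[p [q [+ + npq]]].
  rewrite !inE => /cov_inP[u1 v1 /andP[n1 l1] b1] /cov_inP[u2 v2 /andP[n2 l2] b2].
  have st x y : x \in Q -> cov_in S (u y) (v y) -> strict le x (v y).
    move=> xQ /cov_inP[_ _ /andP[n l] _]; have [_ c1 c2] := cst y x xQ.
    rewrite /strict c1 l andbT; apply/eqP => e.
    by move: c2; rewrite -e tle_refl e neq_le.
  have s1 : strict le (u q) (v p) by apply: st => //; apply/cov_inP; split=> //; apply/andP.
  have s2 : strict le (u p) (v q) by apply: st => //; apply/cov_inP; split=> //; apply/andP.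
  have ne : u p != u q by apply: contraNneq npq => /uinj->.
  case/andP: (s1) => _ l3; case/orP: (tle_total l1 l3) => l4.
    by apply: (b1 (u q)) => //; apply/andP.
  by apply: (b2 (u p)) => //; apply/andP; rewrite eq_sym.
have cardD : #|ID| <= 1.
  rewrite leqNgt; apply/negP => /card_gt1P[p [q [+ + npq]]].
  rewrite !inE => /cov_inP[u1 v1 /andP[n1 l1] b1] /cov_inP[u2 v2 /andP[n2 l2] b2].
  have st x y : x \in Q -> cov_in S (v y) (u y) -> strict le (v y) x.
    move=> xQ /cov_inP[_ _ /andP[n l] _]; have [_ c1 c2] := cst y x xQ.
    rewrite /strict c2 l andbT; apply/eqP => e.
    by move: c1; rewrite -e tle_refl neq_le.
  have s1 : strict le (v p) (u q) by apply: st => //; apply/cov_inP; split=> //; apply/andP.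
  have s2 : strict le (v q) (u p) by apply: st => //; apply/cov_inP; split=> //; apply/andP.
  have ne : v p != v q by apply: contraNneq npq => /vinj->.
  case/andP: (s1) => _ l3; case/orP: (tle_total l2 l3) => l4.
    by apply: (b2 (v p)) => //; apply/andP; rewrite eq_sym.
  by apply: (b1 (v q)) => //; apply/andP.
have cardE : #|IE| <= 5.
  have := @biclique_bound [set u p | p : 'I_8] [set v p | p in IE] _.
  rewrite !card_imset // card_ord => h.
  suff : 8 * #|IE| <= 5 * 8 + #|IE| by lia.
  apply: h => x y /imsetP[p _ ->] /imsetP[q]; rewrite inE => Eq ->.
  by have [-> _ _] := cst q (u p) (uQ p).
have : #|[set: 'I_8]| <= #|IE| + (#|IC| + #|ID|).
  have -> : [set: 'I_8] = IE :|: (IC :|: ID).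
    apply/setP => p; rewrite !inE; apply/esym.
    by have /and3P[_ _ /orP[->|/andP[_ /orP[]->]]] := uv p; rewrite ?orbT.
  by apply: leq_trans (leq_card_setU _ _) _; rewrite leq_add2l; apply: (leq_card_setU IC ID).
by rewrite cardsT card_ord; lia.
Qed.

End Spread.

End TreeOrders.

(** * Graphs of permutations *)

Section PermutationGraph.
Variable m : nat.
Notation label := (bool * 'I_m)%type.
Implicit Types (pi : {perm 'I_m}) (p q : label).

(* Two paths on [m] vertices, told apart by the boolean, and a perfect matching
   given by [pi] from the first to the second. *)
Definition hdart pi p q : bool :=
  (p.1 == q.1) && (q.2 == p.2.+1 :> nat) || [&& ~~ p.1, q.1 & q.2 == pi p.2].

Definition hadj pi p q : bool := hdart pi p q || hdart pi q p.

(** Twelve values whatever [m] is. Index 0 has a flag of its own, because decoding starts there. *)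
Definition colour p : bool * 'I_3 * bool := (p.1, inord (p.2 %% 3), p.2 == 0 :> nat).

Lemma colourE p q : colour p = colour q ->
  [/\ p.1 = q.1, p.2 = q.2 %[mod 3] & (p.2 == 0 :> nat) = (q.2 == 0 :> nat)].
Proof.
case=> -> e ->; split=> //; move/(congr1 val): e.
by rewrite /= !inordK // ltn_pmod.
Qed.

Lemma hadj_colour pi p q : hadj pi p q -> colour p <> colour q.
Proof.
move=> h /colourE[h1 h2 _]; move: h; rewrite /hadj /hdart h1.
by case: (q.1) => /=; rewrite ?orbF /= => /orP[]; lia.
Qed.

Section Readable.
Variables (I : finType) (R : rel I).

(** A minor model of the permutation graph whose branch sets are the fibres of [l]: every edge is
    realised, and nonadjacent labels are never joined. The last clause is the connectedness of the
    fibres. *)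
Definition readable pi (l : I -> option label) : Prop :=
  [/\ forall i j, R i j -> exists p q, [/\ l i = Some p, l j = Some q & p = q \/ hadj pi p q],
      forall p q, hdart pi p q -> exists i j, [/\ R i j, l i = Some p & l j = Some q]
    & forall i j p, l i = Some p -> l j = Some p ->
        connect [rel a b | R a b && (l a == l b)] i j].

(* Indices mod 3 tell the successor from the predecessor on a path, so labels
   propagate along each path from its end of index 0. *)
Lemma readable_sub pi pi' l l' : readable pi l -> readable pi' l' ->
  (forall i, omap colour (l i) = omap colour (l' i)) ->
  forall k,
  (forall i p, p.2 < k -> (l i == Some p) = (l' i == Some p)) ->
  forall i p, p.2 = k :> nat -> l i = Some p -> l' i = Some p.
Proof.
move=> [a1 b1 c1] [a2 b2 c2] col k IH i p pk li.
have lc j q : l j = Some q -> exists2 q', l' j = Some q' & colour q = colour q'.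
  by move=> e; have := col j; rewrite e; case: (l' j) => //= q' [e1 e2 e3]; exists q' => //; rewrite /colour e1 e2 e3.
case: k pk IH => [|k] pk IH.
  have [q -> /colourE[e1 _ e3]] := lc i p li; congr Some.
  move: e3; rewrite pk eqxx => /esym/eqP e3.
  by case: p q e1 e3 pk {li} => [? ?] [? ?] /= -> e3 pk; congr pair; apply: val_inj; rewrite /= e3.
have km : k < m by have := ltn_ord p.2; rewrite pk; apply: ltnW.
pose p0 : label := (p.1, Ordinal km).
(* The label [p] is first recognised at the far end [b] of a pair realising the dart from [p0]. In
   the second model the label of [b] equals or is adjacent to [p0]; the side excludes the matching,
   and the index mod 3 excludes [p0] and its predecessor. *)
have [a [b [Rab la lb]]] : exists a b, [/\ R a b, l a = Some p0 & l b = Some p].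
  by apply: b1; rewrite /hdart /= eqxx pk eqxx.
have la' : l' a = Some p0 by apply/eqP; rewrite -IH ?la.
have lb' : l' b = Some p.
  have [q e /colourE[e1 e2 e3]] := lc b p lb; rewrite e; congr Some.
  have [p1 [q1 []]] := a2 a b Rab; rewrite la' e => -[<-] [<-] [e'|].
    by move: e2; rewrite -e' /= pk; lia.
  rewrite /hadj /hdart /= -e1 eqxx /=.
  have : q.2 = k.+1 :> nat -> q = p.
    move=> e4; case: p q e1 e4 pk {li lb e e2 e3 p0 la la'} => [? ?] [? ?] /= -> e4 pk.
    by congr pair; apply: val_inj; rewrite /= pk e4.
  move: e2; rewrite pk; case: (p.1) => /=; rewrite ?andbF ?orbF => e2 h /orP[/eqP/h//|/eqP]; lia.
(* From [b] the label spreads over the whole fibre: joined vertices of equal colour cannot have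
   adjacent labels, so their labels are equal. *)
have /connectP[s] := c1 b i p lb li.
elim: s b lb lb' {Rab} => [|z s IHs] b lb lb' /=; first by move=> _ ->.
move=> /andP[/andP[Rbz /eqP lbz] ps] e.
apply: (IHs z) => //; first by rewrite -lbz.
have lz : l z = Some p by rewrite -lbz.
have [q e' cq] := lc z p lz; rewrite e'.
have [p1 [q1 []]] := a2 b z Rbz; rewrite lb' e' => -[<-] [<-] [->//|].
by move/hadj_colour.
Qed.

(** Once the two labellings agree, a pair realising the matching edge at [x] for [pi] must realise
    one for [pi'], which determines the image of [x]. *)
Lemma readable_inj pi pi' l l' : readable pi l -> readable pi' l' ->
  (forall i, omap colour (l i) = omap colour (l' i)) -> pi = pi'.
Proof.
move=> r1 r2 col.
have same k : forall i p, p.2 < k -> (l i == Some p) = (l' i == Some p).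
  elim: k => // k IH i p; rewrite ltnS leq_eqVlt => /orP[/eqP pk|]; last exact: IH.
  apply/eqP/eqP => h; first exact: (readable_sub r1 r2 col IH).
  by apply: (readable_sub r2 r1 (fun i => esym (col i)) _ pk h) => j q qk; rewrite IH.
have same' i p : l i = Some p -> l' i = Some p.
  by move/eqP; rewrite (same m) // => /eqP.
apply/permP => x.
have [i [j [Rij li lj]]] : exists i j, [/\ R i j, l i = Some (false, x) & l j = Some (true, pi x)].
  by case: r1 => _ b _; apply: b; rewrite /hdart /= eqxx.
case: r2 => a _ _; have [p [q []]] := a i j Rij.
rewrite (same' _ _ li) (same' _ _ lj) => -[<-] [<-] [//|].
by rewrite /hadj /hdart /= orbF => /eqP.
Qed.

End Readable.
End PermutationGraph.

Lemma set2_eq (T : finType) (a b c d : T) : [set a; b] = [set c; d] ->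
  (a = c /\ b = d) \/ (a = d /\ b = c).
Proof.
move=> e.
have : a \in [set c; d] by rewrite -e !inE eqxx.
have : b \in [set c; d] by rewrite -e !inE eqxx orbT.
have : c \in [set a; b] by rewrite e !inE eqxx.
have : d \in [set a; b] by rewrite e !inE eqxx orbT.
by rewrite !inE => /orP[] /eqP -> /orP[] /eqP -> /orP[] /eqP h1 /orP[] /eqP h2; subst; auto.
Qed.

(** * Sparse models and the code of a permutation *)

Section PermutationModel.
Variables (m : nat) (pi : {perm 'I_m}) (V : finType) (E : rel V).
Notation label := (bool * 'I_m)%type.
Variables (lam : V -> label) (root : label -> V) (par : V -> V) (ends : label -> label -> V * V).

Definition dart_edge x y := [exists p, exists q, hdart pi p q && (ends p q == (x, y))].

(* Every branch set is a tree, with [par] pointing towards its root, and [E]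
   has exactly one further edge for each edge of the graph of [pi]. *)
Record perm_model : Prop := PermModel {
  pm_sym : symmetric E;
  pm_root : forall p, lam (root p) = p;
  pm_par : forall x, x != root (lam x) -> E x (par x) /\ lam (par x) = lam x;
  pm_ends : forall p q, hdart pi p q ->
    [/\ lam (ends p q).1 = p, lam (ends p q).2 = q & E (ends p q).1 (ends p q).2];
  pm_edge : forall x y, E x y -> [|| (x != root (lam x)) && (par x == y),
    (y != root (lam y)) && (par y == x), dart_edge x y | dart_edge y x];
  pm_conn : forall x y, lam x = lam y -> connect [rel a b | E a b && (lam a == lam b)] x y }.

Hypothesis pm : perm_model.

Lemma dart_edgeP x y : reflect (exists p q, hdart pi p q /\ ends p q = (x, y)) (dart_edge x y).
Proof.
apply: (iffP existsP) => [[p /existsP[q /andP[h /eqP e]]]|[p [q [h e]]]]; first by exists p, q.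
by exists p; apply/existsP; exists q; rewrite h e eqxx.
Qed.

Lemma dart_edge_lam x y : dart_edge x y -> hdart pi (lam x) (lam y).
Proof. by case/dart_edgeP=> p [q [h e]]; have [] := pm_ends pm h; rewrite e /= => -> ->. Qed.

Lemma hdart_neq p q : hdart pi p q -> p != q.
Proof.
move=> h; apply/eqP => e; move: h; rewrite /hdart e eqxx /=.
by case: (q.1) => /=; rewrite ?andbF ?orbF => /eqP; lia.
Qed.

Lemma dart_degree x : #|[set y | dart_edge x y || dart_edge y x]| <= 4.
Proof.
pose p := lam x.
(* The candidates come from the successor, the image, the predecessor and the preimage of the label.
   At the end of a path the index falls back on itself, where no dart exists. *)
pose s := [:: (ends p (p.1, insubd p.2 p.2.+1)).2; (ends p (true, pi p.2)).2;
  (ends (p.1, insubd p.2 p.2.-1) p).1; (ends (false, (pi^-1)%g p.2) p).1].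
apply: leq_trans (card_size s); apply/subset_leq_card/subsetP => y; rewrite inE.
have pairE (q q' : label) : q.1 = q'.1 -> q.2 = q'.2 -> q = q'.
  by case: q q' => ? ? [? ?] /= -> ->.
case/orP=> /dart_edgeP[a [b [h e]]]; have [/=] := pm_ends pm h; rewrite e /= => la lb _.
- have : y = (ends a b).2 by rewrite e.
  move=> ->; have -> : a = p by rewrite -la.
  have := h; rewrite /hdart; have -> : a = p by rewrite -la.
  case/orP=> [/andP[/eqP h1 /eqP h2]|/and3P[h1 h2 /eqP h3]].
    suff -> : b = (p.1, insubd p.2 p.2.+1) by rewrite /s !inE eqxx.
    by apply: pairE => //=; apply: val_inj; rewrite val_insubd -h2 ltn_ord.
  suff -> : b = (true, pi p.2) by rewrite /s !inE eqxx orbT.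
  exact: pairE.
- have : y = (ends a b).1 by rewrite e.
  move=> ->; have -> : b = p by rewrite -lb.
  have := h; rewrite /hdart; have -> : b = p by rewrite -lb.
  case/orP=> [/andP[/eqP h1 /eqP h2]|/and3P[h1 h2 /eqP h3]].
    suff -> : a = (p.1, insubd p.2 p.2.-1) by rewrite /s !inE eqxx !orbT.
    by apply: pairE => //=; apply: val_inj; rewrite val_insubd h2 /= ltn_ord.
  suff -> : a = (false, (pi^-1)%g p.2) by rewrite /s !inE eqxx !orbT.
  apply: pairE => /=; first by case: (a.1) h1.
  by rewrite h3 permK.
Qed.

Definition darts := [set d : label * label | hdart pi d.1 d.2].

Lemma card_darts : #|darts| <= 4 * m.
Proof.
pose f (pb : label * bool) : label * label :=
  (pb.1, if pb.2 then (pb.1.1, insubd pb.1.2 pb.1.2.+1) else (true, pi pb.1.2)).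
apply: (@leq_trans #|[set f pb | pb in [set: label * bool]]|); last first.
  apply: leq_trans (leq_imset_card _ _) _; rewrite cardsT !card_prod card_ord !card_bool; lia.
apply/subset_leq_card/subsetP => -[p q]; rewrite inE /hdart /= => h; apply/imsetP.
case/orP: h => [/andP[/eqP h1 /eqP h2]|/and3P[h1 h2 /eqP h3]].
  exists (p, true); rewrite ?in_setT //; rewrite /f /=; case: q h1 h2 => [a b] /= <- h2.
  suff -> : b = insubd p.2 p.2.+1 by [].
  by apply: val_inj; rewrite val_insubd -h2 ltn_ord.
by exists (p, false); rewrite ?in_setT //; rewrite /f /=; case: q h2 h3 => [[] b] //= _ ->.
Qed.

Variable le : rel V.
Hypothesis tle : tree_order le.
Hypothesis compat : forall u v, Defs.cover le u v -> E u v.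

(** [S] has to contain the ends of all darts and of the inner edges that are not cover pairs, and to
    be closed under meets so that the tree order can be contracted to it. *)
Lemma small_frame : 0 < m -> exists S : {set V},
  [/\ #|S| <= 28 * m, meet_closed le S,
      forall p q, hdart pi p q -> ((ends p q).1 \in S) && ((ends p q).2 \in S)
    & forall x y, E x y -> lam x = lam y -> x \notin S \/ y \notin S ->
        Defs.cover le x y \/ Defs.cover le y x].
Proof.
move=> m0.
have [r hr] : exists r, forall x, le r x by case: tle.
have pT_ex v : exists u, v != r -> Defs.cover le u v.
  have [->|vr] := eqVneq v r; first by exists r.
  have [|u hu _] := @parent_of _ _ tle v r; last by exists u.
  by rewrite /strict eq_sym vr hr.
have [pT hpT] := choice pT_ex.
pose ET := [set [set v; pT v] | v in [set~ r]].
pose NR := ~: [set root p | p : label].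
pose EI := [set [set x; par x] | x in NR].
pose EL := [set [set (ends d.1 d.2).1; (ends d.1 d.2).2] | d in darts].
have NRP x : (x \in NR) = (x != root (lam x)).
  rewrite inE; congr (~~ _); apply/imsetP/eqP => [[p _ ->]|->]; first by rewrite (pm_root pm).
  by exists (lam x).
have cT : #|V| <= #|ET|.+1.
  rewrite card_in_imset; first by rewrite cardsC1; case: #|V|.
  move=> v w; rewrite !inE => vr wr /set2_eq[[]//|[e1 e2]].
  have /andP[/andP[n1 l1] _] := hpT v vr; have /andP[/andP[n2 l2] _] := hpT w wr.
  by rewrite -e1 in l2; rewrite e2 in l1; apply: tle_anti l2 l1.
have rinj : injective root by move=> p q e; rewrite -[p](pm_root pm) e (pm_root pm).
have cI : #|EI| + 2 * m <= #|V|.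
  have : #|[set root p | p : label]| = 2 * m.
    by rewrite card_imset // card_prod card_bool card_ord.
  have h1 : #|EI| <= #|NR| := leq_imset_card _ _.
  have h2 : #|[set root p | p : label]| + #|NR| = #|V| := cardsC _.
  by move=> h3; rewrite -h2 h3 addnC leq_add2l.
have cL : #|EL| <= 4 * m by apply: leq_trans (leq_imset_card _ _) card_darts.
have EP x y : E x y -> ([set x; y] \in EI) || ([set x; y] \in EL).
  move/(pm_edge pm) => /or4P[/andP[h /eqP<-]|/andP[h /eqP<-]|/dart_edgeP[p [q [h e]]]|/dart_edgeP[p [q [h e]]]].
  - by apply/orP; left; apply/imsetP; exists x; rewrite ?NRP.
  - by apply/orP; left; apply/imsetP; exists y; rewrite ?NRP // setUC.
  - by apply/orP; right; apply/imsetP; exists (p, q); rewrite ?inE //= e.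
  - by apply/orP; right; apply/imsetP; exists (p, q); rewrite ?inE //= e setUC.
have subT : ET \subset EI :|: EL.
  apply/subsetP => A /imsetP[v]; rewrite !inE => vr ->.
  by rewrite setUC; apply/EP/compat/hpT.
pose N := EI :\: ET.
(* [ET] has at least $|V|-1$ edges, at most $4m$ of them in [EL], and [EI] has at most $|V|-2m$
   edges; the difference leaves at most $2m+1$. *)
have cN : #|N| <= 2 * m + 1.
  have : #|ET| <= #|EI :&: ET| + #|EL|.
    apply: leq_trans (_ : #|(EI :&: ET) :|: EL| <= _); last exact: leq_card_setU.
    apply/subset_leq_card/subsetP => A AT; have := subsetP subT A AT.
    by rewrite !inE AT andbT.
  by have := cardsID ET EI; rewrite -/N; lia.
pose S0 := finset.cover (N :|: EL).
(* Two ends per edge give $2(2m+1) + 8m \le 14m$ vertices; the meet closure doubles this. *)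
have cS0 : #|S0| <= 14 * m.
  apply: leq_trans (_ : 2 * #|N :|: EL| <= _); last first.
    by have : #|N :|: EL| <= #|N| + #|EL| := leq_card_setU _ _; lia.
  apply: leq_trans (leq_card_cover _) _; rewrite mulnC -sum_nat_const.
  apply: leq_sum => A; rewrite inE => /orP[|/imsetP[d _ ->]]; last by rewrite cards2; case: (_ == _).
  by rewrite inE => /andP[_ /imsetP[x _ ->]]; rewrite cards2; case: (_ == _).
have [S [S0S cS leS]] := meet_closure tle S0; exists S; split=> //; first by lia.
  move=> p q h; have dA : [set (ends p q).1; (ends p q).2] \in N :|: EL.
    by rewrite inE; apply/orP; right; apply/imsetP; exists (p, q); rewrite ?inE.
  by apply/andP; split; apply: (subsetP S0S); apply/bigcupP; exists [set (ends p q).1; (ends p q).2];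
    rewrite // !inE eqxx ?orbT.
move=> x y Exy lxy nS.
have xyT : [set x; y] \in ET.
  apply: contraT => nT.
  have xyN : [set x; y] \in N.
    rewrite inE nT /=; have /(pm_edge pm) := Exy.
    case/or4P=> [/andP[h /eqP<-]|/andP[h /eqP<-]|/dart_edge_lam/hdart_neq|/dart_edge_lam/hdart_neq].
    - by apply/imsetP; exists x; rewrite ?NRP.
    - by apply/imsetP; exists y; rewrite ?NRP // setUC.
    - by rewrite lxy eqxx.
    - by rewrite lxy eqxx.
  have inS z : z \in [set x; y] -> z \in S.
    by move=> zxy; apply: (subsetP S0S); apply/bigcupP; exists [set x; y]; rewrite // inE xyN.
  by case: nS => /negP[]; apply: inS; rewrite !inE eqxx ?orbT.
case/imsetP: xyT => v; rewrite !inE => vr /set2_eq[[-> ->]|[-> ->]]; [right|left]; exact: hpT.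
Qed.

Section Code.
Variable n : nat.

(** Intended for [M] the contracted relation, with rows in row order and columns in column order,
    and [P] the identity of [S] in the same layout: [P] turns the column index [k] back into the row
    index [j] of the same vertex. *)
Definition decode (P M : {ffun 'I_n * 'I_n -> bool}) : rel 'I_n :=
  fun i j => [exists k, P (j, k) && M (i, k)].

Variable d : nat.
Hypothesis tww : exists s, contraction_sequence s /\ sequence_error (structure_matrix E le) s <= d.

Lemma code_exists : 0 < m -> 28 * m <= n -> exists P M (c : {ffun 'I_n -> option (bool * 'I_3 * bool)}) l,
  [/\ P \in grid_free (8 * d.+1.*2) n, M \in grid_free (8 * d.+1.*2) n,
      readable (decode P M) pi l & forall i, c i = omap (@colour m) (l i)].
Proof.
move=> m0 mn; have [S [cS mS endS covS]] := small_frame m0.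
have [s [cs es]] := tww.
have [rr [rc [rri rci rrlt rclt nog]]] := twin_width_orders S cs es.
have symE := pm_sym pm.
pose R := contracted le S lam E.
have RS u v : R u v -> (u \in S) && (v \in S) by case/and3P=> -> ->.
have sparse x y : E x y -> [|| par x == y, par y == x | dart_edge x y || dart_edge y x].
  by move/(pm_edge pm) => /or4P[/andP[_ ->]|/andP[_ ->]|->|->]; rewrite ?orbT.
have spr : spread 8 (structure_matrix E le) R.
  move=> Q u v uQ ui vi uv cst.
  apply: (contracted_spread tle sparse dart_degree uQ ui vi uv) => p x xQ.
  by case: (cst p x xQ) => h1 h2 h3 h4 h5; split.
have sprt : spread 8 (fun x y => structure_matrix E le y x) (fun x y => R y x).
  move=> Q u v uQ ui vi uv cst.
  apply: (contracted_spread (S := S) (lam := lam) tle sparse dart_degree uQ ui vi).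
    by move=> p; rewrite contracted_sym //; apply: uv.
  by move=> p x xQ; case: (cst p x xQ) => h1 h2 h3 h4 h5; split.
pose D (x y : V) := (x \in S) && (x == y).
(* Matrix entries record equality, so two diagonal pairs with distinct vertices already contradict
   the constancy. *)
have sprD (A : V -> V -> _) (Dt : rel V) : (forall x y, A x y = structure_matrix E le x y \/ A x y = structure_matrix E le y x) ->
    (forall x y, Dt x y -> x = y) -> spread 8 A Dt.
  move=> hA hD Q u v uQ ui vi uv cst.
  pose p0 : 'I_8 := ord0; pose p1 : 'I_8 := lift ord0 ord0.
  have := cst p1 (u p0) (uQ p0).
  have e1 := hD _ _ (uv p1).
  have n01 : u p0 != v p1 by rewrite -e1; apply/eqP => /ui.
  case: (hA (u p0) (v p1)) => ->; case: (hA (u p1) (v p1)) => -> /(congr1 (fun t => t.1.1.1.1)) /=;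
  by rewrite e1 eqxx ?[v p1 == _]eq_sym (negPf n01).
have nogR := nog 8 R isT RS spr sprt.
have nogD : ~ grid (8 * d.+1.*2) (quot rr rc D).
  refine (nog 8 D isT _ _ _).
  - by move=> x y /andP[xS /eqP<-]; rewrite xS.
  - by refine (sprD _ D _ _) => x y; [left | case/andP=> _ /eqP].
  - refine (sprD _ (fun x y => D y x) _ _) => x y; first by right.
  by case/andP=> _ /eqP.
have n0 : 0 < n by apply: leq_trans mn; rewrite muln_gt0.
pose o (f : V -> nat) x : 'I_n := insubd (Ordinal n0) (f x).
have lt_n x (f : V -> nat) : (x \in S -> f x < #|S|) -> x \in S -> f x < n.
  by move=> h xS; apply: leq_trans (h xS) (leq_trans cS mn).
have oE (f : V -> nat) x : (forall x, x \in S -> f x < #|S|) -> x \in S -> o f x = f x :> nat.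
  by move=> h xS; rewrite val_insubd (lt_n x f (h x) xS).
pose enc (Q : rel V) : {ffun 'I_n * 'I_n -> bool} := [ffun p : 'I_n * 'I_n => quot rr rc Q p.1 p.2].
have free Q : ~ grid (8 * d.+1.*2) (quot rr rc Q) -> enc Q \in grid_free (8 * d.+1.*2) n.
  move=> h; rewrite inE; apply/negP => /asboolP g; apply: h; apply: grid_sub g => i j.
  by case/existsP=> -[a b] /and3P[/= /eqP<- /eqP<-]; rewrite ffunE.
(* Row indices taken by no vertex of [S] remain unlabelled. *)
pose l (i : 'I_n) : option (bool * 'I_m) := omap lam [pick x in S | rr x == i].
have lE x : x \in S -> l (o rr x) = Some (lam x).
  move=> xS; rewrite /l; case: pickP => [y /andP[yS /eqP e]|/(_ x)] /=; last by rewrite xS oE ?eqxx.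
  by rewrite oE // in e; rewrite (rri y x).
have lS i p : l i = Some p -> exists2 x, x \in S & i = o rr x /\ lam x = p.
  rewrite /l; case: pickP => //= x /andP[xS /eqP e] [<-]; exists x => //; split=> //.
  by apply: val_inj; rewrite /= oE.
have dec i j : decode (enc D) (enc R) i j -> exists x y, [/\ R x y, i = o rr x & j = o rr y].
  case/existsP=> k /andP[]; rewrite !ffunE /= => /quotP[y [y' [ey ey' /andP[yS /eqP e]]]].
  case/quotP=> x [z [ex ez Rxz]]; have /andP[xS zS] := RS _ _ Rxz.
  have e' : y = z by apply: rci; rewrite // e ey' ez.
  exists x, z; split=> //; apply: val_inj; rewrite /= oE ?ex //.
  by rewrite -e' ey.
have dec' x y : R x y -> decode (enc D) (enc R) (o rr x) (o rr y).
  move=> Rxy; have /andP[xS yS] := RS _ _ Rxy.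
  apply/existsP; exists (o rc y); rewrite !ffunE /=; apply/andP; split; apply/quotP.
    by exists y, y; rewrite !oE //; split=> //; apply/andP.
  by exists x, y; rewrite !oE.
exists (enc D), (enc R), [ffun i => omap (@colour m) (l i)], l; split; rewrite ?free //; last by move=> i; rewrite ffunE.
split.
- move=> i j /dec[x [y [Rxy -> ->]]]; have /andP[xS yS] := RS _ _ Rxy.
  exists (lam x), (lam y); rewrite !lE //; split=> //.
  case: (contracted_lam Rxy) => [|/(pm_edge pm)]; first by left.
  case/or4P=> [/andP[h /eqP<-]|/andP[h /eqP<-]|/dart_edge_lam h|/dart_edge_lam h].
  + by left; case: (pm_par pm h).
  + by left; case: (pm_par pm h).
  + by right; rewrite /hadj h.
  + by right; rewrite /hadj h orbT.
- move=> p q h; have [l1 l2 Ee] := pm_ends pm h; have /andP[s1 s2] := endS p q h.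
  exists (o rr (ends p q).1), (o rr (ends p q).2); rewrite !lE // l1 l2; split=> //.
  by apply: dec'; rewrite /R /contracted s1 s2 Ee.
move=> i j p /lS[x xS [-> lx]] /lS[y yS [-> ly]].
have := contracted_connect tle mS covS xS yS (pm_conn pm (etrans lx (esym ly))).
case/connectP=> t pt ->; elim: t x {xS lx} pt => [|z t IH] x /= => [_|/andP[/andP[Rxz lxz] pt]].
  exact: connect0.
apply: connect_trans (IH z pt); apply: connect1 => /=; have /andP[xS zS] := RS _ _ Rxz.
by rewrite dec' //= !lE // (eqP lxz).
Qed.

End Code.
End PermutationModel.

Lemma connect_homo (T T' : finType) (e : rel T) (e' : rel T') (f : T -> T') x y :
  (forall a b, e a b -> connect e' (f a) (f b)) -> connect e x y -> connect e' (f x) (f y).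
Proof.
move=> h /connectP[s ps ->]; elim: s x ps => [|z s IH] x /=; first by rewrite connect0.
by move=> /andP[/h xz /IH]; apply: connect_trans.
Qed.

(** * From a clique minor to a sparse model *)

Section ModelFacts.
Variables (m : nat) (pi : {perm 'I_m}) (V : finType) (E : rel V).
Notation label := (bool * 'I_m)%type.
Variables (lam : V -> label) (root : label -> V) (par : V -> V) (ends : label -> label -> V * V).
Hypothesis pm : perm_model pi E lam root par ends.

Lemma perm_model_connected x y : connect E x y.
Proof.
have symE := pm_sym pm; have csym := sym_connect_sym symE.
have inner a b : lam a = lam b -> connect E a b.
  move/(pm_conn pm); apply: connect_sub => u v /andP[Euv _]; exact: connect1.
have dart p q : hdart pi p q -> connect E (root p) (root q).
  move=> h; have [l1 l2 Ee] := pm_ends pm h.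
  apply: (@connect_trans _ _ (ends p q).1); first by apply: inner; rewrite (pm_root pm).
  apply: connect_trans (connect1 Ee) _; by apply: inner; rewrite (pm_root pm).
have m0 : 0 < m by case: (lam x).2 => i /=; case: m.
pose z : 'I_m := Ordinal m0.
have side s i : connect E (root (s, z)) (root (s, i)).
  case: i => i; elim: i => [|i IH] im; first by rewrite (_ : z = Ordinal im) ?connect0 //; apply: val_inj.
  apply: connect_trans (IH (ltnW im)) _; apply: dart.
  by rewrite /hdart /= !eqxx.
have base p : connect E (root (false, z)) (root p).
  case: p => [[] i] //; apply: (@connect_trans _ _ (root (true, pi z))); last first.
    by apply: connect_trans (side true i); rewrite csym.
  by apply: dart; rewrite /hdart /= eqxx.
have xr w : connect E (root (lam w)) w by apply: inner; rewrite (pm_root pm).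
apply: (@connect_trans _ _ (root (false, z))).
  by rewrite csym; apply: connect_trans (base _) (xr x).
exact: connect_trans (base _) (xr y).
Qed.

(** Spanning twin-width is defined through components, whose vertices form another type even when
    the graph is connected; this carries the model over to it. *)
Lemma perm_model_iso (V' : finType) (E' : rel V') (f : V -> V') (g : V' -> V) :
  cancel f g -> cancel g f -> (forall x y, E' (f x) (f y) = E x y) ->
  perm_model pi E' (lam \o g) (f \o root) (f \o par \o g)
    (fun p q => (f (ends p q).1, f (ends p q).2)).
Proof.
move=> fg gf EE'.
have Eg x y : E (g x) (g y) = E' x y by rewrite -EE' !gf.
have de x y : dart_edge pi (fun p q => (f (ends p q).1, f (ends p q).2)) x y
    = dart_edge pi ends (g x) (g y).
  apply: eq_existsb => p; apply: eq_existsb => q; congr (_ && _).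
  by rewrite xpair_eqE !(can2_eq fg gf) -xpair_eqE -surjective_pairing.
split.
- by move=> x y; rewrite -!Eg (pm_sym pm).
- by move=> p /=; rewrite fg (pm_root pm).
- move=> x /=; rewrite -(can2_eq gf fg) => /(pm_par pm)[h1 h2].
  by rewrite fg -Eg fg.
- by move=> p q /(pm_ends pm)[h1 h2 h3] /=; rewrite !fg EE'.
- move=> x y; rewrite -Eg => /(pm_edge pm); rewrite !de /=.
  by rewrite -!(can2_eq gf fg) !(can2_eq fg gf).
move=> x y /= /(pm_conn pm) h; rewrite -[x]gf -[y]gf.
by apply: connect_homo h => a b /= h; apply: connect1; rewrite /= EE' !fg.
Qed.

End ModelFacts.

(** The parents in any compatible tree order form a spanning tree rooted at the minimum; moving to
    the parent shrinks the down-set, so the root is reached. *)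
Lemma tree_parent (H : sgraph) (r0 : H) : connected H -> exists (r : H) (par : H -> H),
  (forall x, x != r -> sedge x (par x)) /\
  forall x, connect [rel a b | (a != r) && (par a == b) || (b != r) && (par b == a)] x r.
Proof.
move=> cH; have [le [tle compat]] := compatible_tree_order_ex (cH r0).
have [r hr] : exists r, forall x, le r x by case: tle.
have ex x : exists u, x != r -> Defs.cover le u x.
  have [->|xr] := eqVneq x r; first by exists r.
  have [|u hu _] := @parent_of _ _ tle x r; last by exists u.
  by rewrite /strict eq_sym xr hr.
have [par hpar] := choice ex; exists r, par; split.
  by move=> x xr; rewrite sedge_sym; apply/compat/hpar.
move=> x; have [n] := ubnP #|[set s | le s x]|; elim: n x => // n IH x.
rewrite ltnS => cx; have [->|xr] := eqVneq x r; first exact: connect0.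
have /andP[/andP[ne lpx] _] := hpar x xr.
apply: connect_trans (connect1 _) (IH (par x) _); first by rewrite /= xr eqxx.
apply: leq_trans cx; apply: proper_card; apply/properP; split.
  by apply/subsetP => s; rewrite !inE => h; apply: (tle_trans tle) lpx.
exists x; rewrite inE ?(tle_refl tle) //; apply/negP => h.
by case/eqP: ne; apply: (tle_anti tle).
Qed.

Lemma set_tree_parent (G : sgraph) (X : {set G}) : X != set0 -> connected (induced X) ->
  exists (r : G) (par : G -> G), [/\ r \in X,
    forall x, x \in X -> x != r -> (par x \in X) && sedge x (par x) &
    forall x, x \in X -> connect [rel a b | [&& a \in X, b \in X &
        (a != r) && (par a == b) || (b != r) && (par b == a)]] x r].
Proof.
move=> /set0Pn[x0 x0X] cX; pose r0 : induced X := exist _ x0 x0X.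
have [r [par [h1 h2]]] := tree_parent r0 cX.
pose p x := if insub x is Some u then val (par u) else x.
have pE (u : induced X) : p (val u) = val (par u) by rewrite /p valK.
have neE (u v : induced X) : (val u != val v) = (u != v) by rewrite (inj_eq val_inj).
exists (val r), p; split; first exact: (valP r).
  move=> x xX; rewrite -[x]/(val (exist _ x xX : induced X)) neE pE => /h1 h.
  by apply/andP; split; [apply: (valP (par _)) | apply: h].
move=> x xX; rewrite -[x]/(val (exist _ x xX : induced X)).
apply: connect_homo (h2 _) => a b /= h; apply: connect1.
by rewrite /= (valP a) (valP b) !neE !pE !(inj_eq val_inj).
Qed.

Section SubgraphModel.
Variables (m : nat) (pi : {perm 'I_m}) (G : sgraph).
Notation label := (bool * 'I_m)%type.
Hypothesis m0 : 0 < m.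

(** Keep a spanning tree of every branch set and one edge for each dart. [F] discards all the other
    edges, which is where closure under non-induced subgraphs will be used. *)
Lemma minor_subgraph_model : minor (complete_graph #|{: label}|) G ->
  exists (W : {set G}) (F : {set {set G}}) lam root par ends,
    perm_model pi (@sedge (subgraph W F)) lam root par ends.
Proof.
move=> [B0 [B1 B2 B3 B4]].
pose B (p : label) := B0 (enum_rank p).
have dis p q x : x \in B p -> x \in B q -> p = q.
  move=> xp xq; apply/eqP; apply: contraT => ne.
  have ne' : enum_rank p != enum_rank q by rewrite (inj_eq enum_rank_inj).
  by rewrite (disjointFr (B3 _ _ ne') xp) in xq.
have [root hroot] := choice (fun p : label => set_tree_parent (B1 (enum_rank p)) (B2 (enum_rank p))).
have [par hp] := choice hroot.
have ex (pq : label * label) : exists e : G * G, pq.1 != pq.2 ->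
    [/\ e.1 \in B pq.1, e.2 \in B pq.2 & sedge e.1 e.2].
  have [->|ne] := eqVneq pq.1 pq.2; first by exists (root pq.1, root pq.1).
  have ne' : enum_rank pq.1 != enum_rank pq.2 by rewrite (inj_eq enum_rank_inj).
  by have [x [y [h1 h2 h3]]] := B4 _ _ ne'; exists (x, y).
have [ends' hends] := choice ex; pose ends p q := ends' (p, q).
pose W := \bigcup_p B p.
have BW p x : x \in B p -> x \in W by move=> xB; apply/bigcupP; exists p.
pose p0 : label := (false, Ordinal m0).
pose lam x : label := odflt p0 [pick p | x \in B p].
have lamE p x : x \in B p -> lam x = p.
  move=> xp; rewrite /lam; case: pickP => [q xq|/(_ p)] /=; first exact: dis xq xp.
  by rewrite xp.
pose F := [set [set x; par (lam x) x] | x in [set x in W | x != root (lam x)]] :|: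
  [set [set (ends d.1 d.2).1; (ends d.1 d.2).2] | d in @darts _ pi].
have rW p : root p \in B p by have [] := hp p.
pose k x : subgraph W F := insubd (exist _ (root p0) (BW _ _ (rW p0))) x.
have kE x : x \in W -> val (k x) = x by move=> xW; rewrite val_insubd xW.
have vk (u : subgraph W F) : k (val u) = u by apply: val_inj; rewrite kE ?(valP u).
have lamW x : x \in W -> x \in B (lam x).
  by case/bigcupP=> p _ xp; rewrite (lamE p).
have hd p q : hdart pi p q -> [/\ (ends p q).1 \in B p, (ends p q).2 \in B q & sedge (ends p q).1 (ends p q).2].
  by move/hdart_neq => h; apply: (hends (p, q)).
have parP x : x \in W -> x != root (lam x) ->
    [/\ par (lam x) x \in B (lam x), sedge x (par (lam x) x) & [set x; par (lam x) x] \in F].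
  move=> xW xr; have [_ h _] := hp (lam x); have /andP[h1 h2] := h x (lamW x xW) xr.
  split=> //; rewrite inE; apply/orP; left; apply/imsetP; exists x => //.
  by rewrite inE xW.
exists W, F, (fun u => lam (val u)), (fun p => k (root p)),
  (fun u => k (par (lam (val u)) (val u))), (fun p q => (k (ends p q).1, k (ends p q).2)).
have kneq (u : subgraph W F) x : x \in W -> (u == k x) = (val u == x).
  by move=> xW; rewrite -(inj_eq val_inj) kE.
have sE (u v : subgraph W F) : sedge u v = ([set val u; val v] \in F) && sedge (val u) (val v) by [].
split.
- exact: sedge_sym.
- by move=> p; rewrite kE ?(lamE p) //; apply: BW (rW p).
- move=> u; rewrite kneq; last exact: BW (rW _).
  move=> /(parP _ (valP u))[h1 h2 h3]; rewrite sE kE ?h3 ?h2 ?(lamE _ _ h1) //; exact: BW h1.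
- move=> p q h; have [h1 h2 h3] := hd p q h.
  rewrite /= /subgraph_edge !kE ?(BW _ _ h1) ?(BW _ _ h2) // (lamE _ _ h1) (lamE _ _ h2) h3 andbT.
  by split=> //; rewrite inE; apply/orP; right; apply/imsetP; exists (p, q); rewrite ?inE.
- move=> u v; rewrite sE => /andP[]; rewrite inE => /orP[/imsetP[x]|/imsetP[[p q]]]; rewrite inE.
    case/andP=> xW xr /set2_eq[[e1 e2]|[e1 e2]] _.
      apply/or4P; apply: Or41; rewrite kneq; last exact: BW (rW _).
      by rewrite -e1 in xr e2; rewrite xr /= -e2 vk.
    apply/or4P; apply: Or42; rewrite kneq; last exact: BW (rW _).
    by rewrite -e2 in xr e1; rewrite xr /= -e1 vk.
  move=> h /set2_eq[[/= e1 e2]|[/= e1 e2]] _.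
    apply/or4P; apply: Or43; apply/dart_edgeP; exists p, q; split=> //.
    by rewrite -e1 -e2 !vk.
  apply/or4P; apply: Or44; apply/dart_edgeP; exists p, q; split=> //.
  by rewrite -e1 -e2 !vk.
move=> u v luv; pose Q := [rel a b | @sedge (subgraph W F) a b && (lam (val a) == lam (val b))].
have Qsym : symmetric Q by move=> a b; rewrite [LHS]/= [RHS]/= subgraph_edge_sym eq_sym.
have toroot (a : subgraph W F) : connect Q a (k (root (lam (val a)))).
  rewrite -{1}[a]vk; set p := lam (val a); have [_ hpar hc] := hp p.
  apply: connect_homo (hc _ (lamW _ (valP a))) => x y /= /and3P[xB yB h].
  have step x' y' : x' \in B p -> y' \in B p -> x' != root p -> par p x' = y' -> Q (k x') (k y').
    move=> xB' yB' xr' e; rewrite /Q /= /subgraph_edge !kE ?(BW p) // !(lamE p) // eqxx andbT.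
    have lx : lam x' = p by apply: lamE.
    by have := @parP x' (BW _ _ xB'); rewrite lx e => /(_ xr')[_ -> ->].
  apply: connect1; case/orP: h => /andP[h1 /eqP h2]; first exact: step.
  by rewrite Qsym; apply: step.
have := toroot u; have := toroot v; rewrite luv => h1 h2; apply: connect_trans h2 _.
by rewrite (sym_connect_sym Qsym).
Qed.

End SubgraphModel.

(** With $N = (B+2)^2$, each of the last $N+1$ factors of $(2N+1)!$ exceeds $N$, so the factorial is
    at least $N^{N+1} = (B+2)^{2N+2}$. *)
Lemma fact_superexp B : exists2 m, 0 < m & B ^ m < m`!.
Proof.
pose N := B.+2 ^ 2; have N0 : 0 < N by rewrite expn_gt0.
have h n : N ^ n <= (N + n)`!.
  elim: n => [|n IH]; first by rewrite expn0 fact_gt0.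
  by rewrite addnS factS expnS; apply: leq_mul => //; lia.
exists (N + N.+1); first by rewrite addn_gt0 N0.
apply: leq_trans (h _); rewrite /N -expnM -/N.
apply: leq_ltn_trans (_ : B.+2 ^ (N + N.+1) < _); first by rewrite leq_exp2r; lia.
by rewrite ltn_exp2l; lia.
Qed.

Lemma sequence_of_spanning_twin_width (G : sgraph) (x : G) c : spanning_twin_width G <= c ->
  exists le : rel (component x), [/\ tree_order le, compatible le &
    exists s, contraction_sequence s /\ sequence_error (structure_matrix (@sedge (component x)) le) s <= c].
Proof.
move=> h; have {h} : connected_spanning_twin_width (component_root x) (@component_connected G x) <= c.
  apply: leq_trans h; rewrite /spanning_twin_width.
  exact: (@leq_bigmax _ (fun x => connected_spanning_twin_width (component_root x) (@component_connected G x)) x).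
rewrite /connected_spanning_twin_width; case: ex_minnP => k /asboolP[le [h1 h2 h3]] _ kc.
exists le; split=> //; move: h3; rewrite /twin_width; case: ex_minnP => k' /asboolP[s [h3 h4]] _ e.
by exists s; split=> //; rewrite h4 e.
Qed.

(** * Bounded spanning twin-width excludes a clique minor *)

Section Unbounded.
Variables (C : sgraph -> Prop) (c : nat).
Hypothesis monoC : monotone_class C.
Hypothesis bound : forall G, C G -> spanning_twin_width G <= c.

Let K := 8 * c.+1.*2.

Lemma permutation_code m n (G : sgraph) (pi : {perm 'I_m}) : 0 < m -> 28 * m <= n ->
  C G -> minor (complete_graph #|{: bool * 'I_m}|) G ->
  exists (P M : {ffun 'I_n * 'I_n -> bool}) (col : {ffun 'I_n -> option (bool * 'I_3 * bool)}) l,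
  [/\ P \in grid_free K n, M \in grid_free K n,
      readable (decode P M) pi l & forall i, col i = omap (@colour m) (l i)].
Proof.
move=> m0 mn CG mG.
have [W [F [lam [root [par [ends pm]]]]]] := minor_subgraph_model pi m0 mG.
have CH : C (subgraph W F) by case: monoC => _; apply.
pose x := root (false, Ordinal m0).
have [le [tle compat tww]] := sequence_of_spanning_twin_width x (bound CH).
have inc (u : subgraph W F) : u \in [set y | connect (@sedge (subgraph W F)) x y].
  by rewrite inE; apply: (perm_model_connected pm).
pose f u : component x := exist _ u (inc u).
have fg : cancel f val by [].
have gf : cancel val f by move=> u; apply: val_inj.
have pm' := @perm_model_iso _ _ _ _ _ _ _ _ pm _ (@sedge (component x)) f val fg gf (fun _ _ => erefl).
exact: (code_exists pm' tle compat tww m0 mn).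
Qed.

Lemma bounded_excludes : exists t, forall G, C G -> ~ minor (complete_graph t) G.
Proof.
have K1 : 1 < K by rewrite /K; lia.
have [D hD] := klazar K1.
(* Each of the two matrices has at most $D^n$ values and the colouring $13^n$, counting twelve
   colours or none. The exponent 56 comes from rounding $28m$ up to a power of two, the sizes
   covered by [klazar]. *)
have [m m0 hm] := fact_superexp ((D * D * 13) ^ 56).
exists #|{: bool * 'I_m}| => G CG mG.
have m28 : 1 < 28 * m by lia.
have /andP[h1 h2] := @up_log_bounds 2 (28 * m) isT m28.
pose q := up_log 2 (28 * m); pose n := 2 ^ q.
have q0 : 0 < q by rewrite up_log_gt0.
have n56 : n <= 56 * m.
  by rewrite /n -(prednK q0) expnS; move: h1; rewrite -/q; lia.
pose code := ({ffun 'I_n * 'I_n -> bool} * {ffun 'I_n * 'I_n -> bool} * {ffun 'I_n -> option (bool * 'I_3 * bool)})%type.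
have ex (pi : {perm 'I_m}) : exists cd : code, exists l,
    [/\ cd.1.1 \in grid_free K n, cd.1.2 \in grid_free K n,
      readable (decode cd.1.1 cd.1.2) pi l & forall i, cd.2 i = omap (@colour m) (l i)].
  by have [P [M [col [l H]]]] := permutation_code pi m0 h2 CG mG; exists (P, M, col), l.
have [f hf] := choice ex.
have finj : injective f.
  move=> pi pi' e; have [l [_ _ r1 c1]] := hf pi; have [l' [_ _ r2 c2]] := hf pi'.
  rewrite -e in r2 c2; apply: (readable_inj r1 r2) => i; by rewrite -c1 -c2.
have sub : [set f pi | pi : {perm 'I_m}] \subset
    setX (setX (grid_free K n) (grid_free K n)) [set: {ffun 'I_n -> option (bool * 'I_3 * bool)}].
  apply/subsetP => cd /imsetP[pi _ ->]; have [l [a b _ _]] := hf pi.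
  by case: (f pi) a b => [[P M] col] /= a b; rewrite !in_setX in_setT a b.
have := subset_leq_card sub; rewrite card_imset // card_Sn !cardsX cardsT card_ffun card_option !card_prod card_bool !card_ord.
apply/negP; rewrite -ltnNge; apply: leq_trans hm; rewrite ltnS -expnM.
apply: leq_trans (_ : (D * D * 13) ^ n <= _); last first.
  rewrite leq_pexp2l //.
  (* [D = 0] is impossible, since the zero matrix of size 1 is grid-free. *)
  case: D hD => // h; have := h 0; rewrite expn0 expn1 leqn0 cards_eq0 => /eqP e.
  have := in_set0 ([ffun=> false] : {ffun 'I_1 * 'I_1 -> bool}); rewrite -e inE => /negbFE/asboolP.
  move=> [a [b ab]]; have [u [v [_ _ /existsP[p]]]] := ab 0 0 (ltnW K1) (ltnW K1).
  by rewrite ffunE !andbF.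
rewrite !expnMn; apply: leq_mul; last by [].
by apply: leq_mul; apply: hD.
Qed.

End Unbounded.

(** * Depth-first search *)

(** The first bit is the most significant, so for vectors of equal length comparing values is
    comparing lexicographically. *)
Fixpoint binary (s : seq bool) : nat :=
  if s is b :: s' then b * 2 ^ size s' + binary s' else 0.

Lemma binary_lt s : binary s < 2 ^ size s.
Proof. by elim: s => //= b s IH; rewrite expnS; case: b; lia. Qed.

Lemma binary_lex s s' i : size s = size s' -> binary s' <= binary s ->
  nth false s' i -> ~~ nth false s i -> exists2 j, j < i & nth false s j && ~~ nth false s' j.
Proof.
elim: s s' i => [|b s IH] [|b' s'] //= i; first by rewrite nth_nil.
move=> [sz]; have := binary_lt s; have := binary_lt s'; rewrite -sz.
case: i => [|i] /= l1 l2; first by case: b' b => [] [] //=; lia.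
case: b b' => [] [] /= le h1 h2; last 2 first.
- by lia.
- by have [|j ji h] := IH s' i sz _ h1 h2; [lia | exists j.+1].
- by have [|j ji h] := IH s' i sz _ h1 h2; [lia | exists j.+1].
- by exists 0.
Qed.

Lemma prefix_total (T : eqType) (s1 s2 s : seq T) :
  prefix s1 s -> prefix s2 s -> size s1 <= size s2 -> prefix s1 s2.
Proof.
rewrite !prefixE => /eqP e1 /eqP e2 le; apply/eqP.
by rewrite -{1}e2 take_takel.
Qed.

Lemma prefix_size_eq (T : eqType) (s1 s2 s : seq T) :
  prefix s1 s -> prefix s2 s -> size s1 = size s2 -> s1 = s2.
Proof. by rewrite !prefixE => /eqP e1 /eqP e2 e; rewrite -e1 -e2 e. Qed.

Lemma prefix_rcons_lt (T : eqType) (s1 s2 : seq T) x :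
  prefix s1 (rcons s2 x) -> size s1 <= size s2 -> prefix s1 s2.
Proof. by move=> h; apply: prefix_total h (prefix_rcons _ _). Qed.

Section DFS.
Variables (V : finType) (E : rel V).
Hypothesis symE : symmetric E.

Definition within (X : {set V}) : rel V := fun a b => [&& a \in X, b \in X & E a b].

Definition connected_on (X : {set V}) := forall x y, x \in X -> y \in X -> connect (within X) x y.

Lemma within_sym X : symmetric (within X).
Proof. by move=> x y; rewrite /within symE andbCA. Qed.

(** The stack is read from its bottom, so adjacency to vertices near the root weighs most. *)
Definition attachment (t : seq V) (A : {set V}) : nat := binary [seq [exists y in A, E a y] | a <- t].

Definition below (D : {set V}) (pth : V -> seq V) x := [set z in D | prefix (pth x) (pth z)].

(* [P] is the stack of the search when it enters [D] at [v]; [pth] lists the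
   stack from its bottom up to each vertex. *)
Record dfs_on (D : {set V}) (v : V) (P : seq V) (pth : V -> seq V) (pos : V -> nat) : Prop := DfsOn {
  do_root : pth v = rcons P v;
  do_parent : forall x, x \in D -> x != v -> exists u, [/\ u \in D, pth x = rcons (pth u) x & E u x];
  do_pre : forall x, x \in D -> prefix (rcons P v) (pth x);
  do_edge : forall x y, x \in D -> y \in D -> E x y -> prefix (pth x) (pth y) || prefix (pth y) (pth x);
  do_inj : {in D &, injective pos};
  do_le : forall x y, x \in D -> y \in D -> prefix (pth x) (pth y) -> pos x <= pos y;
  do_conv : forall x y z, x \in D -> y \in D -> z \in D -> prefix (pth x) (pth y) ->
    pos x <= pos z <= pos y -> prefix (pth x) (pth z);
  do_lex : forall t x y, x \in D -> y \in D -> pth x = rcons t x -> pth y = rcons t y ->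
    pos x < pos y -> attachment t (below D pth y) <= attachment t (below D pth x) }.

(** Remove [v], search each component of the rest from a neighbour of [v], and visit the components
    by decreasing attachment to the extended stack. *)
Lemma dfs_exists (D : {set V}) (v : V) (P : seq V) : v \in D -> connected_on D ->
  exists pth pos, dfs_on D v P pth pos.
Proof.
have [n] := ubnP #|D|; elim: n D v P => // n IH D v P cD vD conD.
pose D' := D :\ v; pose comp x := [set y | connect (within D') x y].
have D'P x : (x \in D') = (x \in D) && (x != v) by rewrite !inE andbC.
have csym := sym_connect_sym (within_sym D').
have comp_self x : x \in comp x by rewrite inE connect0.
have comp_in x y : x \in D' -> y \in comp x -> y \in D'.
  move=> xD'; rewrite inE => /connectP[s + ->]; elim: s x xD' => [|z s IHs] x xD' //= /andP[/and3P[_ zD' _]].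
  exact: IHs.
have comp_eq x y : y \in comp x -> comp y = comp x.
  rewrite inE => xy; apply/setP => z; rewrite !inE; apply/idP/idP; last by rewrite csym in xy; apply: connect_trans.
  exact: connect_trans.
have comp_con x : x \in D' -> connected_on (comp x).
  move=> xD' y z yx zx; have : connect (within D') y z.
    by move: zx; rewrite -(comp_eq x y yx) inE.
  case/connectP=> s + ->; elim: s y yx {zx} => [|u s IHs] y yx /=; first by rewrite connect0.
  move=> /andP[yu ps]; have ux : u \in comp x by rewrite -(comp_eq _ _ yx) inE connect1.
  apply: connect_trans (connect1 _) (IHs u ux ps).
  by rewrite /within yx ux; case/and3P: yu.
have entry x : x \in D' -> exists2 w, w \in comp x & E v w.
  move=> xD'; have xD : x \in D by move: xD'; rewrite D'P => /andP[].
  have /connectP[s ps es] := conD x v xD vD.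
  suff H u : u \in comp x -> path (within D) u s -> v = last u s -> exists2 w, w \in comp x & E v w.
    exact: H (comp_self x) ps es.
  elim: s u {ps es} => [|z s IHs] u ux /=.
    by move=> _ e; have := comp_in x u xD' ux; rewrite -e D'P eqxx andbF.
  move=> /andP[/and3P[uD zD uz] ps] e; have [ez|zv] := eqVneq z v.
    by exists u => //; rewrite symE -ez.
  apply: (IHs z) => //; rewrite -(comp_eq _ _ ux) inE; apply: connect1.
  by rewrite /within uz (comp_in x) // D'P zD zv.
have small x : x \in D' -> #|comp x| < n.
  move=> xD'; apply: leq_trans (_ : #|D'| < n); last by move: cD; rewrite (cardsD1 v D) vD add1n ltnS.
  apply/subset_leq_card/subsetP => y; exact: comp_in.
pose P' := rcons P v.
(* The choice is indexed by vertex sets, so that all vertices of a component share one search; sets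
   that are not components get a dummy value. *)
have exA (A : {set V}) : exists wpp : V * (V -> seq V) * (V -> nat), (exists2 x, x \in D' & A = comp x) ->
    [/\ wpp.1.1 \in A, E v wpp.1.1 & dfs_on A wpp.1.1 P' wpp.1.2 wpp.2].
  have [[x xD' ->]|nx] := pselect (exists2 x, x \in D' & A = comp x); last by exists (v, fun=> [::], fun=> 0).
  have [w wx vw] := entry x xD'.
  have wD' := comp_in x w xD' wx.
  have [pth [pos h]] := IH (comp x) w P' (small x xD') wx (comp_con x xD').
  by exists (w, pth, pos).
have [f hf] := choice exA.
pose w A := (f A).1.1; pose pt A := (f A).1.2; pose ps A := (f A).2.
have fP x : x \in D' -> [/\ w (comp x) \in comp x, E v (w (comp x)) & dfs_on (comp x) (w (comp x)) P' (pt (comp x)) (ps (comp x))].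
  by move=> xD'; apply: hf; exists x.
pose cs := sort (fun A B => attachment P' B <= attachment P' A) [seq comp x | x <- enum D'].
have cs_in x : x \in D' -> comp x \in cs by move=> xD'; rewrite mem_sort map_f // mem_enum.
have cs_sorted : sorted (fun A B => attachment P' B <= attachment P' A) cs.
  by apply: sort_sorted => A B; apply: leq_total.
pose idx x := index (comp x) cs.
have idx_eq x y : x \in D' -> y \in D' -> idx x = idx y -> comp x = comp y.
  by move=> xD' yD' e; rewrite -(nth_index set0 (cs_in x xD')) -(nth_index set0 (cs_in y yD')) -/(idx x) e.
have idx_lt x y : x \in D' -> y \in D' -> idx x < idx y -> attachment P' (comp y) <= attachment P' (comp x).
  move=> xD' yD' lt; rewrite -(nth_index set0 (cs_in x xD')) -(nth_index set0 (cs_in y yD')).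
  apply: (@sorted_ltn_nth _ (fun A B => attachment P' B <= attachment P' A)) lt => //; rewrite ?inE ?index_mem ?cs_in //.
  by move=> A B Z h1 h2; apply: leq_trans h2 h1.
(* [K] exceeds every local position, so the component index and the local position act as two digits
   of [pos]; the index is shifted by one to leave 0 for [v]. *)
pose K := (\max_(p : {set V} * V) ps p.1 p.2).+1.
have ltK A x : ps A x < K by rewrite ltnS; apply: (@leq_bigmax _ (fun p : {set V} * V => ps p.1 p.2) (A, x)).
pose pth x := if x == v then P' else pt (comp x) x.
pose pos x := if x == v then 0 else (idx x).+1 * K + ps (comp x) x.
have pthv : pth v = P' by rewrite /pth eqxx.
have posv : pos v = 0 by rewrite /pos eqxx.
have D'v x : x \in D' -> (x == v) = false by rewrite D'P => /andP[_ /negPf].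
have pthE x : x \in D' -> pth x = pt (comp x) x by move=> h; rewrite /pth D'v.
have posE x : x \in D' -> pos x = (idx x).+1 * K + ps (comp x) x by move=> h; rewrite /pos D'v.
have pthA x y : x \in D' -> y \in comp x -> pth y = pt (comp x) y.
  by move=> h yx; rewrite pthE ?(comp_eq x y) //; apply: comp_in yx.
have posA x y : x \in D' -> y \in comp x -> pos y = (idx x).+1 * K + ps (comp x) y.
  by move=> h yx; rewrite posE /idx ?(comp_eq x y) //; apply: comp_in yx.
have DD' x : x \in D -> x = v \/ x \in D'.
  by move=> xD; have [->|ne] := eqVneq x v; [left | right; rewrite D'P xD].
have preA x : x \in D' -> prefix (rcons P' (w (comp x))) (pth x).
  by move=> h; have [_ _ g] := fP x h; rewrite pthE //; apply: (do_pre g).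
have same x y : x \in D' -> y \in D' -> prefix (pth x) (pth y) -> comp x = comp y.
  move=> xD' yD' h; have px := prefix_trans (preA x xD') h.
  have := prefix_size_eq px (preA y yD'); rewrite !size_rcons => /(_ erefl)/rcons_inj[e].
  have [wx _ _] := fP x xD'; have [wy _ _] := fP y yD'.
  by rewrite -(comp_eq _ _ wx) e (comp_eq _ _ wy).
have big x : x \in D' -> size P' < size (pth x).
  by move=> h; have := size_prefix (preA x h); rewrite size_rcons.
have pre x : x \in D -> prefix P' (pth x).
  case/DD'=> [->|xD']; first by rewrite pthv prefix_refl.
  by apply: prefix_trans (prefix_rcons _ _) (preA x xD').
have inj_in x y : x \in D' -> y \in comp x -> y \in D by move=> h1 h2; have := comp_in x y h1 h2; rewrite D'P => /andP[].
have belowA x y : x \in D' -> y \in comp x -> below D pth y = below (comp x) (pt (comp x)) y.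
  move=> xD' yx; apply/setP => z; rewrite !inE; apply/andP/andP => -[h1 h2].
    have yD' := comp_in x y xD' yx.
    case: (DD' z h1) => [e|zD'].
      by have := size_prefix h2; rewrite e pthv leqNgt big.
    have e := same y z yD' zD' h2; have zx : z \in comp x by rewrite -(comp_eq x y yx) e.
    by rewrite -pthA // -[pt _ z]pthA //; split=> //; move: zx; rewrite inE.
  have zx : z \in comp x by rewrite inE.
  by rewrite !(pthA x) //; split=> //; apply: inj_in zx.
exists pth, pos; split.
- exact: pthv.
- move=> x xD xv; have xD' : x \in D' by rewrite D'P xD.
  have [wx vw g] := fP x xD'; have [e|xw] := eqVneq x (w (comp x)).
    exists v; rewrite vD pthv {3}e; split=> //; rewrite pthE // {2}e (do_root g) -e //.
  have [u [ux pu Eux]] := do_parent g (comp_self x) xw.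
  by exists u; split=> //; [apply: inj_in ux | rewrite pthE // (pthA x u)].
- exact: pre.
- move=> x y xD yD Exy; case: (DD' x xD) => [->|xD']; first by rewrite pthv pre.
  case: (DD' y yD) => [->|yD']; first by rewrite pthv pre ?orbT.
  have yx : y \in comp x by rewrite inE; apply: connect1; rewrite /within xD' yD'.
  have [_ _ g] := fP x xD'.
  by rewrite !(pthA x) //; apply: (do_edge g).
- move=> x y xD yD; case: (DD' x xD) => [->|xD']; case: (DD' y yD) => [->|yD'] //.
  + by rewrite posv posE // mulSn /K; lia.
  + by rewrite posv posE // mulSn /K; lia.
  rewrite !posE // => e; have := ltK (comp x) x; have := ltK (comp y) y => l1 l2.
  have ei : idx x = idx y by nia.
  have ec := idx_eq x y xD' yD' ei; rewrite ei ec in e.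
  have [_ _ g] := fP y yD'.
  by apply: (do_inj g) => //; rewrite ?comp_self -?ec ?comp_self //; move: e; rewrite -ec; lia.
- move=> x y xD yD; case: (DD' x xD) => [->|xD']; first by rewrite posv.
  case: (DD' y yD) => [->|yD']; first by rewrite pthv => /size_prefix; rewrite leqNgt big.
  move=> h; have e := same x y xD' yD' h; have yx : y \in comp x by rewrite e.
  have [_ _ g] := fP x xD'; move: h; rewrite !(pthA x) // !(posA x) // leq_add2l; exact: (do_le g).
- move=> x y z xD yD zD h; case: (DD' x xD) => [->|xD']; first by rewrite pthv pre.
  case: (DD' y yD) => [ey|yD'].
    by move: h; rewrite ey pthv => /size_prefix; rewrite leqNgt big.
  have e := same x y xD' yD' h; have yx : y \in comp x by rewrite e.
  case: (DD' z zD) => [->|zD'].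
    by rewrite posv posE // leqn0 mulSn /K; case/andP=> /eqP; lia.
  move=> hz; have ez : idx z = idx x.
    move: hz; rewrite (posA x x) // (posA x y) // (posE z) //.
    have := ltK (comp x) x; have := ltK (comp x) y; have := ltK (comp z) z; nia.
  have zx : z \in comp x by rewrite -(idx_eq z x zD' xD' ez).
  have [_ _ g] := fP x xD'; move: h hz; rewrite !(pthA x) // !(posA x) // !leq_add2l; exact: (do_conv g).
move=> t x y xD yD; case: (DD' y yD) => [->|yD']; first by rewrite posv.
case: (DD' x xD) => [->|xD'].
  rewrite pthv /P' => /rcons_inj[<-] e; have := big y yD'; rewrite e /P' !size_rcons ltnn //.
move=> ex ey lt; have [ec|nc] := eqVneq (comp x) (comp y).
  have yx : y \in comp x by rewrite ec.
  have [_ _ g] := fP x xD'; rewrite !(belowA x) //.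
  move: ex ey lt; rewrite !(pthA x) // !(posA x) // ltn_add2l; exact: (do_lex g).
have px := preA x xD'; have py := preA y yD'; rewrite ex in px; rewrite ey in py.
(* Siblings in distinct components are their entry vertices: a longer common stack [t] would contain
   an entry vertex shared by both. *)
have st : size t = size P'.
  apply/eqP; rewrite eqn_leq; apply/andP; split; last first.
    by have := size_prefix px; rewrite !size_rcons ltnS.
  rewrite leqNgt; apply/negP => lts; case/eqP: nc.
  have h1 := prefix_rcons_lt px; have h2 := prefix_rcons_lt py; rewrite !size_rcons in h1 h2.
  have lts' : (size P).+1 < size t by move: lts; rewrite /P' size_rcons.
  have := prefix_size_eq (h1 lts') (h2 lts'); rewrite !size_rcons => /(_ erefl)/rcons_inj[e].
  have [wx _ _] := fP x xD'; have [wy _ _] := fP y yD'.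
  by rewrite -(comp_eq _ _ wx) e (comp_eq _ _ wy).
have es a b : size (rcons P' a) = size (rcons t b) by rewrite [LHS]size_rcons [RHS]size_rcons st.
have [et ewx] : t = P' /\ x = w (comp x).
  by have := prefix_size_eq px (prefix_refl _) => /(_ (es _ _))/rcons_inj[e1 e2]; split; apply: esym.
have ewy : y = w (comp y).
  by have := prefix_size_eq py (prefix_refl _) => /(_ (es _ _))/rcons_inj[e1 e2]; apply: esym.
have bel z : z \in D' -> z = w (comp z) -> below D pth z = comp z.
  move=> zD' ez; rewrite (belowA z) //; apply/setP => u; rewrite in_set andbC.
  have [_ _ g] := fP z zD'; case uz: (u \in comp z); rewrite ?andbF //= andbT.
  have pz : pt (comp z) z = rcons P' (w (comp z)) by rewrite -(do_root g) -ez.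
  by rewrite pz; apply: (do_pre g).
rewrite !bel // et; apply: idx_lt => //.
rewrite ltn_neqAle; apply/andP; split; first by apply: contraNneq nc => /idx_eq->.
move: lt; rewrite !posE // leqNgt; have := ltK (comp x) x; have := ltK (comp y) y; nia.
Qed.

End DFS.

Definition subtree_adj (V : finType) (E le : rel V) (a c : V) : bool := [exists y, le c y && E a y].

(* [le] is a depth-first search tree and [pos] the order of visit; siblings are
   visited by decreasing attachment of their subtrees to the root path, compared
   lexicographically from the root. *)
Record sorted_dfs (V : finType) (E le : rel V) (pos : V -> nat) : Prop := SortedDfs {
  sd_tree : tree_order le;
  sd_cover : forall x y, Defs.cover le x y -> E x y;
  sd_edge : forall x y, E x y -> le x y || le y x;
  sd_inj : injective pos;
  sd_le : forall x y, le x y -> pos x <= pos y;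
  sd_conv : forall x y z, le x y -> pos x <= pos z <= pos y -> le x z;
  sd_lex : forall p c c' a, Defs.cover le p c -> Defs.cover le p c' -> pos c < pos c' ->
    le a p -> subtree_adj E le a c' -> ~~ subtree_adj E le a c ->
    exists b, [/\ strict le b a, subtree_adj E le b c & ~~ subtree_adj E le b c'] }.

Section SortedDfsExists.
Variables (V : finType) (E : rel V).
Hypothesis symE : symmetric E.

(** Ancestors are read off as prefixes of stacks. A bit position before that of [a] in the
    attachment vector is then an ancestor strictly below [a], which turns [binary_lex] into the last
    clause. *)
Lemma sorted_dfs_exists (v : V) : (forall x y, connect E x y) ->
  exists le pos, sorted_dfs E le pos.
Proof.
move=> conn; have con : connected_on E [set: V].
  move=> x y _ _; apply: connect_sub (conn x y) => a b Eab.
  by apply: connect1; rewrite /within !inE.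
have [pth [pos h]] := dfs_exists symE [::] (in_setT v) con.
pose le x y := prefix (pth x) (pth y).
have last_pth x d : last d (pth x) = x.
  have [->|xv] := eqVneq x v; first by rewrite (do_root h).
  by have [u [_ -> _]] := do_parent h (in_setT x) xv; rewrite last_rcons.
have pth_inj : injective pth by move=> x y e; rewrite -(last_pth x x) e last_pth.
have tle : tree_order le.
  split; first split.
  - by move=> x; apply: prefix_refl.
  - move=> x y /andP[h1 h2]; apply: pth_inj; apply: (prefix_size_eq h1 (prefix_refl _)).
    by apply/eqP; rewrite eqn_leq !size_prefix.
  - by move=> y x z; apply: prefix_trans.
  - by exists v => x; rewrite /le (do_root h); apply: (do_pre h); rewrite inE.
  move=> x y z xz yz; have [l|l] := leqP (size (pth x)) (size (pth y)).
    by rewrite /le (prefix_total xz yz).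
  by rewrite /le (prefix_total yz xz) ?orbT // ltnW.
have coverP p c : Defs.cover le p c -> pth c = rcons (pth p) c /\ E p c.
  move=> cv; have /andP[/andP[npc lpc] _] := cv.
  have cv' : c != v.
    apply: contraNneq npc => e; apply/eqP/(tle_anti tle) => //.
    by rewrite e /le (do_root h); apply: (do_pre h); rewrite inE.
  have [u [_ pu Euc]] := do_parent h (in_setT c) cv'.
  have luc : le u c by rewrite /le pu prefix_rcons.
  have nuc : u != c.
    by apply/eqP => e; have := congr1 size pu; rewrite e size_rcons; lia.
  have lup : le u p by apply: (cover_below tle cv); apply/andP.
  have lpu : le p u.
    rewrite /le; apply: (@prefix_rcons_lt _ _ _ c); first by rewrite -pu.
    rewrite leqNgt; apply/negP => lt; case/eqP: npc; apply: pth_inj.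
    apply: (prefix_size_eq lpc (prefix_refl _)); apply/eqP; rewrite eqn_leq size_prefix //=.
    by rewrite pu size_rcons.
  by rewrite (tle_anti tle lpu lup).
have pth_nth x j d : j < size (pth x) -> pth (nth d (pth x) j) = take j.+1 (pth x).
  have [n] := ubnP (size (pth x)); elim: n x j => // n IH x j; rewrite ltnS => sx jx.
  have [e|xv] := eqVneq x v.
    by move: jx; rewrite e (do_root h) /=; case: j => // _; rewrite (do_root h).
  have [u [_ pu _]] := do_parent h (in_setT x) xv.
  move: jx sx; rewrite pu size_rcons ltnS leq_eqVlt nth_rcons => /orP[/eqP->|ju] sx.
    by rewrite ltnn eqxx -pu take_oversize // pu size_rcons.
  by rewrite ju IH // -cats1 takel_cat.
exists le, pos; split=> //.
- by move=> x y /coverP[].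
- by move=> x y; apply: (do_edge h); rewrite inE.
- by move=> x y; apply: (do_inj h); rewrite inE.
- by move=> x y; apply: (do_le h); rewrite inE.
- by move=> x y z; apply: (do_conv h); rewrite inE.
move=> p c c' a /coverP[pc _] /coverP[pc' _] lt ap ac' nac.
have := do_lex h (in_setT c) (in_setT c') pc pc' lt.
rewrite /attachment; set B := fun c => [seq [exists y in below [set: V] pth c, E a y] | a <- pth p].
have adjE b z : [exists y in below [set: V] pth z, E b y] = subtree_adj E le b z.
  by apply: eq_existsb => y; rewrite !inE.
pose i := (size (pth a)).-1.
have sa : 0 < size (pth a) by have := size_prefix (do_pre h (in_setT a)); rewrite size_rcons; apply: leq_trans.
have ip : i < size (pth p) by rewrite /i prednK // size_prefix.
have ai : nth a (pth p) i = a.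
  have [s e] := prefixP ap; rewrite e nth_cat /i prednK // leqnn.
  by rewrite nth_last last_pth.
have nB z j : j < size (pth p) -> nth false (B z) j = subtree_adj E le (nth a (pth p) j) z.
  by move=> jp; rewrite (nth_map a) // adjE.
move=> hk; have [|||j ji] := @binary_lex (B c) (B c') i _ hk.
- by rewrite !size_map.
- by rewrite nB // ai.
- by rewrite nB // ai.
have jp : j < size (pth p) := ltn_trans ji ip.
rewrite !nB // => /andP[h1 h2]; exists (nth a (pth p) j); split=> //.
have e : pth (nth a (pth p) j) = take j.+1 (pth p) by apply: pth_nth.
have ea : pth a = take i.+1 (pth p) by rewrite -{1}ai; apply: pth_nth.
apply/andP; split.
  apply/eqP => e'; have := congr1 size e; rewrite e' ea !size_takel //; lia.
by rewrite /le e ea prefixE size_takel ?take_takel ?eqxx // ltnS ltnW.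
Qed.

End SortedDfsExists.

(** * Grids in depth-first order give clique minors *)

Lemma connected_on_induced (G : sgraph) (X : {set G}) : connected_on (@sedge G) X -> connected (induced X).
Proof.
move=> h u v; pose f x : induced X := insubd u x.
have fE (w : induced X) : f (val w) = w by rewrite /f valKd.
rewrite -[u]fE -[v]fE; apply: connect_homo (h _ _ (valP u) (valP v)) => a b /and3P[aX bX ab].
by apply: connect1; rewrite /= /induced_edge !val_insubd aX bX.
Qed.

(** Merging [X i] with [Y i] turns a model of the complete bipartite graph into one of the complete
    graph. *)
Lemma biclique_minor (G : sgraph) t (X Y : nat -> {set G}) :
  (forall i, i < t -> connected_on (@sedge G) (X i)) ->
  (forall i, i < t -> connected_on (@sedge G) (Y i)) ->
  (forall i j, i < j -> j < t -> [disjoint X i & X j]) ->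
  (forall i j, i < j -> j < t -> [disjoint Y i & Y j]) ->
  (forall i j, i < t -> j < t -> [disjoint X i & Y j]) ->
  (forall i j, i < t -> j < t -> exists x y, [/\ x \in X i, y \in Y j & sedge x y]) ->
  minor (complete_graph t) G.
Proof.
move=> cX cY dX dY dXY adj; have symE := @sedge_sym G.
have dis (Z : nat -> {set G}) (i j : nat) : (forall i j, i < j -> j < t -> [disjoint Z i & Z j]) ->
    i < t -> j < t -> i != j -> [disjoint Z i & Z j].
  by move=> dZ it jt; rewrite neq_ltn => /orP[ij|ji]; [apply: dZ | rewrite disjoint_sym; apply: dZ].
have mono (A B : {set G}) x y : A \subset B -> connect (within (@sedge G) A) x y -> connect (within (@sedge G) B) x y.
  move=> /subsetP AB; apply: connect_sub => a b /and3P[aA bA ab].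
  by apply: connect1; rewrite /within !AB.
exists (fun u : 'I_t => X u :|: Y u); split.
- move=> u; have [x [y [xX _ _]]] := adj u u (ltn_ord u) (ltn_ord u).
  by apply/set0Pn; exists x; rewrite inE xX.
- move=> u; apply: connected_on_induced => a b.
  have [x [y [xX yY xy]]] := adj u u (ltn_ord u) (ltn_ord u).
  suff to_x c : c \in X u :|: Y u -> connect (within (@sedge G) (X u :|: Y u)) c x.
    move=> aU bU; apply: connect_trans (to_x a aU) _.
    by rewrite (sym_connect_sym (within_sym symE _)); apply: to_x.
  rewrite inE => /orP[cXu|cYu]; first by apply: mono (subsetUl _ _) _; apply: cX.
  apply: connect_trans (_ : connect _ c y) _; first by apply: mono (subsetUr _ _) _; apply: cY.
  by apply: connect1; rewrite /within !inE xX yY symE xy !orbT.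
- move=> u v uv; have uv' : u != v :> nat by rewrite (inj_eq val_inj).
  rewrite -setI_eq0 setIUl !setIUr !setU_eq0 !setI_eq0 (dis X) // (dis Y) // dXY //=.
  by rewrite andbT disjoint_sym dXY.
move=> u v uv; have [x [y [xX yY xy]]] := adj u v (ltn_ord u) (ltn_ord v).
by exists x, y; rewrite !inE xX yY orbT.
Qed.

Section SortedDfsSets.
Variables (V : finType) (E le : rel V) (pos : V -> nat).
Hypothesis symE : symmetric E.
Hypothesis sd : sorted_dfs E le pos.
Let tle := sd_tree sd.

Lemma strict_pos x y : strict le x y -> pos x < pos y.
Proof.
move=> /andP[ne l]; rewrite ltn_neqAle (sd_le sd l) andbT.
by apply: contraNneq ne => /(sd_inj sd)->.
Qed.

Lemma edge_le x y : E x y -> pos x < pos y -> le x y.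
Proof. by move=> /(sd_edge sd)/orP[//|/(sd_le sd)]; rewrite leqNgt => /negP. Qed.

Lemma total_pos x y z : le x z -> le y z -> pos x <= pos y -> le x y.
Proof.
move=> xz yz p; case/orP: (tle_total tle xz yz) => // yx.
have -> : x = y by apply: (sd_inj sd); apply/eqP; rewrite eqn_leq p (sd_le sd yx).
exact: (tle_refl tle).
Qed.

(** The parent of every vertex other than [r] stays in [X], and positions decrease along parents, so
    all of them lead to [r]. *)
Lemma connected_subtree (r : V) (X : {set V}) : r \in X ->
  (forall x, x \in X -> le r x /\ forall u, le r u -> le u x -> u \in X) -> connected_on E X.
Proof.
move=> rX h; suff to_r x : x \in X -> connect (within E X) x r.
  move=> x y xX yX; apply: connect_trans (to_r x xX) _.
  by rewrite (sym_connect_sym (within_sym symE _)); apply: to_r.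
have [n] := ubnP (pos x); elim: n x => // n IH x; rewrite ltnS => px xX.
have [->|xr] := eqVneq x r; first exact: connect0.
have [rx hx] := h x xX.
have [|u cu umax] := @parent_of _ _ tle x r; first by rewrite /strict eq_sym xr.
have /andP[ux _] := cu; have /andP[_ lux] := ux.
have ru : le r u by apply: umax; rewrite /strict eq_sym xr.
have uX := hx u ru lux.
apply: connect_trans (connect1 _) (IH u _ uX); last exact: leq_trans (strict_pos ux) px.
by rewrite /within xX uX symE (sd_cover sd).
Qed.

Definition segment (v : V) lo hi := [set u | le u v && (lo <= pos u < hi)].

Lemma connected_segment v lo hi : connected_on E (segment v lo hi).
Proof.
have [->|[x0 x0S]] := set_0Vmem (segment v lo hi); first by move=> x y; rewrite inE.
case: (arg_minnP pos x0S) => r rS rmin; apply: (@connected_subtree r) => // x xS.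
have : r \in segment v lo hi by []; have := xS.
rewrite !in_set => /andP[xv /andP[x1 x2]] /andP[rv /andP[r1 r2]].
split; first exact: total_pos rv xv (rmin x xS).
move=> u ru ux; rewrite inE (tle_trans tle ux xv) /=.
by rewrite (leq_trans r1 (sd_le sd ru)) (leq_ltn_trans (sd_le sd ux) x2).
Qed.

Lemma siblings v c c' : Defs.cover le v c -> Defs.cover le v c' -> le c c' -> c = c'.
Proof.
move=> /andP[vc _] /andP[_ nb] cc'; apply/eqP; apply: contraT => ne.
by case/negP: nb; apply/existsP; exists c; rewrite vc /strict ne cc'.
Qed.

Lemma siblings_meet v c c' y : Defs.cover le v c -> Defs.cover le v c' -> le c y -> le c' y -> c = c'.
Proof.
move=> cc cc' cy cy'; case/orP: (tle_total tle cy cy'); first exact: siblings cc cc'.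
by move/(siblings cc' cc).
Qed.

Lemma child_towards v y : strict le v y -> exists2 c, Defs.cover le v c & le c y.
Proof.
have [n] := ubnP (pos y); elim: n y => // n IH y; rewrite ltnS => py vy.
have [u cu umax] := parent_of tle vy; have /andP[uy _] := cu.
have vu := umax v vy; have [->|ne] := eqVneq v u; first by exists y => //; apply: tle_refl.
have [||c cc cu'] := IH u; first exact: leq_trans (strict_pos uy) py.
  by apply/andP.
by exists c => //; case/andP: uy => _; apply: (tle_trans tle cu').
Qed.

End SortedDfsSets.

(** * Many sibling subtrees attached to one root path *)

(** The number of groups for [star_rec]: $2t$ windows, each long enough for the next stage, and two
    more groups, the last of which provides the reference index [cs]. *)
Fixpoint star_bound t s := if s is s'.+1 then 2 * t * star_bound t s' + 2 else t.

Lemma star_bound_gt0 t s : 0 < t -> 0 < star_bound t s.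
Proof. by move=> t0; case: s => //= s; rewrite addn2. Qed.

Section Star.
Variables (t : nat) (ok : pred nat) (N : nat -> nat -> bool) (a lo hi : nat -> nat).
Hypothesis t0 : 0 < t.
Hypothesis lex : forall i i' x, ok i -> ok i' -> i < i' -> N i' x -> ~~ N i x ->
  exists2 y, y < x & N i y && ~~ N i' y.
Let L0 := star_bound t t.
Hypothesis ok_lo : forall l, l < L0 -> ok (lo l).
Hypothesis lo_hi : forall l, l < L0 -> lo l <= hi l.
Hypothesis hi_lo : forall l, l.+1 < L0 -> hi l < lo l.+1.
Hypothesis hits : forall l j, l < L0 -> j < t.*2.+1 -> exists i x,
  [/\ ok i, lo l <= i <= hi l, a j <= x < a j.+1 & N i x].

(** In the application, [N i x] says that the subtree of the child visited at position [i] is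
    adjacent to the root-path vertex at position [x]. This is then a biclique between [t] sibling
    subtrees and [t] path vertices. *)
Definition star_common := exists c x : nat -> nat,
  [/\ forall i, i < t -> ok (c i), forall i j, i < j -> j < t -> c i < c j,
      forall i j, i < j -> j < t -> x i < x j & forall i j, i < t -> j < t -> N (c i) (x j)].

(** Each group of subtrees can be tied together by its own interval of the root path; these
    intervals end before [a r.+1], so the later row blocks remain free for the other side of a
    biclique. *)
Definition star_private := exists r (e u v : nat -> nat),
  [/\ r < t, forall i, i < t -> e i < L0 /\ v i < a r.+1,
      forall i j, i < j -> j < t -> e i < e j /\ v i < u j &
      forall i k, i < t -> ok k -> lo (e i) <= k <= hi (e i) -> exists2 x, u i <= x <= v i & N k x].

Let lo_mono l l' : l <= l' -> l' < L0 -> lo l <= lo l'.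
Proof.
move=> /subnKC<-; elim: (l' - l) => [|n IH]; rewrite ?addn0 // addnS => h.
by apply: leq_trans (IH (ltnW h)) (leq_trans (lo_hi (ltnW h)) (ltnW (hi_lo h))).
Qed.

Let hi_lo' l l' : l < l' -> l' < L0 -> hi l < lo l'.
Proof. by move=> h h'; apply: leq_trans (hi_lo (leq_ltn_trans h h')) (lo_mono h h'). Qed.

Let a_mono j j' : j <= j' -> j' <= t.*2.+1 -> a j <= a j'.
Proof.
have L00 : 0 < L0 by apply: star_bound_gt0.
apply: (@nondecr_upto a t.*2.+1) => i it; have [k [x [_ _ h _]]] := hits L00 it; lia.
Qed.

Let least (P : pred nat) B : (exists2 x, x < B & P x) ->
  [/\ find P (iota 0 B) < B, P (find P (iota 0 B)) & forall x, x < find P (iota 0 B) -> ~~ P x].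
Proof.
move=> [x xB Px]; have h : has P (iota 0 B) by apply/hasP; exists x; rewrite ?mem_iota.
have f1 : find P (iota 0 B) < B by rewrite -[X in _ < X](size_iota 0) -has_find.
split=> //; first by have := nth_find 0 h; rewrite nth_iota.
move=> y yf; have := before_find 0 yf; rewrite nth_iota ?add0n => [->//|].
exact: ltn_trans yf f1.
Qed.

(* [C] is the part below [b] of the sets [N k], common to all the groups left;
   it has [t - s] elements. Either the next element is again common to many
   consecutive groups, or it moves often enough to give private intervals. *)
Lemma star_rec s l0 b (C : pred nat) (x : nat -> nat) : s <= t ->
  l0 + star_bound t s <= L0 -> b <= a (t - s) ->
  (forall k, ok k -> lo l0 <= k <= hi (l0 + star_bound t s).-1 -> forall y, y < b -> N k y = C y) ->
  (forall i j, i < j -> j < t - s -> x i < x j) ->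
  (forall i, i < t - s -> (x i < b) && C (x i)) ->
  star_common \/ star_private.
Proof.
elim: s l0 b C x => [|s IH] l0 b C x st lL ba hull xinc xC.
  left; rewrite subn0 /= in xinc xC lL hull.
  exists (fun i => lo (l0 + i)), x; split=> // [i it|i j ij jt|i j it jt].
  - by apply: ok_lo; lia.
  - have h : l0 + i < l0 + j by lia.
    by apply: leq_ltn_trans (lo_hi _) (hi_lo' h _); lia.
  have /andP[xb Cx] := xC j jt; rewrite (hull _ _ _ _ xb) //; first by apply: ok_lo; lia.
  apply/andP; split; first by apply: lo_mono; lia.
  apply: leq_trans (lo_hi _) _; first lia.
  have [e|ne] := eqVneq i t.-1; first by rewrite (_ : l0 + i = (l0 + t).-1) //; lia.
  by apply: ltnW; apply: leq_trans (hi_lo' _ _) (lo_hi _); lia.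
set p := star_bound t s in IH *; have p0 : 0 < p by apply: star_bound_gt0.
rewrite /= -/p in lL hull.
have bS : star_bound t s.+1 = 2 * t * p + 2 by [].
set r := t - s.+1 in ba xinc xC *; have rt : r < t by rewrite /r; lia.
set L := 2 * t * p + 2 in lL hull.
have lastL : (l0 + L).-1 < L0 by rewrite /L; lia.
(* The last group provides a child [cs] with a neighbour in row block [r]. By [lex], every earlier
   child of the range also has one in $[b, B)$, and the least such neighbour, [f] below, is
   nondecreasing. *)
have [cs [xs [okc /andP[cs1 cs2] /andP[xs1 xs2] Nc]]] := hits (j := r) lastL ltac:(lia).
pose P k := fun y => (b <= y) && N k y; set B := a r.+1 in xs2.
pose f k := find (P k) (iota 0 B).
pose inh k := ok k /\ lo l0 <= k <= hi (l0 + L).-1.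
have inhC k : inh k -> forall y, y < b -> N k y = C y by case=> h1 h2; apply: hull.
have inhcs : inh cs.
  split=> //; apply/andP; split=> //; apply: leq_trans cs1; apply: lo_mono => //; rewrite /L; lia.
have mono k k' y : inh k -> inh k' -> k <= k' -> P k' y -> exists2 y', y' <= y & P k y'.
  move=> hk hk' kk' /andP[by_ Ny]; have [Nk|Nk] := boolP (N k y).
    by exists y => //; rewrite /P by_.
  have lt : k < k' by rewrite ltn_neqAle kk' andbT; apply: contraNneq Nk => ->.
  have [y' y'y /andP[N1 N2]] := lex (proj1 hk) (proj1 hk') lt Ny Nk.
  exists y'; first exact: ltnW.
  rewrite /P N1 andbT leqNgt; apply/negP => y'b.
  by case/negP: N2; rewrite (inhC _ hk') // -(inhC _ hk).
have fP k : inh k -> k <= cs -> [/\ f k < B, P k (f k) & forall y, y < f k -> ~~ P k y].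
  move=> hk kcs; apply: least; have [|y' h1 h2] := mono k cs xs hk inhcs kcs; first by rewrite /P Nc andbT (leq_trans ba).
  by exists y' => //; apply: leq_ltn_trans h1 xs2.
have fmono k k' : inh k -> inh k' -> k <= k' -> k' <= cs -> f k <= f k'.
  move=> hk hk' kk' kcs; have [_ h1 _] := fP k' hk' kcs.
  have [y h2 h3] := mono _ _ _ hk hk' kk' h1; apply: leq_trans h2.
  have [_ _ h4] := fP k hk (leq_trans kk' kcs).
  by rewrite leqNgt; apply/negP => /h4; rewrite h3.
pose u l := f (lo (l0 + l)).
have inlo l : l <= 2 * t * p -> inh (lo (l0 + l)) /\ lo (l0 + l) <= cs.
  move=> lL'; split; last by apply: leq_trans cs1; apply: lo_mono => //; rewrite /L; lia.
  split; first by apply: ok_lo; lia.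
  apply/andP; split; first by apply: lo_mono; lia.
  by apply: leq_trans (lo_hi lastL); apply: lo_mono => //; rewrite /L; lia.
have umono l l' : l <= l' -> l' <= 2 * t * p -> u l <= u l'.
  move=> ll' h; have [h1 h2] := inlo l' h; have [h3 h4] := inlo l (leq_trans ll' h).
  by apply: fmono => //; apply: lo_mono; lia.
have between k l l' : l < l' -> l' <= 2 * t * p -> ok k -> lo (l0 + l) <= k <= hi (l0 + l'.-1) ->
    [/\ inh k, k <= cs & u l <= f k <= u l'].
  move=> ll' h okk /andP[k1 k2].
  have kl' : k <= lo (l0 + l') by apply: leq_trans k2 (ltnW (hi_lo' _ _)); lia.
  have [h1 h2] := inlo l' h; have [h3 h4] := inlo l (ltnW (leq_trans ll' h)).
  have kcs := leq_trans kl' h2.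
  have ik : inh k.
    split=> //; case: h1 => _ /andP[_ h1]; case: h3 => _ /andP[h3 _].
    by rewrite (leq_trans h3 k1) (leq_trans kl' h1).
  by split=> //; rewrite !fmono.
(* If [f] stands still across a window of [p] groups, its value [w] is a neighbour common to all of
   them and becomes the next element. *)
have [[i it ei]|ninc] := pselect (exists2 i, i < 2 * t & u (i * p) = u (i.+1 * p)).
  have ip : i.+1 * p <= 2 * t * p by rewrite leq_mul2r it orbT.
  have ip' : i * p < i.+1 * p by rewrite mulSn; lia.
  set w := u (i * p) in ei.
  have [bw wB] : b <= w /\ w < B.
    have [h1 h2] := inlo (i * p) (ltnW (leq_trans ip' ip)).
    by have [h3 /andP[h4 _] _] := fP _ h1 h2.
  apply: (IH (l0 + i * p) w.+1 (fun y => (y < b) && C y || (y == w))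
    (fun j => if j < r then x j else w)).
  - lia.
  - by rewrite /L mulSn in lL ip *; lia.
  - have -> : t - s = r.+1 by rewrite /r; lia.
    exact: wB.
  - move=> k okk hk y yw.
    have e : (l0 + i * p + p).-1 = l0 + (i.+1 * p).-1 by rewrite mulSn; lia.
    rewrite -/p e in hk.
    have [ik kcs] := between k _ _ ip' ip okk hk; rewrite -/w -ei => fw.
    have fk : f k = w by apply/eqP; rewrite eqn_leq andbC.
    have [_ Pw Pmin] := fP k ik kcs; rewrite fk in Pw Pmin.
    have [yb|yb] := ltnP y b; first by rewrite (inhC _ ik) //= (_ : y == w = false) ?orbF //; lia.
    have [->|ne] := eqVneq y w; first by case/andP: Pw => _ ->.
    have := Pmin y ltac:(lia); rewrite /P yb /= => /negPf -> //.
  - have -> : t - s = r.+1 by rewrite /r; lia.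
    move=> j j' jj' j't; have jr : j < r by lia.
    rewrite jr; have [j'r|j'r] := ltnP j' r; first exact: xinc.
    by have /andP[h _] := xC j jr; apply: leq_trans h bw.
  have -> : t - s = r.+1 by rewrite /r; lia.
  move=> j jr; have [j'r|j'r] := ltnP j r; last by rewrite ltnSn eqxx orbT.
  have /andP[h1 h2] := xC j j'r; rewrite h1 h2 /= andbT.
  by apply: leq_trans h1 (leqW bw).
(* Otherwise [u] moves across each of the $2t$ windows: the even windows give the private intervals
   and the odd ones keep them disjoint. *)
right; have inc i : i < 2 * t -> u (i * p) < u (i.+1 * p).
  move=> it; rewrite ltn_neqAle umono ?leq_mul2r ?it ?leqnSn ?orbT // andbT.
  by apply/eqP => e; apply: ninc; exists i.
have ip i : i <= 2 * t -> i * p <= 2 * t * p by move=> h; rewrite leq_mul2r h orbT.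
have ip' i : i * p < i.+1 * p by rewrite mulSn; lia.
exists r, (fun i => l0 + i.*2 * p), (fun i => u (i.*2 * p)), (fun i => u (i.*2.+1 * p)); split=> //.
- move=> i it; have h1 := ip i.*2 ltac:(lia); split; first by rewrite /L in lL; lia.
  by have [h2 h3] := inlo (i.*2.+1 * p) (ip i.*2.+1 ltac:(lia)); have [h4 _ _] := fP _ h2 h3.
- move=> i j ij jt; split; first by rewrite ltn_add2l ltn_mul2r p0 ltn_double.
  apply: leq_trans (inc i.*2.+1 ltac:(lia)) _; apply: umono; last by apply: ip; lia.
  by rewrite leq_mul2r; apply/orP; right; lia.
move=> i k it okk hk.
have [|ik kcs fk] := between k _ _ (ip' i.*2) (ip i.*2.+1 ltac:(lia)) okk.
  case/andP: hk => h1 h2; rewrite h1 /=; apply: leq_trans h2 _.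
  have h3 : i.*2.+1 * p <= 2 * t * p by apply: ip; lia.
  have [e|ne] := eqVneq p 1; first by rewrite e !muln1.
  apply: ltnW; apply: leq_trans (hi_lo' _ _) (lo_hi _); rewrite mulSn in h3 *; rewrite /L in lL; lia.
exists (f k) => //.
by have [_ /andP[_ ->]] := fP k ik kcs.
Qed.

Lemma star_lemma : star_common \/ star_private.
Proof.
apply: (@star_rec t 0 0 pred0 id) => //; rewrite ?subnn //.
Qed.

End Star.

(** * A wide star or a long chain in the tree *)

Section Marks.
Variables (V : finType) (E le : rel V) (pos : V -> nat).
Hypothesis sd : sorted_dfs E le pos.
Let tle := sd_tree sd.
Variables (K : nat) (z : nat -> V).
Hypothesis zinc : forall i j, i < j -> j < K -> pos (z i) < pos (z j).

Definition marks (w : V) := [set j : 'I_K | le w (z j)].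

(** A column block of the grid lies between two consecutive [z j]; here it falls entirely into the
    subtree at [w] minus the subtree at [u]. *)
Definition block_between j w u := j.+1 < K /\
  forall y, pos (z j) <= pos y <= pos (z j.+1) -> le w y && ~~ le u y.

Definition star_at B := exists v (c : nat -> V) (j : nat -> nat),
  (forall l, l < B -> [/\ Defs.cover le v (c l), le (c l) (z (j l)) & j l < K]) /\
  forall l l', l < l' -> l' < B -> pos (c l) < pos (c l').

Lemma mark_mono i j : i <= j -> j < K -> pos (z i) <= pos (z j).
Proof. by rewrite leq_eqVlt => /orP[/eqP->//|ij jK]; apply/ltnW/zinc. Qed.

Lemma star_of_children B v : B <= #|[set c | Defs.cover le v c & marks c != set0]| -> star_at B.
Proof.
set Ch := [set c | _ & _]; pose n := (\max_(x : V) pos x).+1.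
have posn x : pos x < n by rewrite ltnS; apply: leq_bigmax.
move=> hB; pose P i := [exists c in Ch, pos c == i].
have [|f [fP finc]] := @incr_enum P n B.
  apply: leq_trans hB _; pose o x : 'I_n := Ordinal (posn x).
  have oinj : injective o by move=> x y e; apply: (sd_inj sd); have /= := congr1 val e.
  rewrite -(card_imset _ oinj); apply/subset_leq_card/subsetP => i /imsetP[c cCh ->].
  by rewrite inE; apply/exists_inP; exists c.
have ex l : exists cj : V * nat, l < B ->
    [/\ Defs.cover le v cj.1, le cj.1 (z cj.2), cj.2 < K & pos cj.1 = f l].
  have [lB|_] := ltnP l B; last by exists (v, 0).
  have /andP[/exists_inP[c cCh /eqP e] _] := fP l lB.
  move: cCh; rewrite inE => /andP[cc /set0Pn[j jc]].
  by rewrite inE in jc; exists (c, val j) => _; split=> //=; apply: ltn_ord.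
have [g hg] := choice ex; exists v, (fun l => (g l).1), (fun l => (g l).2).
split=> [l lB|l l' ll' l'B]; first by have [] := hg l lB.
have [_ _ _ ->] := hg l (ltn_trans ll' l'B); have [_ _ _ ->] := hg l' l'B.
exact: finc.
Qed.

Lemma marks_mono u v : le u v -> marks v \subset marks u.
Proof. by move=> uv; apply/subsetP => j; rewrite !inE; apply: tle_trans. Qed.

(** The extra 1 is for [v], which may itself be one of the [z j]. *)
Lemma marks_children v : #|marks v| <= (\sum_(c | Defs.cover le v c && (marks c != set0)) #|marks c|).+1.
Proof.
rewrite -addn1 addnC.
pose A := \bigcup_(c | Defs.cover le v c && (marks c != set0)) marks c.
have sub : marks v \subset [set j : 'I_K | z j == v] :|: A.
  apply/subsetP => j; rewrite !inE => vj; have [//|ne] := eqVneq (z j) v.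
  have [c cc cj] := child_towards sd (y := z j) (v := v) ltac:(by rewrite /strict eq_sym ne vj).
  apply/bigcupP; exists c; last by rewrite inE.
  by rewrite cc /=; apply/set0Pn; exists j; rewrite inE.
apply: leq_trans (subset_leq_card sub) _; apply: leq_trans (leq_card_setU _ _) _; apply: leq_add.
  rewrite leqNgt; apply/negP => /card_gt1P[i [j [+ + ne]]]; rewrite !inE => /eqP e1 /eqP e2.
  have : i != j :> nat by rewrite (inj_eq val_inj).
  by rewrite neq_ltn => /orP[h|h]; have := zinc h (ltn_ord _); rewrite e1 e2 ltnn.
rewrite /A; elim/big_rec2: _ => [|c S n _ h]; first by rewrite cards0.
by apply: leq_trans (leq_card_setU _ _) _; rewrite leq_add2l.
Qed.

(* [v] is the deepest vertex below [w] losing at most two marks; its best child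
   [u] loses three, two of which lie on the same side of [u]. *)
Lemma chain_step B w : 0 < B -> 4 <= #|marks w| -> ~ star_at B ->
  exists u, [/\ strict le w u, exists j, block_between j w u & #|marks w| <= B * #|marks u| + 3].
Proof.
move=> B0 w4 nstar.
have Pw : le w w && (#|marks w| <= #|marks w| + 2) by rewrite (tle_refl tle) leq_addr.
case: (arg_maxnP (P := fun v => le w v && (#|marks w| <= #|marks v| + 2)) pos Pw) => v /andP[wv hv] vmax.
pose Ch := [pred c | Defs.cover le v c && (marks c != set0)].
have small c : Ch c -> #|marks c| + 2 < #|marks w|.
  move=> /andP[cc _]; have /andP[vc _] := cc; rewrite ltnNge; apply/negP => h.
  have := vmax c; rewrite h andbT => /(_ (tle_trans tle wv _)); have /andP[_ lvc] := vc.
  by move=> /(_ lvc) /=; rewrite /geq /= leqNgt (strict_pos sd vc).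
have chB : #|Ch| < B.
  rewrite ltnNge; apply/negP => h; apply: nstar; apply: (@star_of_children B v).
  by apply: leq_trans h _; apply/subset_leq_card/subsetP => c; rewrite !inE.
have mv : #|marks v| <= (\sum_(c | Ch c) #|marks c|).+1 := marks_children v.
have [c0 c0Ch] : exists c0, Ch c0.
  apply: contrapT => h; move: mv; rewrite big1; first by lia.
  by move=> c hc; case: h; exists c.
case: (arg_maxnP (P := Ch) (fun c => #|marks c|) c0Ch) => u uCh umax.
have /andP[cu _] := uCh; have /andP[/andP[nvu vu] _] := cu.
have wu : le w u := tle_trans tle wv vu.
have stwu : strict le w u.
  rewrite /strict wu andbT; apply: contraNneq nvu => e; apply/eqP/(tle_anti tle) => //.
  by rewrite -e.
exists u; split=> //; last first.
  have : \sum_(c | Ch c) #|marks c| <= B * #|marks u|.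
    apply: leq_trans (_ : \sum_(c | Ch c) #|marks u| <= _); first by apply: leq_sum => c /umax.
    by rewrite sum_nat_const leq_mul2r ltnW ?orbT.
  by move=> h; move: mv hv; lia.
pose Dm := marks w :\: marks u.
have cD : 2 < #|Dm|.
  have := cardsID (marks u) (marks w); rewrite (setIidPr (marks_mono wu)) -/Dm.
  by have := small u uCh; lia.
pose Lf := [set j in Dm | pos (z j) < pos u].
have [S [cS]] : exists S : {set 'I_K}, 1 < #|S| /\ (S = Lf \/ S = Dm :\: Lf).
  have [h|h] := leqP 2 #|Lf|; first by exists Lf; split=> //; left.
  exists (Dm :\: Lf); split; last by right.
  have sub : Lf \subset Dm by apply/subsetP => j; rewrite inE => /andP[].
  have := cardsID Lf Dm; rewrite (setIidPr sub) => e.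
  move: cD h; rewrite -e; move: #|Lf| #|Dm :\: Lf| => p q; lia.
(* Subtrees are intervals of [pos], so everything visited between two lost marks on the same side of
   [u] is in the subtree at [w] and outside the one at [u]. *)
have blk (i j : 'I_K) : i < j -> i \in Dm -> j \in Dm -> pos (z j) < pos u \/ pos u < pos (z i) ->
    exists j, block_between j w u.
  move=> ij; rewrite !inE => /andP[ui wi] /andP[uj wj] side; exists i.
  have iK : i.+1 < K := leq_ltn_trans ij (ltn_ord j).
  have sj : pos (z i.+1) <= pos (z j) by apply: mark_mono => //; apply: ltn_ord.
  split=> // y /andP[y1 y2]; apply/andP; split.
    apply: (sd_conv sd wj); rewrite (leq_trans (sd_le sd wi) y1) /=; exact: leq_trans y2 sj.
  apply/negP => uy; have := sd_le sd uy; case: side => side.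
    by rewrite leqNgt (leq_ltn_trans (leq_trans y2 sj) side).
  by case/negP: ui; apply: (sd_conv sd uy); rewrite (ltnW side).
have pair (i j : 'I_K) : i != j -> i \in Dm -> j \in Dm ->
    (pos (z i) < pos u /\ pos (z j) < pos u) \/ (pos u < pos (z i) /\ pos u < pos (z j)) ->
    exists j, block_between j w u.
  move=> ij iD jD side; have : i != j :> nat by rewrite (inj_eq val_inj).
  rewrite neq_ltn => /orP[h|h]; [apply: (blk i j) | apply: (blk j i)] => //; by case: side => -[]; auto.
case/card_gt1P: cS => i [j [iS jS ij]] => -[eS|eS]; move: iS jS; rewrite eS !inE.
  move=> /andP[iD iu] /andP[jD ju]; apply: (pair i j ij); rewrite ?inE ?iD ?jD //; by left.
have right (k : 'I_K) : ~~ le u (z k) -> ~~ (pos (z k) < pos u) -> pos u < pos (z k).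
  move=> h; rewrite -leqNgt leq_eqVlt => /orP[/eqP/(sd_inj sd) e|//].
  by rewrite e (tle_refl tle) in h.
move=> /andP[h1 h2] /andP[h3 h4]; rewrite h2 h4 /= in h1 h3.
have /andP[h5 _] := h2; have /andP[h6 _] := h4.
apply: (pair i j ij); rewrite ?inE ?h2 ?h4 //; right; split; exact: right.
Qed.

(** The constant is one more than the 3 lost in [chain_step], and it also provides the 4 marks
    required there. *)
Fixpoint chain_bound B p := if p is p'.+1 then B * chain_bound B p' + 4 else 0.

Lemma chain_or_star B p w : 0 < B -> chain_bound B p <= #|marks w| -> star_at B \/
  exists f : nat -> V, f 0 = w /\
    forall l, l < p -> strict le (f l) (f l.+1) /\ exists j, block_between j (f l) (f l.+1).
Proof.
move=> B0; have [|nstar] := pselect (star_at B); first by left.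
elim: p w => [|p IH] w hp; first by right; exists (fun=> w).
right; have [|u [wu blk hu]] := @chain_step B w B0 _ nstar; first exact: leq_trans (leq_addl _ _) hp.
have [|/nstar//|[f [f0 hf]]] := IH u.
  have := leq_trans hp hu; rewrite /= -[4]/(1 + 3) addnA leq_add2r addn1 ltn_pmul2l //; exact: ltnW.
exists (fun l => if l is l'.+1 then f l' else w); split=> // -[_|l lp]; last exact: hf.
by rewrite f0.
Qed.

End Marks.

(** * The clique minor in a grid *)

Section GridMinor.
Variables (G : sgraph) (le : rel G) (pos : G -> nat).
Notation E := (@sedge G).
Hypothesis sd : sorted_dfs E le pos.
Let tle := sd_tree sd.
Let symE := @sedge_sym G.

Variables (t K : nat) (a : nat -> nat) (z : nat -> G).
Hypothesis t0 : 0 < t.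
Let B := (star_bound t t).*2.+1.
Hypothesis KB : chain_bound B t < K.
Hypothesis ainc : forall i, i < t.*2.+2 -> a i <= a i.+1.
Hypothesis zinc : forall i j, i < j -> j < K.+1 -> pos (z i) < pos (z j).
Hypothesis az : a t.*2.+2 <= pos (z 0).
Hypothesis hit : forall i j, i < t.*2.+2 -> j < K -> exists x y,
  [/\ a i <= pos x < a i.+1, pos (z j) < pos y < pos (z j.+1) & E x y].

Let a_mono i j : i <= j -> j <= t.*2.+2 -> a i <= a j.
Proof. exact: (nondecr_upto ainc). Qed.

Let z_mono i j : i <= j -> j < K.+1 -> pos (z i) <= pos (z j).
Proof. by rewrite leq_eqVlt => /orP[/eqP->//|ij jK]; apply/ltnW/zinc. Qed.

Let row_below i x : i < t.*2.+2 -> pos x < a i.+1 -> pos x < pos (z 0).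
Proof. by move=> it px; apply: leq_trans px (leq_trans (a_mono _ _) az). Qed.

(** The differences of consecutive subtrees along the chain each contain a whole column block, hence
    are adjacent to every row block. The other side consists of pieces of the path to [x0], which
    comes after the first [t] row blocks. *)
Lemma chain_minor x0 (f : nat -> G) :
  (exists i, [/\ t <= i, i < t.*2.+2 & a i <= pos x0]) -> f 0 = x0 ->
  (forall l, l < t -> strict le (f l) (f l.+1) /\ exists j, block_between le pos K z j (f l) (f l.+1)) ->
  minor (complete_graph t) G.
Proof.
move=> [i0 [ti0 i0t ai0]] f0 hf.
have fmono l l' : l <= l' -> l' <= t -> le (f l) (f l').
  move=> /subnKC<-; elim: (l' - l) => [|n IH]; rewrite ?addn0; first by move=> _; apply: tle_refl.
  rewrite addnS => h; have [/andP[_ h1] _] := hf _ h.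
  exact: (tle_trans tle (IH (ltnW h))).
pose X l := [set y | le (f l) y && ~~ le (f l.+1) y].
pose Y i := segment le pos x0 (a i) (a i.+1).
apply: (@biclique_minor G t X Y).
- move=> l lt; have [/andP[nf lf] _] := hf l lt.
  apply: (connected_subtree symE sd (r := f l)).
    rewrite inE (tle_refl tle) /=; apply: contra nf => h; apply/eqP; exact: (tle_anti tle lf h).
  move=> x; rewrite inE => /andP[h1 h2]; split=> // u fu ux; rewrite inE fu /=.
  by apply: contra h2 => h; exact: (tle_trans tle h ux).
- move=> i it; exact: connected_segment.
- move=> i j ij jt; rewrite disjoint_subset; apply/subsetP => y; rewrite !inE => /andP[_ h].
  by rewrite negb_and; apply/orP; left; apply: contra h; apply: (tle_trans tle); apply: fmono => //; apply: ltnW.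
- move=> i j ij jt; rewrite disjoint_subset; apply/subsetP => y; rewrite !inE => /andP[_ /andP[_ h]].
  rewrite negb_and negb_and -!ltnNge; apply/orP; right; apply/orP; left.
  by apply: leq_trans h (a_mono _ _); lia.
- move=> l i lt it; rewrite disjoint_subset; apply/subsetP => y; rewrite !inE => /andP[h _].
  rewrite negb_and negb_and -!leqNgt; apply/orP; right; apply/orP; right.
  apply: leq_trans (_ : pos x0 <= _); first by apply: leq_trans ai0; apply: a_mono; lia.
  by apply: (sd_le sd); apply: (tle_trans tle) h; rewrite -f0; apply: fmono => //; apply: ltnW.
move=> l i lt it; have [_ [j [jK blk]]] := hf l lt.
have i2 : i < t.*2.+2 by lia.
have [x [y [/andP[x1 x2] /andP[y1 y2] Exy]]] := hit i2 (ltnW jK).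
have yX : y \in X l by rewrite inE; apply: blk; rewrite (ltnW y1) (ltnW y2).
exists y, x; split=> //; last by rewrite symE.
rewrite inE x1 x2 !andbT.
have xy : pos x < pos y by apply: ltn_trans y1; apply: leq_trans (row_below i2 x2) (z_mono _ _) => //; lia.
have fy : le x0 y by move: yX; rewrite inE => /andP[h _]; apply: (tle_trans tle) h; rewrite -f0; apply: fmono => //; apply: ltnW.
apply: (total_pos sd (edge_le sd Exy xy) fy); apply/ltnW; apply: leq_trans x2 _.
by apply: leq_trans ai0; apply: a_mono; lia.
Qed.

(** Group [l] consists of the children from number $2l+1$ to number $2l+2$; it catches the column
    block that follows the mark of the former. Child 0 is kept aside to force the row ends onto the
    path to [v]. *)
Lemma star_minor : star_at le pos K z B -> minor (complete_graph t) G.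
Proof.
move=> [v [c [j [hc cinc]]]]; pose L0 := star_bound t t.
have L00 : 0 < L0 by apply: star_bound_gt0.
have vc l : l < B -> [/\ pos v < pos (c l), le (c l) (z (j l)) & le v (z (j l))].
  move=> lB; have [cv cz _] := hc l lB; have /andP[vcl _] := cv; split=> //; first exact: (strict_pos sd vcl).
  by case/andP: vcl => _ h; apply: (tle_trans tle) cz.
have zlt l l' : l < l' -> l' < B -> pos (z (j l)) < pos (c l').
  move=> ll' l'B; have lB := ltn_trans ll' l'B; have [cv cz _] := hc l lB; have [cv' cz' _] := hc l' l'B.
  rewrite ltnNge; apply/negP => h; have := cinc l l' ll' l'B.
  have -> : c l = c l'; last by rewrite ltnn.
  by apply: (siblings cv cv'); apply: (sd_conv sd cz); rewrite h ltnW // cinc.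
have jlt l l' : l < l' -> l' < B -> j l < j l'.
  move=> ll' l'B; rewrite ltnNge; apply/negP => h; have lB := ltn_trans ll' l'B.
  have [_ _ jK] := hc l lB; have := z_mono h (ltnW jK).
  have [cv' cz' _] := hc l' l'B; have := sd_le sd cz'; have := zlt l l' ll' l'B; lia.
pose lo l := pos (c l.*2.+1); pose hi l := pos (c l.*2.+2).
have B2 l : l < L0 -> l.*2.+2 < B by rewrite /B -/L0; lia.
pose ok i := [exists ch, Defs.cover le v ch && (pos ch == i)].
have okP i : reflect (exists2 ch, Defs.cover le v ch & pos ch = i) (ok i).
  by apply: (iffP existsP) => [[ch /andP[h /eqP e]]|[ch h e]]; exists ch; rewrite // h e eqxx.
pose N i x := [exists ch, exists u, [&& Defs.cover le v ch, pos ch == i, le u v, pos u == x & subtree_adj E le u ch]].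
have NP i x : reflect (exists ch u, [/\ Defs.cover le v ch, pos ch = i, le u v, pos u = x & subtree_adj E le u ch]) (N i x).
  apply: (iffP existsP) => [[ch /existsP[u /and5P[h1 /eqP h2 h3 /eqP h4 h5]]]|[ch [u [h1 h2 h3 h4 h5]]]].
    by exists ch, u.
  by exists ch; apply/existsP; exists u; rewrite h1 h2 h3 h4 h5 !eqxx.
have Nadj ch u : Defs.cover le v ch -> N (pos ch) (pos u) -> le u v /\ subtree_adj E le u ch.
  by move=> cch /NP[ch' [u' [h1 /(sd_inj sd) e h3 /(sd_inj sd) e' h5]]]; rewrite -e -e'.
have lex i i' x : ok i -> ok i' -> i < i' -> N i' x -> ~~ N i x -> exists2 y, y < x & N i y && ~~ N i' y.
  move=> /okP[ch h1 <-] /okP[ch' h1' <-] lt /NP[ch2 [u [_ /(sd_inj sd)-> h3 <- h5]]] nN.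
  have nadj : ~~ subtree_adj E le u ch.
    by apply: contra nN => h; apply/NP; exists ch, u.
  have [b [bu b1 b2]] := sd_lex sd h1 h1' lt h3 h5 nadj.
  exists (pos b); first exact: (strict_pos sd bu).
  apply/andP; split; last by apply: contra b2 => /(Nadj _ _ h1')[].
  by apply/NP; exists ch, b; split=> //; case/andP: bu => _ h; apply: (tle_trans tle) h3.
have hits l i : l < L0 -> i < t.*2.+1 -> exists k x,
    [/\ ok k, lo l <= k <= hi l, a i <= x < a i.+1 & N k x].
  move=> lL it; have l2 := B2 l lL; have l1 : l.*2.+1 < B := ltnW l2.
  have [cv1 cz1 jK1] := hc _ l1; have [cv2 cz2 jK2] := hc _ l2.
  have B0 : 0 < B by []; have [cv0 cz0 jK0] := hc 0 B0.
  have [x [y [/andP[x1 x2] /andP[y1 y2] Exy]]] := hit (ltnW it) jK1.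
  have y3 : pos y < pos (z (j l.*2.+2)).
    by apply: leq_trans y2 (z_mono _ _); rewrite ?jlt // ltnW.
  have [p1 _ vz1] := vc _ l1; have [_ _ vz2] := vc _ l2.
  have vy : le v y by apply: (sd_conv sd vz2); rewrite (ltnW y3) andbT; apply: leq_trans (sd_le sd vz1) (ltnW y1).
  have nvy : v != y.
    by apply/eqP => e; move: y1; rewrite -e => h; have := sd_le sd cz1; lia.
  have [ch cch chy] := child_towards sd (v := v) (y := y) ltac:(by rewrite /strict nvy).
  have lo_ch : lo l <= pos ch.
    rewrite leqNgt; apply/negP => h.
    have e : ch = c l.*2.+1.
      apply: (siblings cch cv1); apply: (sd_conv sd chy).
      by rewrite (ltnW h) /=; apply: leq_trans (sd_le sd cz1) (ltnW y1).
    by move: h; rewrite e /lo ltnn.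
  have ch_hi : pos ch <= hi l.
    rewrite leqNgt; apply/negP => h.
    have e : c l.*2.+2 = ch.
      apply: (siblings cv2 cch); apply: (sd_conv sd cz2).
      by rewrite (ltnW h) /=; apply: leq_trans (sd_le sd chy) (ltnW y3).
    by move: h; rewrite -e /hi ltnn.
  have pxz : pos x < pos (z (j 0)).
    by apply: leq_trans (row_below (ltnW it) x2) (z_mono _ _); rewrite // ltnW.
  have z0y : pos (z (j 0)) < pos y.
    by apply: ltn_trans y1; apply: zinc; [apply: jlt | rewrite ltnW].
  have xy : le x y by apply: (edge_le sd Exy (ltn_trans pxz z0y)).
  have xz : le x (z (j 0)) by apply: (sd_conv sd xy); rewrite (ltnW pxz) (ltnW z0y).
  (* If [x] were strictly inside the subtree at [v], the child of [v] towards it would be both [c 0]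
     and [ch], but [ch] is visited later than [c 0]. *)
  have xv : le x v.
    case/orP: (tle_total tle xy vy) => // vx; have [->|nvx] := eqVneq x v; first exact: tle_refl.
    have [ch' cch' ch'x] := child_towards sd (v := v) (y := x) ltac:(by rewrite /strict eq_sym nvx).
    have e1 : ch' = c 0 by apply: (siblings_meet sd cch' cv0 (tle_trans tle ch'x xz) cz0).
    have e2 : ch' = ch by apply: (siblings_meet sd cch' cch (tle_trans tle ch'x xy) chy).
    by move: lo_ch; rewrite -e2 e1 /lo leqNgt cinc.
  exists (pos ch), (pos x); split=> //.
  - by apply/okP; exists ch.
  - by rewrite lo_ch.
  - by rewrite x1.
  by apply/NP; exists ch, x; split=> //; apply/existsP; exists y; rewrite chy.
have oklo l : l < L0 -> ok (lo l).
  by move=> lL; apply/okP; exists (c l.*2.+1) => //; have [] := hc _ (ltnW (B2 l lL)).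
have lohi l : l < L0 -> lo l <= hi l by move=> lL; apply/ltnW/cinc => //; apply: B2.
have hilo l : l.+1 < L0 -> hi l < lo l.+1 by move=> lL; apply: cinc => //; have := B2 _ lL; lia.
pose sub ch := [set y | le ch y].
have con_sub ch : connected_on E (sub ch).
  apply: (connected_subtree symE sd (r := ch)); first by rewrite inE (tle_refl tle).
  by move=> x; rewrite inE => h; split=> // u cu _; rewrite inE.
have sub_anc ch u y : Defs.cover le v ch -> le u v -> le ch y -> y != u.
  move=> cch uv chy; apply/eqP => e; rewrite e in chy; have /andP[sv _] := cch.
  by have := strict_pos sd sv; have := sd_le sd (tle_trans tle chy uv); lia.
have sub_dis ch ch' y : Defs.cover le v ch -> Defs.cover le v ch' -> pos ch < pos ch' -> le ch y -> ~~ le ch' y.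
  by move=> h1 h2 lt h3; apply/negP => h4; move: lt; rewrite (siblings_meet sd h1 h2 h3 h4) ltnn.
case: (star_lemma t0 lex oklo lohi hilo hits).
  move=> [ci [xi [okc cci xinc Ncx]]].
  have exd i : exists d, i < t -> Defs.cover le v d /\ pos d = ci i.
    have [it|_] := ltnP i t; last by exists v.
    by have /okP[d h1 h2] := okc i it; exists d.
  have [d hd] := choice exd.
  have exu i : exists u, i < t -> pos u = xi i.
    have [it|_] := ltnP i t; last by exists v.
    by have /NP[ch [u [_ _ _ h _]]] := Ncx 0 i t0 it; exists u.
  have [u hu] := choice exu.
  have Nd i k : i < t -> k < t -> le (u k) v /\ subtree_adj E le (u k) (d i).
    move=> it kt; have [h1 h2] := hd i it; apply: Nadj => //.
    by rewrite h2 hu //; apply: Ncx.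
  (* Common neighbours: sibling subtrees against single vertices of the root path. *)
  apply: (@biclique_minor G t (fun i => sub (d i)) (fun i => [set u i])).
  - by move=> i it; apply: con_sub.
  - by move=> i it x y /set1P-> /set1P->; apply: connect0.
  - move=> i k ik kt; have it := ltn_trans ik kt; have [h1 h2] := hd i it; have [h3 h4] := hd k kt.
    rewrite disjoint_subset; apply/subsetP => y; rewrite !inE => h.
    by apply: sub_dis h; rewrite // h2 h4 cci.
  - move=> i k ik kt; have it := ltn_trans ik kt.
    rewrite disjoint_subset; apply/subsetP => y; rewrite !inE => /eqP->.
    by apply/eqP => e; have := xinc i k ik kt; rewrite -(hu _ it) -(hu _ kt) e ltnn.
  - move=> i k it kt; have [h1 h2] := hd i it; have [h3 _] := Nd i k it kt.
    rewrite disjoint_subset; apply/subsetP => y; rewrite !inE => h; exact: (sub_anc _ _ _ h1 h3 h).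
  move=> i k it kt; have [_ /existsP[y /andP[h1 h2]]] := Nd i k it kt.
  by exists y, (u k); rewrite !inE eqxx; split=> //; rewrite symE.
move=> [r [e [ui [vi [rt he einc priv]]]]].
pose seg i := segment le pos v (ui i) (vi i).+1.
pose grp i ch := Defs.cover le v ch && (lo (e i) <= pos ch <= hi (e i)).
pose Xg i := [set y | [exists ch, grp i ch && le ch y]].
have XgP i y : reflect (exists ch, grp i ch /\ le ch y) (y \in Xg i).
  rewrite inE; apply: (iffP existsP) => [[ch /andP[h1 h2]]|[ch [h1 h2]]]; exists ch => //.
  by rewrite h1.
(* Private intervals: a whole group of subtrees tied together by its interval, against the row
   blocks that follow [r]. *)
pose X i := seg i :|: Xg i.
pose Y i := segment le pos v (a (r.+1 + i)) (a (r.+1 + i).+1).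
have mono (A A' : {set G}) x y : A \subset A' -> connect (within E A) x y -> connect (within E A') x y.
  move=> /subsetP AB; apply: connect_sub => p q /and3P[aA bA ab].
  by apply: connect1; rewrite /within !AB.
have hlt i k : i < k -> k < t -> hi (e i) < lo (e k).
  move=> ik kt; have [eik _] := einc i k ik kt; have [ek _] := he k kt.
  by rewrite /hi /lo; apply: cinc; have := B2 _ ek; lia.
have anc_Xg i w : le w v -> w \notin Xg i.
  move=> wv; apply/XgP => -[ch [/andP[h1 _] h2]].
  by have := sub_anc ch w w h1 wv h2; rewrite eqxx.
apply: (@biclique_minor G t X Y).
- move=> i it.
  have to_seg y : y \in X i -> exists2 s, s \in seg i & connect (within E (X i)) y s.
    rewrite inE => /orP[ys|/XgP[ch [gch chy]]]; first by exists y.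
    have /andP[cch lch] := gch.
    have [|x /andP[x1 x2] /NP[ch' [w [_ /(sd_inj sd) ech wv ew]]]] := priv i (pos ch) it _ lch.
      by apply/okP; exists ch.
    rewrite ech => /existsP[y' /andP[h1 h2]].
    have ws : w \in seg i by rewrite inE wv ew x1 ltnS x2.
    exists w => //; apply: (@connect_trans _ _ y').
      apply: mono (_ : sub ch \subset _) _; last by apply: con_sub; rewrite inE.
      by apply/subsetP => p; rewrite inE => h; rewrite inE; apply/orP; right; apply/XgP; exists ch.
    apply: connect1; rewrite /within symE h2 andbT; apply/andP; split; last by rewrite inE ws.
    by rewrite inE; apply/orP; right; apply/XgP; exists ch.
  move=> x y xX yX; have [s sS cs] := to_seg x xX; have [s' sS' cs'] := to_seg y yX.
  apply: connect_trans cs _; rewrite (sym_connect_sym (within_sym symE _)).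
  apply: connect_trans cs' _; apply: mono (subsetUl _ _) _; exact: (connected_segment symE sd).
- by move=> i it; apply: (connected_segment symE sd).
- move=> i k ik kt; have it := ltn_trans ik kt; have [eik vu] := einc i k ik kt.
  rewrite disjoint_subset; apply/subsetP => y; rewrite !inE negb_or => /orP[/andP[yv /andP[y1 y2]]|].
    have yk : pos y < ui k by apply: leq_ltn_trans vu; rewrite -ltnS.
    rewrite yv /= negb_and -ltnNge yk /=.
    by have := anc_Xg k y yv; rewrite inE.
  move=> yX; apply/andP; split.
    by apply: contraL yX => /andP[yv _]; have := anc_Xg i y yv; rewrite inE.
  case/existsP: yX => ch /andP[/andP[h1 /andP[_ h2]] h3].
  apply/existsP => -[ch' /andP[/andP[h4 /andP[h5 _]] h6]].
  have lt : pos ch < pos ch' by apply: leq_ltn_trans h2 (leq_trans (hlt i k ik kt) h5).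
  by have := sub_dis _ _ y h1 h4 lt h3; rewrite h6.
- move=> i k ik kt; rewrite disjoint_subset; apply/subsetP => y; rewrite !inE => /andP[yv /andP[_ y2]].
  rewrite yv /= negb_and -!ltnNge; apply/orP; left.
  by apply: leq_trans y2 (a_mono _ _); lia.
- move=> i k it kt; rewrite disjoint_sym disjoint_subset; apply/subsetP => y; rewrite !inE => /andP[yv /andP[y1 y2]].
  rewrite negb_or yv /= negb_and -!ltnNge; apply/andP; split; last by have := anc_Xg i y yv; rewrite inE.
  apply/orP; right; have [_ h] := he i it.
  by apply: leq_trans h (leq_trans _ y1); apply: a_mono; lia.
move=> i k it kt; have [ei _] := he i it.
have rk : r.+1 + k < t.*2.+1 by lia.
have [m [x [okm hm hx /NP[ch [w [cch em wv ew adj]]]]]] := hits (e i) (r.+1 + k) ei rk.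
case/existsP: adj => y /andP[h1 h2]; exists y, w; split; last by rewrite symE.
  by rewrite inE; apply/orP; right; apply/XgP; exists ch; rewrite /grp cch em.
by rewrite inE wv ew.
Qed.

Lemma marks_minor : minor (complete_graph t) G.
Proof.
have K0 : 0 < K by lia.
(* For an edge between the last row block and the last column block, the row end [x0] is below every
   [z j], so all marks are available. *)
have [x0 [y0 [/andP[x1 x2] /andP[y1 y2] Exy]]] := hit (i := t.*2.+1) (j := K.-1) ltac:(by []) ltac:(by rewrite prednK).
have x0z : pos x0 < pos (z 0) by apply: (@row_below t.*2.+1).
have x0y : le x0 y0.
  apply: (edge_le sd Exy); apply: ltn_trans y1; apply: leq_trans x0z (z_mono _ _) => //; lia.
have x0m j : j < K -> le x0 (z j).
  move=> jK; apply: (sd_conv sd x0y); apply/andP; split.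
    by apply: leq_trans (ltnW x0z) (z_mono _ _) => //; lia.
  by apply: leq_trans (z_mono _ _) (ltnW y1); lia.
have zinc' i j : i < j -> j < K -> pos (z i) < pos (z j) by move=> ij jK; apply: zinc => //; lia.
have [||st|[f [f0 hf]]] := @chain_or_star _ _ _ _ sd K z zinc' B t x0.
- by [].
- apply: leq_trans (ltnW KB) _; rewrite (_ : marks _ _ _ _ = [set: 'I_K]) ?cardsT ?card_ord //.
  by apply/setP => j; rewrite !inE x0m.
- exact: star_minor.
apply: (chain_minor (x0 := x0) (f := f)) => //.
exists t.*2.+1; split=> //; lia.
Qed.

End GridMinor.

(** Comparing the middle cuts [a k] and [b k] tells whether a quadrant of the grid or the transpose
    of the opposite one has its rows before its columns. *)
Lemma grid_above_diagonal (V : finType) (E : rel V) (pos : V -> nat) k : symmetric E ->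
  grid k.*2 (quot pos pos E) -> exists a b : nat -> nat,
  [/\ a k <= b 0, forall i, i < k -> a i <= a i.+1 &
    forall i j, i < k -> j < k -> exists x y, [/\ a i <= pos x < a i.+1, b j <= pos y < b j.+1 & E x y]].
Proof.
move=> symE [a [b ab]].
have H i j : i < k.*2 -> j < k.*2 -> exists x y,
    [/\ a i <= pos x < a i.+1, b j <= pos y < b j.+1 & E x y].
  move=> ik jk; have [_x [_y [h1 h2 /quotP[x [y [e1 e2 Exy]]]]]] := ab i j ik jk.
  by exists x, y; rewrite e1 e2.
have [le|/ltnW le] := leqP (a k) (b k).
  exists a, (fun j => b (k + j)); rewrite addn0; split=> // [i ik|i j ik jk].
    by have [||x [y [h _ _]]] := H i i; lia.
  by rewrite addnS; apply: H; lia.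
exists b, (fun j => a (k + j)); rewrite addn0; split=> // [i ik|i j ik jk].
  by have [||x [y [_ h _]]] := H i i; lia.
have [||x [y [h1 h2 h3]]] := H (k + j) i; try lia.
by exists y, x; rewrite addnS symE.
Qed.

Lemma grid_minor t : exists2 k, 1 < k & forall (G : sgraph) (le : rel G) pos,
  sorted_dfs (@sedge G) le pos -> grid k (quot pos pos (@sedge G)) -> minor (complete_graph t) G.
Proof.
case: t => [|t'].
  exists 2 => // G le pos _ _; exists (fun=> set0); split=> [] [] //.
set t := t'.+1; have t0 : 0 < t by [].
clearbody t => {t'}.
have [K KB] : exists K, chain_bound (star_bound t t).*2.+1 t < K by exists (chain_bound (star_bound t t).*2.+1 t).+1.
(* There are $2t+1$ row blocks for the star lemma and a last one for [x0]; each of the $K+1$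
   vertices [z j] takes up two column blocks. *)
have [k tk Kk] : exists2 k, t.*2.+2 <= k & K.+1.*2 <= k.
  by exists (t.*2.+2 + K.+1.*2); rewrite ?leq_addr ?leq_addl.
exists k.*2; first by lia.
move=> G le pos sd /(grid_above_diagonal (@sedge_sym G))[a [b [ab ainc H]]].
(* The [z j] are taken in even column blocks, so that the odd blocks lie strictly between
   consecutive ones. *)
have zex j : exists z : G, j < K.+1 -> b j.*2 <= pos z < b j.*2.+1.
  have [jK|_] := ltnP j K.+1.
    have [||x [y [_ h _]]] := H 0 j.*2; [lia | lia | by exists y].
  have [||x _] := H 0 0; [lia | lia | by exists x].
have [z hz] := choice zex.
have binc j : j < k -> b j <= b j.+1 by move=> jk; have [||x [y [_ h _]]] := H 0 j; lia.
have bmono := nondecr_upto binc.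
apply: (@marks_minor G le pos sd t K a z).
- by [].
- by [].
- by move=> i it; apply: ainc; lia.
- move=> i j ij jK; have h1 := hz i ltac:(lia); have h2 := hz j ltac:(lia).
  have := bmono i.*2.+1 j.*2 ltac:(lia) ltac:(lia); lia.
- have := hz 0 ltac:(by []); rewrite double0; have : a t.*2.+2 <= a k; last by lia.
  exact: (nondecr_upto ainc).
move=> i j it jK; have [||x [y [h1 h2 h3]]] := H i j.*2.+1; [lia | lia |].
have h4 := hz j ltac:(lia); have h5 := hz j.+1 ltac:(lia); rewrite doubleS in h5.
by exists x, y; split=> //; lia.
Qed.

(** * Contraction sequences from interval partitions *)

Section Refinement.
Variable T : finType.
Implicit Types (P Q X Y : {set {set T}}) (A B C R : {set T}).

Definition refines P Q := forall A, A \in P -> exists2 B, B \in Q & A \subset B.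

Lemma refines_refl P : refines P P. Proof. by move=> A; exists A. Qed.

Lemma refines_trans P Q X : refines P Q -> refines Q X -> refines P X.
Proof.
move=> h1 h2 A /h1[B /h2[C CX BC] AB]; exists C => //; exact: subset_trans BC.
Qed.

Lemma partition_eq P A B x : partition P [set: T] -> A \in P -> B \in P -> x \in A -> x \in B -> A = B.
Proof.
move=> /and3P[_ /trivIsetP dis _] AP BP xA xB; apply/eqP; apply: contraT => ne.
by rewrite (disjointFr (dis A B AP BP ne) xA) in xB.
Qed.

Lemma partition_part P x : partition P [set: T] -> exists2 A, A \in P & x \in A.
Proof.
move=> pP; have : x \in finset.cover P by rewrite (cover_partition pP) in_setT.
by case/bigcupP=> A AP xA; exists A.
Qed.

Lemma partition_nonempty P A : partition P [set: T] -> A \in P -> exists x, x \in A.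
Proof.
by move=> /and3P[_ _ n0] AP; apply/set0Pn; apply: contraNneq n0 => <-.
Qed.

Lemma refine_path P Q : partition P [set: T] -> partition Q [set: T] -> refines P Q ->
  exists s, [/\ path (@merge_parts T) P s, last P s = Q &
    forall P', P' \in P :: s -> [/\ partition P' [set: T], refines P P' & refines P' Q]].
Proof.
have [n] := ubnP #|P|; elim: n P => // n IH P; rewrite ltnS => cP pP pQ rPQ.
have [[A [B [AP BP AB [C CQ /andP[sAC BC]]]]]|nex] := pselect (exists A B, [/\ A \in P, B \in P, A != B &
    exists2 C, C \in Q & (A \subset C) && (B \subset C)]).
  pose P1 := (A :|: B) |: (P :\ A :\ B).
  have m1 : merge_parts P P1.
    by apply/exists_inP; exists A => //; apply/exists_inP; exists B; rewrite // AB eqxx.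
  have p1 := merge_parts_partition pP m1.
  have c1 : #|P1| < #|P|.
    rewrite (cardsD1 A P) AP (cardsD1 B (P :\ A)) !inE eq_sym AB BP /=.
    by rewrite cardsU1 !add1n ltnS; case: (_ \notin _); rewrite /= ?add0n ?add1n.
  have r1 : refines P P1.
    move=> D DP; have [->|nA] := eqVneq D A; first by exists (A :|: B); rewrite ?subsetUl // !inE eqxx.
    have [->|nB] := eqVneq D B; first by exists (A :|: B); rewrite ?subsetUr // !inE eqxx.
    by exists D => //; rewrite !inE nA nB DP orbT.
  have r1Q : refines P1 Q.
    move=> D; rewrite !inE => /orP[/eqP->|/and3P[_ _ /rPQ//]].
    by exists C => //; rewrite subUset sAC.
  have [s [s1 s2 s3]] := IH P1 (leq_trans c1 cP) p1 pQ r1Q.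
  exists (P1 :: s); split=> //=; first by rewrite m1.
  move=> P'; rewrite inE => /orP[/eqP->|/s3[h1 h2 h3]]; first by split=> //; apply: refines_refl.
  by split=> //; apply: refines_trans r1 h2.
have same A C : A \in P -> C \in Q -> A \subset C -> A = C.
  move=> AP CQ sAC; apply/eqP; rewrite eqEsubset sAC; apply/subsetP => y yC.
  have [A' A'P yA'] := partition_part y pP; have [C' C'Q A'C'] := rPQ _ A'P.
  have e : C' = C by apply: (partition_eq pQ C'Q CQ (subsetP A'C' _ yA') yC).
  rewrite e in A'C'; have [->//|ne] := eqVneq A A'.
  by case: nex; exists A, A'; split=> //; exists C; rewrite // sAC.
exists [::]; split=> //.
  apply/setP => C; apply/idP/idP => CP.
    by have [D DQ CD] := rPQ C CP; rewrite (same C D).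
  have [x xC] := partition_nonempty pQ CP; have [A AP xA] := partition_part x pP.
  have [C' C'Q sAC'] := rPQ A AP.
  have e : C' = C by apply: (partition_eq pQ C'Q CP (subsetP sAC' _ xA) xC).
  by rewrite -e -(same A C').
by move=> P'; rewrite inE => /eqP->; split=> //; apply: refines_refl.
Qed.

Section Errors.
Variables (X0 : eqType) (M : T -> T -> X0).

Lemma constant_zone_sub R C R' C' : R \subset R' -> C \subset C' ->
  constant_zone M R' C' -> constant_zone M R C.
Proof.
move=> /subsetP RR /subsetP CC h; apply/forall_inP => i iR; apply/forall_inP => j jC;
  apply/forall_inP => i' iR'; apply/forall_inP => j' jC'.
exact: (implyP (forallP (implyP (forallP (implyP (forallP (implyP (forallP h i) (RR _ iR)) j) (CC _ jC)) i') (RR _ iR')) j') (CC _ jC')).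
Qed.

Definition max_error P e := forall R, R \in P -> #|[set C in P | ~~ constant_zone M R C]| <= e.

(** Zones that are constant for [Q] stay constant when refined, and a part of [Q] contains at most
    [k] parts of [Y], each of which contains a part of [P]. *)
Lemma error_between P Q X Y k e : partition P [set: T] -> partition Q [set: T] ->
  partition Y [set: T] ->
  refines P Y -> refines X Q -> refines Y Q ->
  (forall C, C \in Q -> #|[set A in P | A \subset C]| <= k) -> max_error Q e ->
  forall R, R \in X -> #|[set C in Y | ~~ constant_zone M R C]| <= e * k.
Proof.
move=> pP pQ pY rPY rXQ rYQ hk he R RX; have [R' R'Q RR'] := rXQ R RX.
pose F C' := [set C in Y | C \subset C'].
have cF C' : C' \in Q -> #|F C'| <= k.
  move=> C'Q; apply: leq_trans (hk C' C'Q).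
  pose g (A : {set T}) := odflt set0 [pick C in Y | A \subset C].
  apply: leq_trans (leq_imset_card g _); apply/subset_leq_card/subsetP => C.
  rewrite inE => /andP[CY CC']; have [x xC] := partition_nonempty pY CY.
  have [A AP xA] := partition_part x pP; have [D DY AD] := rPY A AP.
  have eD : D = C by apply: (partition_eq pY DY CY (subsetP AD _ xA) xC).
  apply/imsetP; exists A.
    by rewrite inE AP -eD in CC' *; apply: subset_trans AD CC'.
  rewrite /g; case: pickP => [D' /andP[D'Y AD']|/(_ C)] /=; last by rewrite CY -eD AD.
  by apply: (partition_eq pY CY D'Y xC (subsetP AD' _ xA)).
have sub : [set C in Y | ~~ constant_zone M R C] \subset
    \bigcup_(C' in [set C' in Q | ~~ constant_zone M R' C']) F C'.
  apply/subsetP => C; rewrite inE => /andP[CY nc]; have [C' C'Q CC'] := rYQ C CY.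
  apply/bigcupP; exists C'; last by rewrite inE CY.
  by rewrite inE C'Q; apply: contra nc; apply: constant_zone_sub.
apply: leq_trans (subset_leq_card sub) _; apply: leq_trans (leq_mul (he R' R'Q) (leqnn k)).
rewrite -sum_nat_const; elim/big_ind2: _ => [|A1 n1 A2 n2 h1 h2|C' ]; first by rewrite cards0.
  by apply: leq_trans (leq_card_setU _ _) _; apply: leq_add.
by rewrite inE => /andP[C'Q _]; apply: cF.
Qed.

Hypothesis symM : forall R C, constant_zone M R C = constant_zone M C R.

Lemma error_value_le X Y e :
  (forall R, R \in X -> #|[set C in Y | ~~ constant_zone M R C]| <= e) ->
  (forall C, C \in Y -> #|[set R in X | ~~ constant_zone M C R]| <= e) ->
  error_value M (X, Y) <= e.
Proof.
move=> h1 h2; rewrite /error_value geq_max; apply/andP; split; apply/bigmax_leqP => A AX.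
  exact: h1.
apply: leq_trans (h2 A AX); apply/eq_leq/eq_card => R; by rewrite !inE symM.
Qed.

(** Merging all rows first and then all columns keeps both partitions between [P] and [Q], so
    [error_between] applies throughout. *)
Lemma contraction_between P Q k e : partition P [set: T] -> partition Q [set: T] -> refines P Q ->
  (forall C, C \in Q -> #|[set A in P | A \subset C]| <= k) -> max_error Q e ->
  exists s, [/\ path (@contraction_step T T) (P, P) s, last (P, P) s = (Q, Q) &
    forall PQ, PQ \in s -> error_value M PQ <= e * k].
Proof.
move=> pP pQ rPQ hk he; have [s [s1 s2 s3]] := refine_path pP pQ rPQ.
have rows Y s' P0 : path (@merge_parts T) P0 s' -> path (@contraction_step T T) (P0, Y) [seq (X, Y) | X <- s'].
  elim: s' P0 => [|X s' IH] P0 //= /andP[h1 /IH->].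
  by rewrite /contraction_step /= h1 eqxx.
have cols X s' P0 : path (@merge_parts T) P0 s' -> path (@contraction_step T T) (X, P0) [seq (X, Y) | Y <- s'].
  elim: s' P0 => [|Y s' IH] P0 //= /andP[h1 /IH->].
  by rewrite /contraction_step /= h1 eqxx orbT.
have lr : last (P, P) [seq (X, P) | X <- s] = (Q, P) by rewrite (last_map (fun X => (X, P))) s2.
exists ([seq (X, P) | X <- s] ++ [seq (Q, Y) | Y <- s]); split.
- by rewrite cat_path rows //= lr cols.
- by rewrite last_cat lr (last_map (fun Y => (Q, Y))) s2.
have err X Y : X \in P :: s -> Y \in P :: s -> error_value M (X, Y) <= e * k.
  move=> /s3[pX rPX rXQ] /s3[pY rPY rYQ].
  by apply: error_value_le; apply: (error_between pP pQ).
have Qs : Q \in P :: s by rewrite -s2 mem_last.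
move=> PQ; rewrite mem_cat => /orP[] /mapP[X Xs ->]; apply: err => //.
- by rewrite inE Xs orbT.
- by rewrite inE eqxx.
- by rewrite inE Xs orbT.
Qed.

End Errors.
End Refinement.

Lemma card_factor (T T1 T2 : finType) (f1 : T -> T1) (f2 : T -> T2) (B : {set T}) :
  (forall y z, y \in B -> z \in B -> f1 y = f1 z -> f2 y = f2 z) ->
  #|[set f2 y | y in B]| <= #|[set f1 y | y in B]|.
Proof.
move=> h; have [->|[b0 b0B]] := set_0Vmem B; first by rewrite !imset0 cards0.
pose g t := if [pick y in B | f1 y == t] is Some y then f2 y else f2 b0.
apply: leq_trans (leq_imset_card g _); apply/subset_leq_card/subsetP => t /imsetP[y yB ->].
apply/imsetP; exists (f1 y); first by apply: imset_f.
rewrite /g; case: pickP => [z /andP[zB /eqP e]|/(_ y)]; last by rewrite yB eqxx.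
exact: h.
Qed.

(** Blocks of [q] are intervals of [pos]: a cut of [q] becomes the position just after the last
    vertex before that cut. *)
Lemma grid_monotone (V : finType) (pos q : V -> nat) (R : rel V) k :
  (forall x y, q x < q y -> pos x < pos y) -> grid k (quot q q R) -> grid k (quot pos pos R).
Proof.
move=> mono [a [b ab]].
pose c (a : nat -> nat) i := \max_(x | q x < a i) (pos x).+1.
have cP a' i x : a' i <= q x < a' i.+1 -> c a' i <= pos x < c a' i.+1.
  move=> /andP[h1 h2]; apply/andP; split.
    by apply/bigmax_leqP => y h; apply: mono; apply: leq_trans h h1.
  exact: (@leq_bigmax_cond _ (fun x => q x < a' i.+1) (fun x => (pos x).+1)).
exists (c a), (c b) => i j ik jk; have [_x [_y [h1 h2 /quotP[x [y [e1 e2 Rxy]]]]]] := ab i j ik jk.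
exists (pos x), (pos y); rewrite !cP ?e1 ?e2 //; split=> //; apply/quotP; by exists x, y.
Qed.

(** * Interval partitions refined by subtree ends and heavy neighbours *)

Section Intervals.
Variables (V : finType) (E le : rel V) (pos : V -> nat).
Hypothesis symE : symmetric E.
Hypothesis sd : sorted_dfs E le pos.
Let tle := sd_tree sd.
Let M := structure_matrix E le.

(** Subtrees are intervals of [pos] beginning at their root, so these last vertices determine the
    tree order. *)
Definition lastv x := [arg max_(y > x | le x y) pos y].

Lemma lastvP x : le x (lastv x) /\ forall y, le x y -> pos y <= pos (lastv x).
Proof. by rewrite /lastv; case: arg_maxnP => [|y h1 h2]; first exact: tle_refl. Qed.

Lemma le_lastv x y : pos x <= pos y -> le x y = (pos y <= pos (lastv x)).
Proof.
move=> xy; have [h1 h2] := lastvP x; apply/idP/idP; first exact: h2.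
by move=> h; apply: (sd_conv sd h1); rewrite xy.
Qed.

Lemma le_gt x y : pos y < pos x -> le x y = false.
Proof. by move=> h; apply/negP => /(sd_le sd); rewrite leqNgt h. Qed.

Definition last_rel : rel V := fun x y => lastv x == y.

(** Entries in cells (0, 2) and (1, 3) would be subtrees that cross instead of being nested; an
    entry in cell (2, 0) ensures that these rows come before those columns. *)
Lemma last_no_grid : ~ grid 4 (quot pos pos last_rel).
Proof.
move=> [a [b ab]].
have H i j : i < 4 -> j < 4 -> exists x, a i <= pos x < a i.+1 /\ b j <= pos (lastv x) < b j.+1.
  move=> i4 j4; have [_x [_y [h1 h2 /quotP[x [y [e1 e2 /eqP e]]]]]] := ab i j i4 j4.
  by exists x; rewrite e e1 e2.
have [x [/andP[x1 x2] /andP[x3 x4]]] := H 0 2 isT isT.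
have [y [/andP[y1 y2] /andP[y3 y4]]] := H 1 3 isT isT.
have [z [/andP[z1 z2] /andP[z3 z4]]] := H 2 0 isT isT.
have [w [_ /andP[w1 w2]]] := H 0 1 isT isT.
have [h1 h2] := lastvP x; have [h3 h4] := lastvP y; have [h5 h6] := lastvP z.
have l1 := sd_le sd h5.
have [l|l] := leqP (pos y) (pos (lastv x)); last by lia.
have xy : le x y by rewrite le_lastv //; lia.
by have := h2 _ (tle_trans tle xy h3); lia.
Qed.

(** All causes of a non-constant zone between two classes: a shared vertex, an edge, or a subtree
    rooted in one block and ending in the other. *)
Definition near_rel : rel V := fun x y => [|| x == y, E x y, last_rel x y | last_rel y x].

Section Quotient.
Variables (q : V -> nat).
Hypothesis qmono : forall x y, q x < q y -> pos x < pos y.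

Definition block x := [set y | q y == q x].

Lemma blockP x y : (y \in block x) = (q y == q x). Proof. by rewrite inE. Qed.

Lemma block_eq x y : (block x == block y) = (q x == q y).
Proof.
apply/eqP/eqP => [e|e]; last by apply/setP => z; rewrite !inE e.
by have : x \in block x by [rewrite inE]; rewrite e inE => /eqP.
Qed.

Definition near_blocks x y := [exists x', exists y', [&& q x' == q x, q y' == q y & near_rel x' y']].

Lemma near_blocksP x y : reflect (exists x' y', [/\ q x' = q x, q y' = q y & near_rel x' y']) (near_blocks x y).
Proof.
apply: (iffP existsP) => [[x' /existsP[y' /and3P[/eqP h1 /eqP h2 h3]]]|[x' [y' [h1 h2 h3]]]].
  by exists x', y'.
by exists x'; apply/existsP; exists y'; rewrite h1 h2 !eqxx.
Qed.

Definition nbrs x := [set block y | y in near_blocks x].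
Definition degree x := #|nbrs x|.

Lemma nbrs_near x y : near_blocks x y -> block y \in nbrs x.
Proof. by move=> h; apply: imset_f. Qed.

Lemma nbrs_block x y : q x = q y -> nbrs x = nbrs y.
Proof.
move=> e; have h z : near_blocks x z = near_blocks y z.
  by apply: eq_existsb => x'; apply: eq_existsb => y'; rewrite e.
by apply/setP => B; apply/imsetP/imsetP => -[z hz ->]; exists z; rewrite // /in_mem /= ?h // -h.
Qed.

Variable e0 : nat.
Hypothesis e00 : 0 < e0.

(* During the greedy merging heavy blocks are still singletons, and a light
   block has at most [e0] heavy neighbours; recording them in [key] keeps the
   zones of heavy blocks constant. *)
Definition heavy x := e0 < degree x.

Hypothesis heavy_single : forall x y, heavy x -> q y = q x -> y = x.

Definition key x := (q x, q (lastv x), [set h | heavy h & E h x]).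

Definition classes := preim_partition key [set: V].

Lemma classes_partition : partition classes [set: V].
Proof. exact: preim_partitionP. Qed.

Definition class x := [set y | key y == key x].

Lemma classesP A : reflect (exists x, A = class x) (A \in classes).
Proof.
apply: (iffP imsetP) => [[x _ ->]|[x ->]]; exists x => //; apply/setP => y; rewrite !inE /= eq_sym //.
Qed.

(** At most [e0] blocks in which the subtree may end, times $2^{e0}$ sets of heavy neighbours. *)
Definition key_bound := e0 * 2 ^ e0.

Lemma key_bound_gt0 : 0 < key_bound.
Proof. by rewrite muln_gt0 e00 expn_gt0. Qed.

Lemma near_last x : near_blocks x (lastv x).
Proof. by apply/near_blocksP; exists x, (lastv x); split=> //; rewrite /near_rel /last_rel eqxx !orbT. Qed.

Lemma near_same x y : q x = q y -> near_blocks x y.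
Proof. by move=> e; apply/near_blocksP; exists x, x; split=> //; rewrite /near_rel eqxx. Qed.

Lemma classes_in_block x : #|[set class y | y in block x]| <= key_bound.
Proof.
have [hx|lx] := boolP (heavy x).
  apply: leq_trans key_bound_gt0; rewrite -(cards1 (class x)).
  apply/subset_leq_card/subsetP => A /imsetP[y]; rewrite blockP => /eqP e ->.
  by rewrite (heavy_single hx e) inE.
have dx : degree x <= e0 by rewrite leqNgt.
pose HH := [set h | heavy h && near_blocks x h].
have cH : #|HH| <= e0.
  apply: leq_trans dx; rewrite -(card_in_imset (f := block)).
    apply/subset_leq_card/subsetP => B /imsetP[h]; rewrite inE => /andP[_ h1] ->; exact: nbrs_near.
  move=> h h'; rewrite !inE => /andP[h1 _] /andP[h2 _] /eqP; rewrite block_eq => /eqP e.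
  exact: heavy_single.
apply: leq_trans (card_factor (f1 := fun y => (block (lastv y), [set h | heavy h & E h y])) _) _.
  move=> y z; rewrite !blockP => /eqP e1 /eqP e2 [/eqP]; rewrite block_eq => /eqP e3 e4.
  by apply/setP => u; rewrite !inE /key e1 e2 e3 e4.
apply: leq_trans (_ : #|setX (nbrs x) (powerset HH)| <= _).
  apply/subset_leq_card/subsetP => -[B H] /imsetP[y]; rewrite blockP => /eqP e [-> ->].
  rewrite in_setX powersetE (nbrs_block (esym e)) nbrs_near ?near_last //=.
  apply/subsetP => h; rewrite !inE => /andP[-> Ehy] /=; apply/near_blocksP; exists y, h; split=> //.
  by rewrite /near_rel symE Ehy orbT.
by rewrite cardsX card_powerset /key_bound; apply: leq_mul => //; rewrite leq_exp2l.
Qed.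

Lemma key_eq x y : y \in class x -> [/\ q y = q x, q (lastv y) = q (lastv x) &
  forall h, heavy h -> E h y = E h x].
Proof.
rewrite inE => /eqP[e1 e2 e3]; split=> // h hh.
by have := congr1 (fun S : {set V} => h \in S) e3; rewrite !inE hh.
Qed.

Lemma pos_lt x y x' y' : q x < q y -> q x' = q x -> q y' = q y -> pos x' < pos y'.
Proof. by move=> h e1 e2; apply: qmono; rewrite e1 e2. Qed.

(** All subtrees rooted in [class x] end in the same block; when this is not the block of [y], they
    contain that block entirely or miss it. *)
Lemma le_const x y x' y' : q x < q y -> q (lastv x) <> q y -> x' \in class x -> y' \in class y ->
  le x' y' = (q y < q (lastv x)).
Proof.
move=> lt ne /key_eq[e1 e2 _] /key_eq[e3 _ _].
rewrite le_lastv; last by apply/ltnW; apply: pos_lt lt e1 e3.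
have : q (lastv x) != q y by apply/eqP.
rewrite neq_ltn => /orP[h|h].
  by rewrite ltnNge (ltnW h); apply/negbTE; rewrite -ltnNge; apply: qmono; rewrite e2 e3.
by rewrite h; apply/ltnW; apply: qmono; rewrite e2 e3.
Qed.

Lemma constant_zoneI x y b1 b2 b3 b4 : q x <> q y ->
  (forall x' y', x' \in class x -> y' \in class y -> [/\ E x' y' = b1, E y' x' = b2, le x' y' = b3 & le y' x' = b4]) ->
  constant_zone M (class x) (class y).
Proof.
move=> ne h; apply/forall_inP => i iR; apply/forall_inP => j jC;
  apply/forall_inP => i' iR'; apply/forall_inP => j' jC'.
have neq u v : u \in class x -> v \in class y -> (u == v) = false.
  move=> /key_eq[e1 _ _] /key_eq[e2 _ _]; apply/eqP => e; by case: ne; rewrite -e1 -e2 e.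
rewrite /M /structure_matrix !neq //.
have [-> -> -> ->] := h i j iR jC; by have [-> -> -> ->] := h i' j' iR' jC'.
Qed.

Lemma far_constant x y : ~~ near_blocks x y -> constant_zone M (class x) (class y).
Proof.
move=> nn; have ne : q x <> q y by move=> e; case/negP: nn; apply: near_same.
have nE x' y' : x' \in class x -> y' \in class y -> E x' y' = false.
  move=> /key_eq[e1 _ _] /key_eq[e2 _ _]; apply/negP => h; case/negP: nn; apply/near_blocksP.
  by exists x', y'; rewrite /near_rel h orbT.
have n1 : q (lastv x) <> q y.
  move=> e; case/negP: nn; apply/near_blocksP; exists x, (lastv x); split=> //.
  by rewrite /near_rel /last_rel eqxx !orbT.
have n2 : q (lastv y) <> q x.
  move=> e; case/negP: nn; apply/near_blocksP; exists (lastv y), y; split=> //.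
  by rewrite /near_rel /last_rel eqxx !orbT.
have : q x != q y by apply/eqP.
rewrite neq_ltn => /orP[lt|lt].
  apply: (@constant_zoneI x y false false (q y < q (lastv x)) false ne) => x' y' h1 h2.
  rewrite [E y' x']symE nE // (le_const lt n1) //; split=> //.
  have [e1 _ _] := key_eq h1; have [e2 _ _] := key_eq h2; exact/le_gt/(pos_lt lt).
apply: (@constant_zoneI x y false false false (q x < q (lastv y)) ne) => x' y' h1 h2.
rewrite [E y' x']symE nE // [le y' x'](le_const lt n2) //; split=> //.
have [e1 _ _] := key_eq h1; have [e2 _ _] := key_eq h2; exact/le_gt/(pos_lt lt).
Qed.

(** A heavy block is a single vertex and [key] fixes the adjacency to it. What can still vary is the
    order, and only in the block where the subtree at [x] ends. *)
Lemma heavy_constant x y : heavy x -> q y <> q (lastv x) -> constant_zone M (class x) (class y).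
Proof.
move=> hx nl; have [e|/eqP ne] := eqVneq (q x) (q y).
  apply/forall_inP => i /key_eq[e1 _ _]; apply/forall_inP => j /key_eq[e2 _ _];
    apply/forall_inP => i' /key_eq[e3 _ _]; apply/forall_inP => j' /key_eq[e4 _ _].
  have -> := heavy_single hx e1; have -> := heavy_single hx e3.
  have -> := heavy_single hx (etrans e2 (esym e)).
  by have -> := heavy_single hx (etrans e4 (esym e)).
have one x' : x' \in class x -> x' = x by move=> /key_eq[e1 _ _]; apply: heavy_single.
have Ec y' : y' \in class y -> E x y' = E x y by move=> /key_eq[_ _ h]; apply: h.
have : q x != q y by apply/eqP.
rewrite neq_ltn => /orP[lt|lt].
  apply: (@constant_zoneI x y (E x y) (E x y) (q y < q (lastv x)) false ne) => x' y' h1 h2.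
  rewrite (le_const lt (nesym nl)) // (one x') // [E y' _]symE Ec //; split=> //.
  have [e2 _ _] := key_eq h2; exact/le_gt/(pos_lt lt).
have [e|/eqP ne'] := eqVneq (q (lastv y)) (q x); last first.
  apply: (@constant_zoneI x y (E x y) (E x y) false (q x < q (lastv y)) ne) => x' y' h1 h2.
  rewrite [le y' x'](le_const lt ne') // (one x') // [E y' _]symE Ec //; split=> //.
  have [e2 _ _] := key_eq h2; exact/le_gt/(pos_lt lt).
(* Here the subtrees rooted in [class y] all end in the singleton block of [x], hence all contain
   [x]. *)
apply: (@constant_zoneI x y (E x y) (E x y) false true ne) => x' y' h1 h2.
rewrite (one x') // [E y' _]symE Ec //; have [e2 e3 _] := key_eq h2; split=> //.
  exact/le_gt/(pos_lt lt).
rewrite le_lastv; last by apply/ltnW/(pos_lt lt).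
by rewrite (heavy_single hx (etrans e3 e)) leqnn.
Qed.

Lemma structure_sym R C : constant_zone M R C = constant_zone M C R.
Proof.
have swap x y x' y' : M x y = M x' y' -> M y x = M y' x'.
  rewrite /M /structure_matrix => -[e1 e2 e3 e4 e5].
  by rewrite eq_sym e1 eq_sym e2 e3 e4 e5.
by apply/idP/idP => h; apply/forall_inP => i iC; apply/forall_inP => j jQ;
  apply/forall_inP => i' iC'; apply/forall_inP => j' jQ'; apply/eqP/swap/eqP;
  exact: (implyP (forallP (implyP (forallP (implyP (forallP (implyP (forallP h j) jQ) i) iC) j') jQ') i') iC').
Qed.

(** A heavy row can err only on the classes of one block, a light row only on those of its at most
    [e0] near blocks. *)
Lemma classes_error : max_error M classes (e0 * key_bound).
Proof.
move=> R /classesP[x ->].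
have inblock y : class y \in [set class z | z in block y] by apply: imset_f; rewrite blockP.
have [hx|lx] := boolP (heavy x).
  apply: (@leq_trans (1 * key_bound)); last by rewrite leq_mul2r e00 orbT.
  rewrite mul1n; apply: leq_trans (classes_in_block (lastv x)).
  apply/subset_leq_card/subsetP => C; rewrite inE => /andP[/classesP[y ->] nc].
  have [e|/eqP ne] := eqVneq (q y) (q (lastv x)); last by rewrite heavy_constant in nc.
  by apply: imset_f; rewrite blockP e.
have dx : degree x <= e0 by rewrite leqNgt.
have sub : [set C in classes | ~~ constant_zone M (class x) C] \subset
    \bigcup_(B in nbrs x) [set class z | z in B].
  apply/subsetP => C; rewrite inE => /andP[/classesP[y ->] nc].
  have [h|h] := boolP (near_blocks x y); last by rewrite far_constant in nc.
  by apply/bigcupP; exists (block y); rewrite ?nbrs_near.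
apply: leq_trans (subset_leq_card sub) _; apply: leq_trans (leq_mul dx (leqnn _)).
rewrite /degree -sum_nat_const; elim/big_ind2: _ => [|A1 n1 A2 n2 h1 h2|B]; first by rewrite cards0.
  by apply: leq_trans (leq_card_setU _ _) _; apply: leq_add.
by case/imsetP=> y _ ->; apply: classes_in_block.
Qed.

End Quotient.
End Intervals.

(** * Greedy merging of consecutive intervals *)

Section Greedy.
Variables (V : finType) (E le : rel V) (pos : V -> nat).
Hypothesis symE : symmetric E.
Hypothesis sd : sorted_dfs E le pos.
Let M := structure_matrix E le.
Let tle := sd_tree sd.
Let near := near_rel E le pos.
Variables (k c1 c4 : nat).
Hypothesis no_grid : ~ grid k (quot pos pos E).
Hypothesis mt1 : forall n M, ~ grid k M -> ones M n <= c1 * n.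
Hypothesis mt4 : forall n M, ~ grid 4 M -> ones M n <= c4 * n.

Let c := 1 + c1 + 2 * c4.

(** The terms of [c] count the diagonal, the edges, and [last_rel] together with its transpose. *)
Lemma near_ones (q : V -> nat) m : (forall x y, q x < q y -> pos x < pos y) ->
  ones (quot q q near) m <= c * m.
Proof.
move=> qmono; have g1 : ~ grid k (quot q q E) by move/(grid_monotone qmono).
have g2 : ~ grid 4 (quot q q (last_rel le pos)) by move/(grid_monotone qmono); apply: (last_no_grid sd).
apply: (@leq_trans (\sum_(i < m) \sum_(j < m) ((i == j) + quot q q E i j + quot q q (last_rel le pos) i j + quot q q (last_rel le pos) j i))).
  apply: leq_sum => i _; apply: leq_sum => j _.
  case h : (quot q q near i j) => //; case/quotP: h => x [y [e1 e2]].
  case/or4P=> [/eqP e|h|h|h].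
  - have -> : i = j by apply: val_inj; rewrite /= -e1 -e2 e.
    by rewrite eqxx; lia.
  - have -> : quot q q E i j by apply/quotP; exists x, y.
    by lia.
  - have -> : quot q q (last_rel le pos) i j by apply/quotP; exists x, y.
    by lia.
  - have -> : quot q q (last_rel le pos) j i by apply/quotP; exists y, x.
    by lia.
under eq_bigr => i _ do rewrite !big_split /=.
rewrite !big_split /=.
have -> : \sum_(i < m) \sum_(j < m) (i == j) = m.
  rewrite -[RHS]card_ord -sum1_card; apply: eq_bigr => i _.
  by rewrite (bigD1 i) //= eqxx big1 // => j ji; rewrite eq_sym (negPf ji).
have h1 : \sum_(i < m) \sum_(j < m) quot q q E i j <= c1 * m := mt1 _ g1.
have h2 : \sum_(i < m) \sum_(j < m) quot q q (last_rel le pos) i j <= c4 * m := mt4 _ g2.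
have h3 : \sum_(i < m) \sum_(j < m) quot q q (last_rel le pos) j i <= c4 * m by rewrite exchange_big; apply: mt4.
by rewrite /c !mulnDl mul1n mul0n addn0 -!addnA leq_add2l !leq_add.
Qed.

Definition row_ones (q : V -> nat) m i := \sum_(j < m) (quot q q near i j : nat).

(** The $m-1$ consecutive pairs of rows have at most $2cm \le 4c(m-1)$ ones altogether, so some pair
    is below the average $4c$. *)
Lemma light_pair q m : 1 < m -> (forall x y, q x < q y -> pos x < pos y) ->
  exists2 a, a.+1 < m & row_ones q m a + row_ones q m a.+1 <= 4 * c.
Proof.
move=> m1 qmono; have h := near_ones m qmono; apply: contrapT => nex.
have big a : a < m.-1 -> 4 * c < row_ones q m a + row_ones q m a.+1.
  by move=> am; rewrite ltnNge; apply/negP => hle; apply: nex; exists a => //; lia.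
have hs : \sum_(0 <= i < m.-1.+1) row_ones q m i <= c * m.
  by rewrite (prednK (ltnW m1)) big_mkord; exact: h.
have s1 : \sum_(a < m.-1) row_ones q m a <= c * m.
  by apply: leq_trans hs; rewrite -(big_mkord xpredT (row_ones q m)) big_nat_recr //= leq_addr.
have s2 : \sum_(a < m.-1) row_ones q m a.+1 <= c * m.
  by apply: leq_trans hs; rewrite -(big_mkord xpredT (fun a => row_ones q m a.+1)) big_nat_recl //= leq_addl.
have : \sum_(a < m.-1) (4 * c).+1 <= \sum_(a < m.-1) (row_ones q m a + row_ones q m a.+1).
  by apply: leq_sum => a _; apply: big.
rewrite big_split sum_nat_const card_ord /= mulnS mulnCA => hle.
have p0 : 0 < m.-1 by lia.
have cp : c <= m.-1 * c by rewrite leq_pmull.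
have ecm : c * m = m.-1 * c + c by rewrite -{1}(prednK (ltnW m1)) mulnS addnC mulnC.
rewrite ecm in s1 s2; move: (leq_trans hle (leq_add s1 s2)).
by move: (m.-1 * c) (c) (m.-1) cp p0 => x y p; lia.
Qed.

(** A merged block has degree at most $4c$, so it is never heavy and heavy blocks remain
    singletons. *)
Let e0 := (4 * c).+1.
Let kb := key_bound e0.

(** [q] need not take every value below [m]: empty blocks are allowed, as at the start, where [q] is
    [pos]. *)
Definition valid q m := [/\ forall x, q x < m, forall x y, q x < q y -> pos x < pos y &
  forall x y, heavy E le pos q e0 x -> q y = q x -> y = x].

Definition block_sets (q : V -> nat) m i := [set [set y | q y == j] | j : 'I_m & quot q q near i j].

Lemma card_block_sets q m i : #|block_sets q m i| <= row_ones q m i.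
Proof.
apply: leq_trans (leq_imset_card _ _) _; rewrite /row_ones -sum1_card big_mkcond /=.
by apply: leq_sum => j _; rewrite inE; case: (quot _ _ _ _ _).
Qed.

Definition merge_at (q : V -> nat) a x := if q x <= a then q x else (q x).-1.

Lemma merge_at_same q a x y : merge_at q a x = merge_at q a y -> q x = q y \/
  (a <= q x <= a.+1) && (a <= q y <= a.+1).
Proof. by rewrite /merge_at; case: (leqP (q x) a); case: (leqP (q y) a); lia. Qed.

Lemma merge_at_eq q a x y : q x = q y -> merge_at q a x = merge_at q a y.
Proof. by rewrite /merge_at => ->. Qed.

Lemma degree_merge_other q a x : ~~ (a <= q x <= a.+1) ->
  degree E le pos (merge_at q a) x <= degree E le pos q x.
Proof.
move=> nx; pose g (B : {set V}) := [set y | [exists z in B, merge_at q a z == merge_at q a y]].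
apply: leq_trans (leq_imset_card g _); apply/subset_leq_card/subsetP => B /imsetP[y].
case/near_blocksP=> x' [y' [e1 e2 h]] ->.
have qx : q x' = q x by case: (merge_at_same e1) => // /andP[_ h']; rewrite h' in nx.
apply/imsetP; exists (block q y').
  by apply: nbrs_near; apply/near_blocksP; exists x', y'.
apply/setP => z; rewrite !inE -e2; apply/eqP/exists_inP => [e|[w]].
  by exists y'; rewrite ?inE // e.
by rewrite inE => /eqP/(merge_at_eq a)<- /eqP<-.
Qed.

Lemma degree_merge q m a x : (forall x, q x < m) -> a <= q x <= a.+1 ->
  degree E le pos (merge_at q a) x <= row_ones q m a + row_ones q m a.+1.
Proof.
move=> qm hx; pose g (B : {set V}) := [set y | [exists z in B, merge_at q a z == merge_at q a y]].
apply: (@leq_trans #|block_sets q m a :|: block_sets q m a.+1|); last first.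
  by apply: leq_trans (leq_card_setU _ _) _; apply: leq_add; apply: card_block_sets.
apply: leq_trans (leq_imset_card g _); apply/subset_leq_card/subsetP => B /imsetP[y].
case/near_blocksP=> x' [y' [e1 e2 h]] ->.
have qx : (q x' == a) || (q x' == a.+1).
  by case: (merge_at_same e1) => [->|/andP[h' _]]; [move: hx | move: h']; lia.
apply/imsetP; exists (block q y').
  have inb i : q x' = i -> block q y' \in block_sets q m i.
    move=> e; apply/imsetP; exists (Ordinal (qm y')) => //.
    by rewrite inE; apply/quotP; exists x', y'.
  by rewrite in_setU; case/orP: qx => /eqP e; rewrite (inb _ e) ?orbT.
apply/setP => z; rewrite !inE -e2; apply/eqP/exists_inP => [e|[w]].
  by exists y'; rewrite ?inE // e.
by rewrite inE => /eqP/(merge_at_eq a)<- /eqP<-.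
Qed.

Lemma classes_at q m i : valid q m -> #|[set class E le pos q e0 y | y in [set y | q y == i]]| <= kb.
Proof.
move=> [_ qmono hs]; have [->|[x]] := set_0Vmem [set y | q y == i]; first by rewrite imset0 cards0.
rewrite inE => /eqP e; rewrite -e; exact: (@classes_in_block V E le pos symE q e0 isT hs x).
Qed.

(** Degrees do not grow outside the merged block, and that block is light, so no vertex becomes
    heavy. Merging indices and dropping heavy vertices both coarsen [key], whence the refinement. *)
Lemma valid_merge q m a : valid q m -> a.+1 < m -> row_ones q m a + row_ones q m a.+1 <= 4 * c ->
  [/\ valid (merge_at q a) m.-1,
      forall x, heavy E le pos (merge_at q a) e0 x -> heavy E le pos q e0 x &
      refines (classes E le pos q e0) (classes E le pos (merge_at q a) e0)].
Proof.
move=> [qm qmono hs] am ra.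
have hv x : heavy E le pos (merge_at q a) e0 x -> ~~ (a <= q x <= a.+1).
  move=> h; apply/negP => hx; move: h; rewrite /heavy ltnNge => /negP; apply.
  by apply: leq_trans (degree_merge qm hx) _; apply: leq_trans ra _; rewrite /e0 leqnSn.
have hv2 x : heavy E le pos (merge_at q a) e0 x -> heavy E le pos q e0 x.
  by move=> h; have := degree_merge_other (hv x h); apply: leq_trans.
split=> //.
  split.
  - by move=> x; rewrite /merge_at; case: (leqP (q x) a); have := qm x; lia.
  - move=> x y h; apply: qmono; move: h; rewrite /merge_at; case: (leqP (q x) a); case: (leqP (q y) a); lia.
  move=> x y h e; apply: hs; first exact: hv2.
  by case: (merge_at_same e) => // /andP[_ h']; have := hv x h; rewrite h'.
move=> A /classesP[x ->]; exists (class E le pos (merge_at q a) e0 x); first by apply/classesP; exists x.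
apply/subsetP => y; rewrite !inE => /eqP[e1 e2 e3]; apply/eqP.
rewrite /key (merge_at_eq a e1) (merge_at_eq a e2); congr pair.
apply/setP => h; have := congr1 (fun S : {set V} => h \in S) e3; rewrite !inE.
by case hh : (heavy E le pos (merge_at q a) e0 h) => //=; rewrite (hv2 _ hh).
Qed.

(** Between two consecutive systems of classes, the error [e0 * kb] of the coarser one is multiplied
    by the at most [2 * kb] old classes inside a new one. *)
Definition error_bound := e0 * kb * (2 * kb).

Lemma greedy_sequence m q : valid q m -> exists s,
  let P := classes E le pos q e0 in
  [/\ path (@contraction_step V V) (P, P) s, final_pair (last (P, P) s) &
      forall PQ, PQ \in (P, P) :: s -> error_value M PQ <= error_bound].
Proof.
have kb0 : 0 < kb by apply: key_bound_gt0.
have err0 q' m' : valid q' m' -> max_error M (classes E le pos q' e0) (e0 * kb).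
  by move=> [_ q'mono hs']; apply: (classes_error symE sd q'mono _ hs').
have self q' m' : valid q' m' -> error_value M (classes E le pos q' e0, classes E le pos q' e0) <= error_bound.
  move=> v; have le0 : e0 * kb <= error_bound by apply: leq_pmulr; rewrite muln_gt0 kb0.
  by apply: error_value_le => [|R hR|R hR]; [apply: structure_sym | |]; apply: leq_trans (err0 _ _ v _ hR) le0.
elim: m q => [|m IH] q v.
  exists [::]; split=> //; last by move=> PQ; rewrite inE => /eqP->; apply: self v.
  have h : #|classes E le pos q e0| <= 1.
    rewrite leqNgt; apply/negP => /card_gt1P[A [B [/classesP[x _] _ _]]].
    by case: v => /(_ x).
  by rewrite /final_pair /= h.
(* A single block has degree at most 1, so nothing is heavy and all keys coincide. *)
have [m0|m0] := posnP m.
  exists [::]; split=> //; last by move=> PQ; rewrite inE => /eqP->; apply: self v.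
  case: (v) => qm qmono hs; have q0 x : q x = 0 by have := qm x; rewrite m0; case: (q x).
  have light x : heavy E le pos q e0 x = false.
    apply/negP; rewrite /heavy ltnNge => /negP; apply.
    apply: (@leq_trans 1) => //; rewrite -(cards1 (block q x)).
    apply/subset_leq_card/subsetP => B /imsetP[y _ ->]; rewrite inE block_eq !q0 //.
  have h : #|classes E le pos q e0| <= 1.
    rewrite -(cards1 [set: V]); apply/subset_leq_card/subsetP => A /classesP[x ->].
    rewrite inE; apply/eqP/setP => y; rewrite !inE /key !q0.
    by apply/eqP; congr pair; apply/setP => z; rewrite !inE light.
  by rewrite /final_pair /= h.
case: (v) => qm qmono hs.
have [|a am ra] := light_pair (q := q) (m := m.+1) _ qmono; first by rewrite ltnS.
have [v' hv ref] := valid_merge v am ra.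
have [s2 [p2 f2 e2]] := IH _ v'.
have pq := classes_partition E le pos q e0; have pq' := classes_partition E le pos (merge_at q a) e0.
have inside C : C \in classes E le pos (merge_at q a) e0 ->
    #|[set A in classes E le pos q e0 | A \subset C]| <= 2 * kb.
  move=> /classesP[x ->].
  (* A new block is the union of at most two old ones, each with at most [kb] classes. *)
  have [i [j hij]] : exists i j, forall y, merge_at q a y = merge_at q a x -> q y = i \/ q y = j.
    have [hx|hx] := boolP (a <= q x <= a.+1).
      exists a, a.+1 => y /merge_at_same[->|/andP[h _]]; [move: hx|move: h]; lia.
    by exists (q x), (q x) => y /merge_at_same[->|/andP[_ h]]; [left | rewrite h in hx].
  apply: leq_trans (_ : #|[set class E le pos q e0 y | y in [set y | q y == i]] :|:
      [set class E le pos q e0 y | y in [set y | q y == j]]| <= _); last first.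
    apply: leq_trans (leq_card_setU _ _) _; rewrite mul2n -addnn; apply: leq_add; exact: classes_at v.
  apply/subset_leq_card/subsetP => A; rewrite inE => /andP[/classesP[y ->] sub].
  have : y \in class E le pos (merge_at q a) e0 x by apply: (subsetP sub); rewrite inE.
  rewrite inE => /eqP[e _ _]; rewrite inE.
  by case: (hij y e) => ey; apply/orP; [left | right]; apply: imset_f; rewrite inE ey.
have [s1 [p1 l1 e1]] := contraction_between (structure_sym E le) pq pq' ref inside (err0 _ _ v').
exists (s1 ++ s2); split.
- by rewrite cat_path p1 l1.
- by rewrite last_cat l1.
move=> PQ; rewrite inE mem_cat => /or3P[/eqP->|/e1//|h]; first exact: self v.
by apply: e2; rewrite inE h orbT.
Qed.

Lemma sorted_dfs_sequence : exists s, contraction_sequence s /\ sequence_error M s <= error_bound.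
Proof.
have v : valid pos (\max_(x : V) pos x).+1.
  split=> // [x|x y _ /(sd_inj sd)//]; rewrite ltnS; exact: leq_bigmax.
have [s] := greedy_sequence v.
(* As [pos] is injective, the greedy sequence starts exactly at the partition into singletons. *)
have -> : classes E le pos pos e0 = singletons V.
  have cl x : class E le pos pos e0 x = [set x].
    apply/setP => y; rewrite !inE; apply/eqP/eqP => [[/(sd_inj sd)]//|->//].
  by apply/setP => A; apply/classesP/imsetP => [[x ->]|[x _ ->]]; exists x; rewrite // cl.
move=> [h1 h2 h3]; exists s; split; first by apply/andP.
by rewrite /sequence_error; apply/bigmax_leqP_seq => PQ hPQ _; apply: h3.
Qed.

End Greedy.

Lemma minor_induced (H G : sgraph) (W : {set G}) : minor H (induced W) -> minor H G.
Proof.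
move=> [B [B1 B2 B3 B4]]; exists (fun u => [set val x | x in B u]); split.
- by move=> u; have /set0Pn[x xB] := B1 u; apply/set0Pn; exists (val x); apply: imset_f.
- move=> u; pose f (a : induced (B u)) : induced [set val x | x in B u] :=
    exist _ (val (val a)) (imset_f val (valP a)).
  have fsurj v : exists a, v = f a.
    have /imsetP[x xB e] := valP v; exists (exist _ x xB); exact: val_inj.
  move=> v w; have [a ->] := fsurj v; have [b ->] := fsurj w.
  by apply: connect_homo (B2 u a b) => p q h; apply: connect1.
- move=> u v uv; rewrite -setI_eq0 -imsetI ?imset_eq0 ?setI_eq0 ?B3 //.
  by move=> x y _ _; apply: val_inj.
by move=> u v /B4[x [y [h1 h2 h3]]]; exists (val x), (val y); split=> //; apply: imset_f.
Qed.

Lemma excludes_bounded t : exists c, forall G : sgraph,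
  ~ minor (complete_graph t) G -> spanning_twin_width G <= c.
Proof.
have [k k1 hk] := grid_minor t.
have [c1 mt1] := marcus_tardos k1; have [c4 mt4] := @marcus_tardos 4 isT.
exists (error_bound c1 c4) => G nmin; apply/bigmax_leqP => x _.
set cH := @component_connected G x; set r := component_root x.
have [le [pos sd]] := sorted_dfs_exists (@sedge_sym (component x)) r cH.
have nog : ~ grid k (quot pos pos (@sedge (component x))).
  by move/(hk _ _ _ sd)/minor_induced.
have [s [cs es]] := sorted_dfs_sequence (@sedge_sym (component x)) sd nog mt1 mt4.
apply: leq_trans es; rewrite /connected_spanning_twin_width; case: ex_minnP => n _ hn.
apply: (@leq_trans (twin_width (structure_matrix (@sedge (component x)) le))).
  by apply: hn; apply/asboolP; exists le; split=> //; [apply: sd_tree sd | apply: sd_cover sd].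
rewrite /twin_width; case: ex_minnP => n' _ hn'.
by apply: hn'; apply/asboolP; exists s.
Qed.

Theorem theorem6p1 (C : sgraph -> Prop) (monoC : monotone_class C) :
  (exists c : nat, forall G : sgraph, C G -> spanning_twin_width G <= c) <->
  (exists t : nat, forall G : sgraph, C G -> ~ minor (complete_graph t) G).
Proof.
split=> [[c hc]|[t ht]]; first exact: bounded_excludes monoC hc.
have [c hc] := excludes_bounded t.
by exists c => G /ht/hc.
Qed.
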